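(* Let $k$ be a field of characteristic $p \geq 0$ and let $g \in k[X,Y,Z]$ (polynomial ring in three variables) be of the form $g = bZ^n - a$, where $a, b \in k[X,Y]$ with $b \neq 0$ and $n \geq 2$ is an integer not divisible by $p$. Suppose that $B := k[X,Y,Z]/(g)$ is $k$-isomorphic to a polynomial ring in two variables over $k$, and identify $k[X,Y]$ with its image in $B$. Then there exist $U, V \in B$ with $B = k[U,V]$ such that $V$ is the image of $Z$ in $B$, $U \in k[X,Y]$, $b \in k[U]$, $k[X,Y] = k[U,a]$, and $k[X,Y,Z] = k[U, g, Z]$. *)

(* Defs.v *)
From HB Require Import structures.
From mathcomp Require Import all_boot all_algebra.
From mathcomp Require Import mpoly.
Set Implicit Arguments. Unset Strict Implicit. Unset Printing Implicit Defensive.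
Import GRing.Theory.
Local Open Scope ring_scope.

Definition embXY (k : fieldType) (p : {mpoly k[2]}) : {mpoly k[3]} :=
  p \mPo [tuple 'X_0; 'X_1].

Definition in_subalg (k : fieldType) (m n : nat) (t : n.-tuple {mpoly k[m]})
    (x : {mpoly k[m]}) : Prop :=
  exists P : {mpoly k[n]}, x = P \mPo t.

(* k[X,Y,Z]/(g) is k-isomorphic to the polynomial ring k[S,T] via the
   k-algebra map phi_t : X,Y,Z |-> t_0,t_1,t_2 (every k-algebra map out of
   k[X,Y,Z] has this form): phi_t is surjective with kernel the ideal (g). *)
Definition quot_iso_poly2 (k : fieldType) (g : {mpoly k[3]})
    (t : 3.-tuple {mpoly k[2]}) : Prop :=
  (forall s : {mpoly k[2]}, exists p : {mpoly k[3]}, s = p \mPo t) /\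
  (forall p : {mpoly k[3]}, p \mPo t = 0 <-> exists q : {mpoly k[3]}, p = q * g).

(* Main.v *)
Require Import Defs.
From HB Require Import structures.
From Stdlib Require Import Classical.
From mathcomp Require Import all_boot all_order all_algebra all_solvable all_field.
From mathcomp Require Import zify ring.
From mathcomp Require Import mpoly.
Set Implicit Arguments. Unset Strict Implicit. Unset Printing Implicit Defensive.
Import Order.TTheory GRing.Theory Num.Theory.
Local Open Scope ring_scope.

(** Write A = k[X,Y] and z for the image of Z in B, so that b z^n = a, and let K = k(zeta)
    with zeta a primitive n-th root of unity.

    First, z is a coordinate of the polynomial ring B. The automorphism s : z -> zeta z of
    B_K over A_K is the identity modulo z, so F = s(V) = V + z R for each variable V. The
    translations of the other variable, conjugated by s, form an action of the additive
    group which fixes F. Degenerating it to an action that is homogeneous for the weights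
    given by the bidegree (E, D) of z, say with E <= D, one gets an action fixing the top
    form Q of z. Comparing degrees in the group parameter, and excluding cusps x^q - mu y^p
    by a Jacobian argument, Q = c (x - mu y^d)^E. Since mu is separable over k it lies in k,
    so that x -> x + mu y^d lowers the bidegree of z, and one concludes by induction.

    Next, averaging a complementary variable over the powers of s gives B = k[z,U] with U a
    polynomial in z^n over A. Let x be the constant term of U. Every element of A is a
    polynomial in x modulo a, hence b divides some beta(x), and U = P(x, z^n) modulo b. So b
    divides the product of the U - P(r, z^n) over the roots r of beta. The curves
    U = P(r, z^n) on which b vanishes are pairwise disjoint because x takes distinct values
    on them; hence they are translates of one another and b is a polynomial in
    U' = U - P(r, z^n). Thus U' is integral over A and lies in its fraction field, whence U'
    is in A, up to an extension of scalars that a linear functional removes. Finally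
    A = k[U',a] by induction on the degree in z. *)

(** In positive characteristic locally nilpotent derivations are not enough, so an action is kept as
    a pair of polynomials in a parameter [s] whose constant terms are the two variables. This is how
    the invariance of [F = V + z R] reaches [z]: once [z] is heavier than [V], the top form of [F]
    is the product of those of [z] and [R].

    That the characteristic does not divide [n] serves for the primitive root, for the separability
    of [K] over [k], and for the division by [n] in the averaging. Without separability,
    [(x - mu y^d)^E] could be defined over [k] with [mu] outside [k], when [E] is a power of the
    characteristic. That [n] is at least 2 makes [zeta] different from 1. *)

(* Bivariate polynomials are [{poly {poly k}}]: the inner indeterminate ['X%:P]
   is the first variable, the outer one ['X] the second. *)
Notation bipoly k := {poly {poly k}}.

(** * Evaluation and substitution of bivariate polynomials *)

HB.lock Definition CC (k : comNzRingType) : {rmorphism k -> bipoly k} := polyC \o polyC.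

Lemma CCE (k : comNzRingType) (c : k) : c%:P%:P = CC k c.
Proof. by rewrite unlock. Qed.

Lemma CCM (k : comNzRingType) (c d : k) : CC k (c * d) = CC k c * CC k d.
Proof. exact: rmorphM. Qed.

Definition horner1 (k S : comNzRingType) (f : {rmorphism k -> S}) (x : S) :=
  horner_morph (fun a => mulrC x (f a)).
HB.instance Definition _ (k S : comNzRingType) (f : {rmorphism k -> S}) (x : S) :=
  GRing.RMorphism.on (horner1 f x).

HB.lock Definition ev2 (k S : comNzRingType) (f : {rmorphism k -> S}) (x y : S) :
  bipoly k -> S := horner_morph (fun a => mulrC y (horner1 f x a)).

Section Evaluation.
Variables (k S : comNzRingType) (f : {rmorphism k -> S}).

Lemma ev2_is_zmod_morphism x y : zmod_morphism (ev2 f x y).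
Proof. by rewrite unlock; exact: raddfB. Qed.

Lemma ev2_is_monoid_morphism x y : monoid_morphism (ev2 f x y).
Proof. by rewrite unlock; split; [exact: rmorph1 | exact: rmorphM]. Qed.

HB.instance Definition _ x y :=
  GRing.isZmodMorphism.Build (bipoly k) S (ev2 f x y) (ev2_is_zmod_morphism x y).
HB.instance Definition _ x y :=
  GRing.isMonoidMorphism.Build (bipoly k) S (ev2 f x y) (ev2_is_monoid_morphism x y).

Lemma ev2C x y c : ev2 f x y (CC k c) = f c.
Proof. by rewrite unlock -CCE horner_morphC /= /horner1 horner_morphC. Qed.

Lemma ev2X x y : ev2 f x y 'X%:P = x.
Proof. by rewrite unlock horner_morphC /= /horner1 horner_morphX. Qed.

Lemma ev2Y x y : ev2 f x y 'X = y.
Proof. by rewrite unlock horner_morphX. Qed.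

Lemma ev2B x y (p q : bipoly k) : ev2 f x y (p - q) = ev2 f x y p - ev2 f x y q.
Proof. exact: rmorphB. Qed.

Lemma ev2D x y (p q : bipoly k) : ev2 f x y (p + q) = ev2 f x y p + ev2 f x y q.
Proof. exact: rmorphD. Qed.

Lemma ev2M x y (p q : bipoly k) : ev2 f x y (p * q) = ev2 f x y p * ev2 f x y q.
Proof. exact: rmorphM. Qed.

Lemma ev2Xn x y (p : bipoly k) n : ev2 f x y (p ^+ n) = ev2 f x y p ^+ n.
Proof. exact: rmorphXn. Qed.

End Evaluation.

Lemma bipoly_morphism_ext (k S : comNzRingType) (g h : {rmorphism bipoly k -> S}) :
  (forall c, g (CC k c) = h (CC k c)) -> g 'X%:P = h 'X%:P -> g 'X = h 'X -> g =1 h.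
Proof.
move=> hC hX hY p; elim/poly_ind: p => [|p q IH]; first by rewrite !rmorph0.
rewrite (rmorphD g) (rmorphD h) (rmorphM g) (rmorphM h) IH hY; congr (_ + _).
elim/poly_ind: q => [|q c IHq]; first by rewrite !rmorph0.
rewrite polyCD polyCM (rmorphD g) (rmorphD h) (rmorphM g) (rmorphM h) IHq hX.
by rewrite CCE hC.
Qed.

Lemma ev2E (k S : comNzRingType) (f : {rmorphism k -> S}) x y (p : bipoly k) :
  ev2 f x y p = \sum_(j < size p) \sum_(i < size p`_j) f p`_j`_i * x ^+ i * y ^+ j.
Proof.
rewrite unlock /horner_morph (@horner_coef_wide _ (size p)); last exact: size_poly.
apply: eq_bigr => j _; rewrite coef_map /=.
rewrite /horner1 /horner_morph (@horner_coef_wide _ (size p`_j)); last exact: size_poly.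
rewrite mulr_suml.
by apply: eq_bigr => i _; rewrite coef_map.
Qed.

Notation subst := (ev2 (CC _)).

Definition const_fixing (k : comNzRingType) (s : bipoly k -> bipoly k) :=
  forall c : k, s (CC k c) = CC k c.

Lemma subst_const_fixing (k : comNzRingType) (x y : bipoly k) :
  const_fixing (subst x y).
Proof. by move=> c; rewrite ev2C. Qed.

Lemma substE (k : comNzRingType) (s : {rmorphism bipoly k -> bipoly k}) :
  const_fixing s -> s =1 subst (s 'X%:P) (s 'X).
Proof.
move=> hs; apply: bipoly_morphism_ext => [c||].
- by rewrite /= ev2C; exact: hs.
- by rewrite /= ev2X.
- by rewrite /= ev2Y.
Qed.

Lemma ev2_subst (k S : comNzRingType) (f : {rmorphism k -> S}) (x y : S) F G p :
  ev2 f x y (subst F G p) = ev2 f (ev2 f x y F) (ev2 f x y G) p.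
Proof.
move: p; apply: (bipoly_morphism_ext (g := ev2 f x y \o subst F G)) => [c||] /=.
- by rewrite !ev2C.
- by rewrite !ev2X.
- by rewrite !ev2Y.
Qed.

Lemma morph_ev2 (k S S' : comNzRingType) (f : {rmorphism k -> S})
    (f' : {rmorphism k -> S'}) (g : {rmorphism S -> S'}) x y p :
  (forall c, g (f c) = f' c) -> g (ev2 f x y p) = ev2 f' (g x) (g y) p.
Proof.
move=> hg; move: p.
by apply: (bipoly_morphism_ext (g := g \o ev2 f x y)) => [c||] /=;
  rewrite ?ev2C ?ev2X ?ev2Y.
Qed.

Lemma ev2_id (k : comNzRingType) (p : bipoly k) : subst 'X%:P 'X p = p.
Proof. by rewrite -(@substE _ idfun). Qed.

(** * Base change *)

HB.lock Definition bmap (k K : comNzRingType) (iota : {rmorphism k -> K}) :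
  {rmorphism bipoly k -> bipoly K} := map_poly (map_poly iota).

Section BaseChange.
Variables (k K : comNzRingType) (iota : {rmorphism k -> K}).

Lemma bmapC c : bmap iota (CC k c) = CC K (iota c).
Proof. by rewrite unlock -!CCE /= map_polyC /= map_polyC. Qed.

Lemma bmapX : bmap iota 'X%:P = 'X%:P.
Proof. by rewrite unlock /= map_polyC /= map_polyX. Qed.

Lemma bmapY : bmap iota 'X = 'X.
Proof. by rewrite unlock /= map_polyX. Qed.

Lemma bmap_comp p q : bmap iota (p \Po q) = bmap iota p \Po bmap iota q.
Proof. by rewrite unlock /= map_comp_poly. Qed.

Lemma bmap_polyC p : bmap iota p%:P = (map_poly iota p)%:P.
Proof. by rewrite unlock /= map_polyC. Qed.

Lemma coef_bmap p i j : (bmap iota p)`_j`_i = iota p`_j`_i.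
Proof. by rewrite unlock /= !coef_map. Qed.

Lemma bmap_subst x y p : bmap iota (subst x y p) = subst (bmap iota x) (bmap iota y) (bmap iota p).
Proof.
move: p; apply: (bipoly_morphism_ext (g := bmap iota \o subst x y)
  (h := subst (bmap iota x) (bmap iota y) \o bmap iota)) => [c||] /=.
- by rewrite ev2C !bmapC ev2C.
- by rewrite bmapX !ev2X.
- by rewrite bmapY !ev2Y.
Qed.

End BaseChange.

Lemma bmap_inj (k : fieldType) (K : comNzRingType) (iota : {rmorphism k -> K}) :
  injective (bmap iota).
Proof. by rewrite unlock; apply: map_inj_poly; [exact: map_poly_inj | exact: rmorph0]. Qed.
(** * Finite extensions *)

(** Irreducibility over an arbitrary field is undecidable, hence the excluded middle; a proper
    divisor feeds the induction on the size. *)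
Lemma irreducible_factor (k : fieldType) (p : {poly k}) :
  (1 < size p)%N -> exists2 q, irreducible_poly q & q %| p.
Proof.
elim: {p}(size p) {-2}p (leqnn (size p)) => [|N IH] p hN p_gt1; first by lia.
have [irr|nirr] := classic (irreducible_poly p); first by exists p.
have /not_all_ex_not [q nq] : ~ forall q : {poly k}, size q != 1 -> q %| p -> q %= p.
  by move=> h; apply: nirr; split.
have [q_size nq'] := imply_to_and _ _ nq.
have [q_dvd q_neq] := imply_to_and _ _ nq'.
have p0 : p != 0 by rewrite -size_poly_gt0; apply: ltnW.
have lt_qp : (size q < size p)%N.
  by rewrite ltn_neqAle dvdp_leq // andbT dvdp_size_eqp //; apply/negP.
have q0 : q != 0 by apply: contraNneq p0 => q0; rewrite q0 dvd0p in q_dvd.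
have [||r r_irr r_dvd] := IH q; first by lia.
  by rewrite -size_poly_gt0 in q0; move: q_size q0; case: (size q) => [|[]].
by exists r => //; exact: dvdp_trans q_dvd.
Qed.

(** One root is adjoined at a time. The induction generalises the base field because the cofactor
    lives over the new one; [baseFieldType] then views the tower over [k]. *)
Lemma splitting_extension (k : fieldType) (p : {poly k}) : p != 0 ->
  exists (L : fieldExtType k) (rs : seq L),
    map_poly (in_alg L) p %= \prod_(r <- rs) ('X - r%:P).
Proof.
have [N] := ubnP (size p); elim: N => // N IH in k p * => hN p0.
have [p1|p_le1] := ltnP 1 (size p); last first.
  exists (GRing.regular k : fieldExtType k), [::].
  rewrite big_nil -size_poly_eq1 size_map_poly.
  by rewrite eqn_leq p_le1 size_poly_gt0.
have [q q_irr q_p] := irreducible_factor p1.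
have [L1 _ [z q_z _]] := irredp_FAdjoin q_irr.
have /factor_theorem [p2 Dp] : root (map_poly (in_alg L1) p) z.
  by apply: root_dvdp q_z; rewrite dvdp_map.
have p2_0 : p2 != 0.
  apply: contraNneq p0 => p20; rewrite -(map_poly_eq0 (in_alg L1)).
  by rewrite Dp p20 mul0r.
have [|//|L2 [rs Drs]] := IH L1 p2.
  have: size (map_poly (in_alg L1) p) = (size p2).+1.
    by rewrite Dp size_Mmonic ?monicXsubC // size_XsubC addn2.
  by rewrite size_map_poly => e; rewrite e ltnS in hN.
exists (baseFieldType L2), (in_alg L2 z :: rs).
have -> : map_poly (in_alg (baseFieldType L2)) p =
    map_poly (in_alg L2) (map_poly (in_alg L1) p).
  rewrite -map_poly_comp; apply: eq_map_poly => c /=.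
  by rewrite baseField_scaleE.
rewrite big_cons Dp rmorphM /= rmorphB /= map_polyX map_polyC /= mulrC.
exact: eqp_mull.
Qed.

Section Primitive.
Variables (k : fieldType) (n : nat).
Hypotheses (n_gt0 : (0 < n)%N) (n0 : n%:R != 0 :> k).

(* The last property is purely inseparable closedness of [k] in [K]: it follows
   from the separability of [K] over [k]. *)
Lemma primitive_extension :
  exists (K : fieldExtType k) (zeta : K), n.-primitive_root zeta /\
    forall (mu : K) (e : nat) (P : {poly k}), (0 < e)%N ->
      ('X - mu%:P) ^+ e = map_poly (in_alg K) P -> exists m, mu = in_alg K m.
Proof.
have sz : size ('X^n - 1 : {poly k}) = n.+1.
  by rewrite -(polyC1 k) size_XnsubC.
have p0 : 'X^n - 1 != 0 :> {poly k} by rewrite -size_poly_gt0 sz.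
have [L [rs Drs]] := splitting_extension p0.
have mapE : map_poly (in_alg L) ('X^n - 1) = 'X^n - 1.
  by rewrite rmorphB rmorph1 /= map_polyXn.
have nL : n%:R != 0 :> L by rewrite -(rmorph_nat (in_alg L)) fmorph_eq0.
have sepX : separable_poly ('X^n - 1 : {poly L}) by rewrite separable_Xn_sub_1.
rewrite mapE in Drs.
have /hasP [z _ z_prim] : has n.-primitive_root rs.
  apply: has_prim_root => //.
  - apply/allP => x x_rs; rewrite /= unity_rootE -subr_eq0.
    have : root ('X^n - 1) x by rewrite (eqp_root Drs) root_prod_XsubC.
    by rewrite rootE !hornerE.
  - by rewrite -separable_prod_XsubC -(eqp_separable Drs).
  - have := eqp_size Drs; rewrite -(polyC1 L) size_XnsubC // size_prod_XsubC.
    by case=> <-.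
pose K := <<1; z>>%VS.
have zK : z \in K := memv_adjoin _ _.
have sep y : y \in K -> separable_element 1 y.
  move: y; apply/adjoin_separableP/separable_elementP; exists ('X^n - 1); split => //.
    by rewrite rpredB ?rpredX ?polyOverX ?rpred1.
  by rewrite rootE !hornerE prim_expr_order ?subrr.
exists (subvs_of K : fieldExtType k), (Subvs zK); split.
  rewrite -(fmorph_primitive_root (vsval : {rmorphism subvs_of K -> L})).
  exact: z_prim.
move=> mu e P e0 Dmu.
(* The minimal polynomial of [mu] over [k] divides [('X - mu)^e], so it is a power of ['X - mu];
   separability forces the exponent 1. *)
have : vsval mu \in (1%AS : {vspace L}).
  rewrite -adjoin_deg_eq1 -eqSS -size_minPoly.
  have := sep _ (subvsP mu); rewrite /separable_element.
  have : minPoly 1 (vsval mu) %| ('X - (vsval mu)%:P) ^+ e.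
    apply: minPoly_dvdp; last by rewrite rootE horner_exp hornerXsubC subrr expr0n gtn_eqF.
    apply/polyOver1P; exists P.
    have := congr1 (map_poly (vsval : {rmorphism subvs_of K -> L})) Dmu.
    rewrite rmorphXn rmorphB /= map_polyX map_polyC /= => ->.
    rewrite -map_poly_comp; apply: eq_map_poly => c /=.
    by rewrite algid1.
  case/dvdp_exp_XsubCP => j _ Dj; rewrite (eqp_separable Dj) => sepj.
  rewrite (eqp_size Dj) size_exp_XsubC eqSS eqn_leq; apply/andP; split.
    rewrite leqNgt; apply/negP => j1.
    have sz1 : size ('X - (vsval mu)%:P) != 1%N by rewrite size_XsubC.
    by have := separable_nosquare sepj j1 sz1; rewrite dvdpp.
  have := size_minPoly 1 (vsval mu); rewrite (eqp_size Dj) size_exp_XsubC.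
  by case=> ->.
case/vlineP => m Dm; exists m; apply: val_inj; rewrite /= Dm algid1.
by [].
Qed.

End Primitive.
Lemma pred_size_mul (R : idomainType) (p q : {poly R}) : p != 0 -> q != 0 ->
  (size (p * q)%R).-1 = ((size p).-1 + (size q).-1)%N.
Proof.
move=> p0 q0; rewrite size_mul //; rewrite -!size_poly_gt0 in p0 q0.
by move: p0 q0; case: (size p) => [//|m]; case: (size q) => [//|n] _ _ /=; lia.
Qed.

(** * Complete integral closedness *)

(** The hypothesis says that the fraction [y / c] is almost integral, one denominator [e] serving
    all its powers. No fraction field is needed to express it. *)
Definition completely_integrally_closed (R : idomainType) :=
  forall c e y : R, c != 0 -> e != 0 ->
    (forall j, exists v, e * y ^+ j = c ^+ j * v) -> exists v, y = c * v.

Lemma field_cic (k : fieldType) : completely_integrally_closed k.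
Proof. by move=> c e y c0 _ _; exists (c^-1 * y); rewrite mulVKf. Qed.

(** Leading coefficients inherit the hypothesis, so that of [c] divides that of [y]; subtracting
    [c * q], with [q] the quotient monomial, lowers the degree of [y] and preserves the
    hypothesis. *)
Lemma poly_cic (R : idomainType) :
  completely_integrally_closed R -> completely_integrally_closed {poly R}.
Proof.
move=> cicR c e y c0 e0.
have [N] := ubnP (size y); elim: N => // N IH in y *; rewrite ltnS => hN h.
have [->|y0] := eqVneq y 0; first by exists 0; rewrite mulr0.
have lead_cy : exists v, lead_coef y = lead_coef c * v.
  apply: (cicR _ (lead_coef e)); rewrite ?lead_coef_eq0 // => j.
  have [v /(congr1 lead_coef)] := h j; rewrite !lead_coefM !lead_coef_exp.
  by exists (lead_coef v).
(* Otherwise [y ^+ j] falls short of [c ^+ j] by at least [j] in degree, which [e] cannot make up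
   for when [j] is [size e]. *)
have size_cy : (size c <= size y)%N.
  rewrite leqNgt; apply/negP => lt_yc; have [v Dv] := h (size e).
  have v0 : v != 0.
    apply: contraNneq e0 => v0; move/eqP: Dv; rewrite v0 mulr0 mulf_eq0.
    by rewrite expf_eq0 (negPf y0) andbF orbF.
  have := congr1 (fun p : {poly R} => (size p).-1) Dv.
  rewrite !pred_size_mul ?expf_neq0 // !size_exp.
  rewrite -!size_poly_gt0 in e0 y0 c0; move: e0 y0 c0 lt_yc.
  move: (size e) (size y) (size c) (size v).-1 => [//|m] [//|i] [//|j] l _ _ _ /=.
  by rewrite ltnS; nia.
have [w Dw] := lead_cy; pose q := w *: 'X^(size y - size c).
have [|j|v Dv] := IH (y - c * q).
- have sz_y : size y = (size y).-1.+1 by rewrite prednK // size_poly_gt0.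
  apply: leq_trans hN; rewrite {1}sz_y ltnS; apply/leq_sizeP => i.
  rewrite leq_eqVlt coefB /q -scalerAr coefZ coefMXn => /predU1P[<-|hi].
    rewrite -lead_coefE Dw ltnNge -subn1 leq_sub2l ?size_poly_gt0 //=.
    rewrite (_ : _ - _ = (size c).-1)%N; first by rewrite -lead_coefE mulrC subrr.
    by rewrite -size_poly_gt0 in c0; move: (size c) (size y) c0 size_cy => l m; lia.
  rewrite nth_default; last by rewrite sz_y.
  rewrite ltnNge ltnW /=; last first.
    by rewrite -size_poly_gt0 in c0; move: (size c) (size y) c0 size_cy hi => l m; lia.
  rewrite nth_default ?mulr0 ?subr0 //.
  rewrite -size_poly_gt0 in c0.
  by move: (size c) (size y) c0 size_cy hi => l m; lia.
- have step i : (i <= j)%N -> exists v, e * y ^+ i * (c * q) ^+ (j - i) = c ^+ j * v.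
    move=> le_ij; have [v Dv] := h i; exists (v * q ^+ (j - i)).
    have -> : c ^+ j = c ^+ i * c ^+ (j - i) by rewrite -exprD subnKC.
    by rewrite Dv exprMn; ring.
  rewrite exprBn mulr_sumr.
  elim/big_ind: _ => [|_ _ [v1 ->] [v2 ->]|i _]; first by exists 0; rewrite mulr0.
    by exists (v1 + v2); rewrite mulrDr.
  have [|v Dv] := step (j - i)%N; first exact: leq_subr.
  rewrite subKn ?leq_ord // in Dv.
  exists ((-1) ^+ i * v *+ 'C(j, i)); rewrite !mulrnAr; congr (_ *+ _).
  by rewrite !mulrA (mulrAC (c ^+ j)) -mulrA -Dv; ring.
- by exists (v + q); rewrite mulrDr -Dv subrK.
Qed.

(** Over a domain, monic linear factors can still be cancelled one at a time, each going to [q] or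
    to [h]; the mask records those of [q], and [c] is a unit. The ring [R] will be [L[z]]. *)
Lemma dvd_prod_XsubC (R : idomainType) (I : Type) (f : I -> R) (s : seq I) (q h : {poly R}) :
  \prod_(i <- s) ('X - (f i)%:P) = q * h ->
  exists (m : bitseq) (c d : R),
    c * d = 1 /\ q = c%:P * \prod_(i <- mask m s) ('X - (f i)%:P).
Proof.
elim: s => [|i s IH] in q h *.
  rewrite big_nil => /esym qh1; have qU : q \is a GRing.unit.
    by apply/unitrPr; exists h.
  have /andP [/size_poly1P [c c0 Dq] cU] : (size q == 1%N) && (q`_0 \is a GRing.unit) by [].
  exists [::], c, c^-1; rewrite big_nil mulr1; split=> //.
  by rewrite Dq coefC in cU; rewrite divrr.
rewrite big_cons => qh.
have X0 : 'X - (f i)%:P != 0 by rewrite polyXsubC_eq0.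
have /orP[/factor_theorem[q1 Dq]|/factor_theorem[h1 Dh]] : root q (f i) || root h (f i).
- by rewrite -rootM -qh rootM root_XsubC eqxx.
- have [|m [c [d [cd Dq1]]]] := IH q1 h.
    by apply: (mulfI X0); rewrite qh Dq; ring.
  exists (true :: m), c, d; split=> //.
  by rewrite /= big_cons Dq Dq1; ring.
- have [|m [c [d [cd Dq1]]]] := IH q h1.
    by apply: (mulfI X0); rewrite qh Dh; ring.
  by exists (false :: m), c, d.
Qed.
(** * Descent from [B = A[z]] to [A] when [z] is a coordinate of [B] *)

HB.lock Definition at_const (k : comNzRingType) (x : bipoly k) : {rmorphism {poly k} -> bipoly k} :=
  horner_morph (fun c => mulrC x (CC k c)).

HB.lock Definition mod_z (k : comNzRingType) : {rmorphism bipoly k -> {poly k}} :=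
  map_poly (horner_eval 0).

Section AtConst.
Variable k : comNzRingType.
Implicit Types (x : bipoly k) (p q : {poly k}).

Lemma at_constC x c : at_const x c%:P = CC k c.
Proof. by rewrite [at_const]unlock /= horner_morphC. Qed.

Lemma at_constX x : at_const x 'X = x.
Proof. by rewrite [at_const]unlock /= horner_morphX. Qed.

Lemma at_const_mulXsubC x e p :
  at_const x (('X - e%:P) * p) = (x - CC k e) * at_const x p.
Proof. by rewrite rmorphM rmorphB /= at_constX at_constC. Qed.

Lemma at_constD x p c : at_const x (p * 'X + c%:P) = at_const x p * x + CC k c.
Proof. by rewrite rmorphD rmorphM /= at_constX at_constC. Qed.

Lemma at_const_Z p : at_const 'X%:P p = p%:P.
Proof.
elim/poly_ind: p => [|p c IH]; first by rewrite !rmorph0.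
by rewrite at_constD IH -CCE polyCD polyCM.
Qed.

Lemma at_const_Zn n p : at_const ('X%:P ^+ n) p = (p \Po 'X^n)%:P.
Proof.
elim/poly_ind: p => [|p c IH]; first by rewrite comp_poly0 !rmorph0.
by rewrite at_constD IH comp_poly_MXaddC polyCD polyCM -CCE polyC_exp.
Qed.

Lemma at_const_comp x q p : at_const x (p \Po q) = at_const (at_const x q) p.
Proof.
elim/poly_ind: p => [|p c IH]; first by rewrite comp_poly0 !rmorph0.
by rewrite at_constD comp_poly_MXaddC rmorphD rmorphM /= IH at_constC.
Qed.

Lemma horner_at_const x p f r : x.[f] = r%:P -> (at_const x p).[f] = p.[r]%:P.
Proof.
move=> xf; elim/poly_ind: p => [|p c IH]; first by rewrite rmorph0 !horner0.
by rewrite at_constD hornerD hornerM IH xf -CCE hornerC hornerMXaddC polyCD polyCM.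
Qed.

Lemma at_constE x p : at_const x p = (map_poly (CC k) p).[x].
Proof. by rewrite [at_const]unlock. Qed.

Lemma at_const_id p : at_const 'X p = map_poly polyC p.
Proof.
elim/poly_ind: p => [|p c IH]; first by rewrite !rmorph0.
rewrite !rmorphD !rmorphM /= IH at_constX at_constC map_polyX map_polyC /=.
by rewrite CCE.
Qed.

Lemma morph_at_const (s : {rmorphism bipoly k -> bipoly k}) x p :
  const_fixing s -> s (at_const x p) = at_const (s x) p.
Proof.
move=> hs; elim/poly_ind: p => [|p c IH]; first by rewrite !rmorph0.
rewrite 2!(rmorphD (at_const _)) 2!(rmorphM (at_const _)) (rmorphD s) (rmorphM s) IH.
by rewrite !at_constX !at_constC hs.
Qed.

Lemma mod_zC c : mod_z k (CC k c) = c%:P.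
Proof. by rewrite unlock -CCE /= map_polyC /= /horner_eval hornerC. Qed.

Lemma mod_z_at_const x p : mod_z k (at_const x p) = p \Po mod_z k x.
Proof.
elim/poly_ind: p => [|p c IH]; first by rewrite comp_poly0 !rmorph0.
rewrite (rmorphD (at_const _)) (rmorphM (at_const _)) (rmorphD (mod_z k)) (rmorphM (mod_z k)) IH.
by rewrite at_constX at_constC mod_zC comp_poly_MXaddC.
Qed.

Lemma mod_z_eq0 (p : bipoly k) : mod_z k p = 0 -> exists s, p = 'X%:P * s.
Proof.
move=> h; exists (map_poly (fun c : {poly k} => \poly_(i < (size c).-1) c`_i.+1) p).
apply/polyP => j; rewrite coefCM coef_map_id0; last first.
  by apply/polyP=> i; rewrite coef_poly !coef0 if_same.
have := congr1 (fun q : {poly k} => q`_j) h; rewrite coef0 unlock coef_map /=.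
rewrite /horner_eval horner_coef0 => h0.
apply/polyP => -[|i]; rewrite coefXM //= coef_poly.
case: ltnP => // hi; rewrite nth_default //.
by move: hi; case: (size _) => [|m].
Qed.

End AtConst.

Lemma bmap_at_const (k K : comNzRingType) (iota : {rmorphism k -> K}) x p :
  bmap iota (at_const x p) = at_const (bmap iota x) (map_poly iota p).
Proof.
elim/poly_ind: p => [|p c IH]; first by rewrite !rmorph0.
rewrite (rmorphD (at_const _)) (rmorphM (at_const _)) (rmorphD (bmap iota)).
rewrite (rmorphM (bmap iota)) IH at_constX at_constC bmapC.
rewrite rmorphD rmorphM /= map_polyX map_polyC /=.
by rewrite (rmorphD (at_const _)) (rmorphM (at_const _)) at_constX at_constC.
Qed.

Lemma prod_XsubC_shift (L : fieldType) (I : eqType) (f : I -> {poly L}) g (s : seq I) :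
  (forall r, r \in s -> exists e : L, f r = g + e%:P) ->
  exists Q : {poly L}, size Q = (size s).+1 /\
    \prod_(i <- s) ('X - (f i)%:P) = at_const ('X - g%:P) Q.
Proof.
elim: s => [|r s IH] hs.
  by exists 1; rewrite big_nil (rmorph1 (at_const _)) size_poly1.
have [|Q [sQ DQ]] := IH; first by move=> j jT; apply: hs; rewrite in_cons jT orbT.
have [e De] := hs r (mem_head _ _).
exists (('X - e%:P) * Q); split.
  by rewrite size_monicM ?size_XsubC -?size_poly_gt0 ?sQ ?monicXsubC.
by rewrite big_cons DQ at_const_mulXsubC De polyCD CCE opprD addrA.
Qed.

(* [eps] embeds [A] in [B = k[z][U]], with [z = 'X%:P] and [U = 'X]. *)
Section Descent.
Variables (k : fieldType) (eps : {rmorphism bipoly k -> bipoly k}).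
Hypotheses (eps_const : const_fixing eps) (eps_inj : injective eps).
Variables (a b : bipoly k) (n : nat) (H : {poly bipoly k}).
Hypotheses (n_gt0 : (0 < n)%N) (b0 : b != 0).
Hypothesis eps_a : eps b * 'X%:P ^+ n = eps a.
Hypothesis eps_z0 : forall y s, eps y = 'X%:P * s -> exists y', y = a * y'.
Hypothesis eps_U : 'X = (map_poly eps H).['X%:P ^+ n].

Let x := H`_0.

Lemma mod_z_X : mod_z k 'X%:P = 0.
Proof. by rewrite unlock /= map_polyC /= /horner_eval hornerX polyC0. Qed.

Lemma mod_z_Y : mod_z k 'X = 'X.
Proof. by rewrite unlock /= map_polyX. Qed.

(** Since [n > 0], only the constant term of [U = H(z^n)] survives modulo [z]. Thus [x] generates
    [B/zB = k[U]]. *)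
Lemma mod_z_eps_x : mod_z k (eps x) = 'X.
Proof.
rewrite -[RHS]mod_z_Y [in RHS]eps_U -[RHS]/((mod_z k \o horner_eval _) _).
have -> : map_poly eps H = map_poly eps H - (eps x)%:P + (eps x)%:P by rewrite subrK.
have /factor_theorem [q ->] : root (map_poly eps H - (eps x)%:P) 0.
  by rewrite rootE hornerD hornerN hornerC horner_coef0 coef_map subrr.
rewrite /= /horner_eval hornerD hornerM hornerC subr0 hornerX.
rewrite (rmorphD (mod_z k)) (rmorphM (mod_z k)).
by rewrite (rmorphXn (mod_z k)) mod_z_X expr0n gtn_eqF // mulr0 add0r.
Qed.

(** With [p] the residue of [y] modulo [z], the element [y - p(x)] of [A] lies in [zB], and [eps_z0]
    says that it is a multiple of [a]. *)
Lemma mod_a y : exists p y', y = at_const x p + a * y'.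
Proof.
pose p := mod_z k (eps y); exists p.
have /mod_z_eq0 [s Ds] : mod_z k (eps (y - at_const x p)) = 0.
  rewrite (rmorphB eps) (rmorphB (mod_z k)) morph_at_const // mod_z_at_const.
  by rewrite mod_z_eps_x comp_polyXr subrr.
by have [y' Dy'] := eps_z0 Ds; exists y'; rewrite -Dy' addrC subrK.
Qed.

Let dilate (R : comNzRingType) : {rmorphism {poly R} -> {poly R}} := comp_poly 'X^n.

(** Each coefficient of [G] is a polynomial in [x] modulo [a], and [a = b z^n] vanishes modulo [b].
    The map [dilate] records that [z] enters [P] only through [z^n]. *)
Lemma expand_mod_b (G : {poly bipoly k}) : exists P W,
  (map_poly eps G).['X%:P ^+ n] = map_poly (dilate k) P \Po eps x + eps b * W.
Proof.
elim/poly_ind: G => [|G g [P [W IH]]].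
  by exists 0, 0; rewrite !rmorph0 horner0 mulr0 addr0.
have [p [g' Dg]] := mod_a g.
exists (P * 'X%:P + map_poly polyC p), (W * 'X%:P ^+ n + 'X%:P ^+ n * eps g').
rewrite rmorphD rmorphM /= map_polyX map_polyC /= hornerD hornerM hornerX hornerC IH.
rewrite rmorphD rmorphM /= map_polyC /= comp_polyX.
have -> : map_poly (dilate k) (map_poly polyC p) = map_poly polyC p.
  by rewrite -map_poly_comp; apply: eq_map_poly => c /=; rewrite comp_polyC.
rewrite comp_polyD comp_polyM comp_polyC.
have -> : map_poly polyC p \Po eps x = eps (at_const x p).
  rewrite morph_at_const //; elim/poly_ind: p {Dg} => [|p c IHp].
    by rewrite !rmorph0.
  rewrite rmorphD rmorphM /= map_polyX map_polyC /= comp_poly_MXaddC IHp.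
  by rewrite (rmorphD (at_const _)) (rmorphM (at_const _)) at_constX at_constC CCE.
rewrite Dg (rmorphD eps) (rmorphM eps) -eps_a polyC_exp; ring.
Qed.

(** This is [mod_a] applied to [b] itself, with [a = b z^n]. The polynomial [beta] is nonzero
    because the second factor is 1 modulo [z]. *)
Lemma x_root_mod_b : exists (b' : bipoly k) (beta : {poly k}), beta != 0 /\
  at_const (eps x) beta = eps b * (1 - 'X%:P ^+ n * eps b').
Proof.
have [p [b' Db]] := mod_a b; exists b', p.
have E : at_const (eps x) p = eps b * (1 - 'X%:P ^+ n * eps b').
  rewrite -morph_at_const // mulrBr mulr1 mulrA eps_a -(rmorphM eps) -(rmorphB eps).
  by congr (eps _); rewrite [in RHS]Db addrK.
split=> //; apply: contraNneq b0 => p0; rewrite p0 rmorph0 in E.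
move/esym/eqP: E; rewrite mulf_eq0 => /orP[/eqP h|/eqP/(congr1 (mod_z k))].
  by rewrite -(inj_eq eps_inj) h rmorph0.
rewrite (rmorphB (mod_z k)) (rmorphM (mod_z k)) (rmorphXn (mod_z k)) mod_z_X expr0n.
by rewrite gtn_eqF // mul0r subr0 rmorph0 rmorph1 => /eqP; rewrite oner_eq0.
Qed.

(** * The curves on which [b] vanishes *)

Section Split.
Variables (L : fieldExtType k) (P W b' : bipoly k) (beta : {poly k}) (rs : seq L).
Let iota : {rmorphism k -> L} := in_alg L.
Hypothesis eps_U_mod_b : 'X = map_poly (dilate k) P \Po eps x + eps b * W.
Hypothesis beta_root : at_const (eps x) beta = eps b * (1 - 'X%:P ^+ n * eps b').
Hypothesis beta_split : map_poly iota beta %= \prod_(r <- rs) ('X - r%:P).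

Let bL := bmap iota (eps b).
Let xL := bmap iota (eps x).
Let PL := map_poly (dilate L) (bmap iota P).
Let f (r : L) : {poly L} := PL.[r%:P].

Let f_dilate r : f r = dilate L (bmap iota P).[r%:P].
Proof. by rewrite /f -[in LHS](comp_polyC r 'X^n) horner_map. Qed.

Let U_mod_b : 'X = PL \Po xL + bL * bmap iota W.
Proof.
rewrite -(bmapY iota) [in LHS]eps_U_mod_b (rmorphD (bmap iota)) (rmorphM (bmap iota)).
congr (_ + _); rewrite bmap_comp; congr (_ \Po _).
rewrite /PL [bmap]unlock /= -!map_poly_comp; apply: eq_map_poly => c /=.
by rewrite map_comp_poly map_polyXn.
Qed.

Let curve_mod r : exists g, 'X - (f r)%:P = (xL - CC L r) * g + bL * bmap iota W.
Proof.
have /factor_theorem [q Dq] : root (PL - (f r)%:P) r%:P.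
  by rewrite rootE hornerD hornerN hornerC subrr.
exists (q \Po xL); rewrite [in LHS]U_mod_b addrAC; congr (_ + _).
have -> : PL = q * ('X - r%:P%:P) + (f r)%:P by rewrite -Dq subrK.
by rewrite comp_polyD comp_polyM comp_polyB comp_polyX !comp_polyC CCE addrK mulrC.
Qed.

Let prod_x_dvd : exists2 c, c != 0 & \prod_(r <- rs) (xL - CC L r) =
  CC L c * bL * (1 - 'X%:P ^+ n * bmap iota (eps b')).
Proof.
have /eqpP [[c1 c2] /= /andP[c1_0 c2_0] Dc] := beta_split.
exists (c2^-1 * c1); first by rewrite mulf_neq0 ?invr_eq0.
have /(congr1 (at_const xL)) := Dc.
rewrite -!mul_polyC !(rmorphM (at_const xL)) !at_constC -bmap_at_const beta_root.
rewrite (rmorphM (bmap iota)) (rmorphB (bmap iota)) (rmorphM (bmap iota)).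
rewrite (rmorphXn (bmap iota)) bmapX (rmorph1 (bmap iota)).
rewrite (rmorph_prod (at_const xL)).
under eq_bigr do rewrite (rmorphB (at_const xL)) at_constX at_constC.
move=> E; rewrite CCM -!mulrA E mulrA -CCM mulVf //.
by rewrite (rmorph1 (CC L)) mul1r.
Qed.

(** Modulo [b], each [U - f r] is a multiple of [x - r], and the product of the [x - r] is a
    multiple of [b] by the choice of [beta]. *)
Let b_dvd : exists h, \prod_(r <- rs) ('X - (f r)%:P) = bL * h.
Proof.
have [c _ Dc] := prod_x_dvd.
have [G [V ->]] : exists G V, \prod_(r <- rs) ('X - (f r)%:P) =
    (\prod_(r <- rs) (xL - CC L r)) * G + bL * V.
  elim: rs => [|r s [G [V IH]]].
    by exists 1, 0; rewrite !big_nil mulr1 mulr0 addr0.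
  have [g Dg] := curve_mod r; rewrite !big_cons IH Dg.
  set A := \prod_(_ <- _) _; exists (g * G).
  exists (((xL - CC L r) * g + bL * bmap iota W) * V + bmap iota W * A * G); ring.
exists (CC L c * (1 - 'X%:P ^+ n * bmap iota (eps b')) * G + V); rewrite Dc; ring.
Qed.

(** Along the curve the product of the [x - r'] vanishes in the domain [L[z]], so [x] is constant
    there, equal to some root [r']; as [b] vanishes, the expression of [U] in [x] modulo [b] gives
    [f r']. That [r'] is the label [r] is not claimed. *)
Let on_curve r : bL.[f r] = 0 -> exists r', xL.[f r] = r'%:P /\ f r = f r'.
Proof.
move=> br0; have [c _ /(congr1 (fun p => p.[f r]))] := prod_x_dvd.
rewrite !hornerM br0 mulr0 mul0r => /eqP.
rewrite horner_prod prodf_seq_eq0 => /hasP [r' _ /=].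
rewrite hornerD hornerN -CCE hornerC subr_eq0 => /eqP xr'; exists r'; split=> //.
by rewrite -[LHS]hornerX U_mod_b hornerD hornerM br0 mul0r addr0 horner_comp xr'.
Qed.

Lemma split_b : (exists2 c, c != 0 & bL = CC L c) \/
  exists (g : {poly L}) (r : L) (Q : {poly L}), (1 < size Q)%N /\
    bL = at_const ('X - (dilate L g)%:P) Q /\ bL.[dilate L g] = 0 /\ xL.[dilate L g] = r%:P.
Proof.
have [h /dvd_prod_XsubC [m [c [d [cd Db]]]]] := b_dvd.
have [c' c'0 Dc] : exists2 c' : L, c' != 0 & c = c'%:P.
  have /andP [/size_poly1P [c' c'0 Dc] _] : (size c == 1%N) && (c`_0 \is a GRing.unit).
    have cU : c \is a GRing.unit by apply/unitrPr; exists d.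
    exact: cU.
  by exists c'.
rewrite {}Dc in Db; case Ds: (mask m rs) Db => [|s1 s] Db.
  by left; exists c'; rewrite // Db big_nil mulr1 CCE.
right; have b_at r : r \in s1 :: s -> bL.[f r] = 0.
  move=> r_s; rewrite Db hornerM horner_prod; apply/eqP.
  rewrite mulf_eq0 prodf_seq_eq0; apply/orP; right; apply/hasP; exists r => //=.
  by rewrite hornerXsubC subrr.
have [r1 [xr1 fr1]] := on_curve (b_at s1 (mem_head _ _)).
have diff r : r \in s1 :: s -> exists e : L, f r = f s1 + e%:P.
  move=> r_s; have [r' [xr' fr']] := on_curve (b_at r r_s).
  have [rr|ne_r] := eqVneq r' r1; first by exists 0; rewrite addr0 fr' rr fr1.
  (* [U - f r] divides [x - r'], which on the other curve is the nonzero constant [r1 - r']. So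
     [f s1 - f r] divides a nonzero constant of [L[z]], and is constant. *)
  have /factor_theorem [q Dq] : root (xL - CC L r') (f r).
    by rewrite rootE hornerD hornerN -CCE hornerC xr' subrr.
  have := congr1 (fun p => p.[f s1]) Dq.
  rewrite hornerD hornerN hornerM hornerXsubC xr1 -CCE hornerC -polyCB => E.
  have : size (q.[f s1] * (f s1 - f r)) == 1%N by rewrite -E size_polyC subr_eq0 [r1 == _]eq_sym ne_r.
  rewrite size_mul_eq1 => /andP [_ /size_poly1P [e _ De]].
  by exists (- e); rewrite polyCN -De opprB addrC subrK.
have [Q [sQ DQ]] := prod_XsubC_shift diff.
exists (bmap iota P).[r1%:P], r1, (c'%:P * Q); rewrite -f_dilate -fr1 size_Cmul // sQ.
split=> //; split; first by rewrite (rmorphM (at_const _)) at_constC -DQ Db CCE.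
by split=> //; apply: b_at; exact: mem_head.
Qed.

End Split.
End Descent.

(** * Integral elements of the fraction field of [A] *)

Section IntegralElement.
Variables (L : fieldType) (E : {rmorphism bipoly L -> bipoly L}).
Hypotheses (E_const : const_fixing E) (E_inj : injective E).
Variables (a b w : bipoly L).
Hypotheses (b0 : b != 0) (E_a : E b * w = E a).

Lemma clear_denominators (G : {poly bipoly L}) :
  exists N y, E b ^+ N * (map_poly E G).[w] = E y.
Proof.
elim/poly_ind: G => [|G g [N [y IH]]].
  by exists 0%N, 0; rewrite !rmorph0 horner0 mulr0.
exists N.+1, (a * y + b ^+ N.+1 * g).
rewrite (rmorphD E) !(rmorphM E) (rmorphXn E) -IH -E_a rmorphD rmorphM /=.
by rewrite map_polyX map_polyC /= hornerD hornerM hornerX hornerC !exprS; ring.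
Qed.

(** As [Q(U) = b] lies in [A], repeated division by [Q] brings every polynomial in [U] below the
    degree of [Q], with coefficients in [A]. So one power of [b] is a denominator for all powers of
    [U], and complete integral closedness applies to [U = y / b^N]. *)
Lemma integral_in_image (Q : {poly L}) (U y : bipoly L) N : (1 < size Q)%N ->
  E b = at_const U Q -> E b ^+ N * U = E y -> exists u, E u = U.
Proof.
move=> sQ bQ Dy.
have small (R : {poly L}) m : (size R <= m)%N ->
    exists v, E b ^+ (N * m) * at_const U R = E v.
  elim/poly_ind: R m => [|R c IH] m hm.
    by exists 0; rewrite !rmorph0 mulr0.
  case: m hm => [|m] hm.
    move: hm; rewrite leqn0 size_poly_eq0 => /eqP ->.
    by exists 0; rewrite !rmorph0 mulr0.
  have [|v Dv] := IH m.
    have [->|R0] := eqVneq R 0; first by rewrite size_poly0.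
    by move: hm; rewrite size_MXaddC (negPf R0).
  exists (v * y + b ^+ (N * m.+1) * CC L c).
  rewrite (rmorphD E) !(rmorphM E) (rmorphXn E) -Dv -Dy E_const mulnS exprD.
  by rewrite (rmorphD (at_const U)) (rmorphM (at_const U)) at_constX at_constC; ring.
have all R : exists v, E b ^+ (N * size Q) * at_const U R = E v.
  have [l] := ubnP (size R); elim: l => // l IH in R *; rewrite ltnS => hl.
  have [lt_RQ|le_QR] := ltnP (size R) (size Q); first by apply: small; apply: ltnW.
  have Q0 : Q != 0 by rewrite -size_poly_gt0; apply: leq_trans sQ.
  have [|v Dv] := IH (R %/ Q).
    rewrite size_divp //; apply: leq_trans hl.
    by move: (size R) (size Q) sQ le_QR => i j; lia.
  have [|v' Dv'] := small (R %% Q) (size Q); first by rewrite ltnW // ltn_modp.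
  exists (v * b + v').
  rewrite [in LHS](divp_eq R Q) (rmorphD (at_const U)) (rmorphM (at_const U)) -bQ.
  by rewrite (rmorphD E) (rmorphM E) -Dv -Dv'; ring.
have cic : completely_integrally_closed (bipoly L).
  by do 2!apply: poly_cic; exact: field_cic.
have [u Du] : exists u, y = b ^+ N * u.
  apply: (cic _ (b ^+ (N * size Q))); rewrite ?expf_neq0 // => j.
  have [v Dv] := all 'X^j; exists v; apply: E_inj.
  rewrite !(rmorphM E) !(rmorphXn E) -Dv -Dy (rmorphXn (at_const U)) at_constX.
  by rewrite exprMn; ring.
exists u; have bN0 : E b ^+ N != 0.
  by rewrite expf_neq0 // -(rmorph0 E) (inj_eq E_inj).
by apply: (mulfI bN0); rewrite Dy Du (rmorphM E) (rmorphXn E).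
Qed.

End IntegralElement.

(* Induction on the degree in [z = 'X] in [k[U][z]], [U = 'X%:P]. *)
Lemma generated_by_u_a (k : fieldType) (E : {rmorphism bipoly k -> bipoly k})
    (a b u y : bipoly k) (n : nat) (q : {poly k}) :
  const_fixing E -> injective E -> (0 < n)%N -> b != 0 -> E b * 'X ^+ n = E a ->
  (forall y s, E y = 'X * s -> exists y', y = a * y') ->
  E u = 'X%:P -> E b = q%:P -> exists P, y = subst u a P.
Proof.
move=> E_const E_inj n0 b0 E_a E_z0 E_u E_b.
have [N] := ubnP (size (E y)); elim: N => // N IH in y *; rewrite ltnS => hN.
have [->|y0] := eqVneq y 0; first by exists 0; rewrite rmorph0.
pose p := (E y)`_0; have Ep : E (at_const u p) = p%:P.
  rewrite morph_at_const // E_u; elim/poly_ind: (p) => [|r c IHr].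
    by rewrite !rmorph0.
  rewrite (rmorphD (at_const _)) (rmorphM (at_const _)) at_constX at_constC IHr.
  by rewrite polyCD polyCM CCE.
have [y' Dy'] : exists y', y - at_const u p = a * y'.
  apply: E_z0 (\poly_(i < (size (E y)).-1) (E y)`_i.+1) _.
  rewrite (rmorphB E) Ep; apply/polyP => -[|i]; rewrite coefXM coefB coefC /=.
    by rewrite subrr.
  rewrite subr0 coef_poly; case: ltnP => // hi; rewrite nth_default //.
  by move: hi; case: (size _).
have q0 : q != 0 by rewrite -polyC_eq0 -E_b -(rmorph0 E) (inj_eq E_inj).
have [|P DP] := IH y'.
  have [->|y'0] := eqVneq y' 0.
    by rewrite rmorph0 size_poly0; apply: leq_trans hN; rewrite size_poly_gt0 -(rmorph0 E) (inj_eq E_inj).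
  have le_y : (size (E (y - at_const u p)%R) <= size (E y))%N.
    rewrite (rmorphB E) Ep; apply: leq_trans (size_polyD _ _) _.
    rewrite geq_max leqnn size_polyN; apply: leq_trans (size_polyC_leq1 _) _.
    by rewrite size_poly_gt0 -(rmorph0 E) (inj_eq E_inj).
  have Ey'0 : E y' != 0 by rewrite -(rmorph0 E) (inj_eq E_inj).
  (* [E a = q(U) z^n] with [q(U)] free of [z], so dividing by [a] lowers the degree in [z] by
     [n > 0]. *)
  have : size (E (y - at_const u p)) = (n + size (E y'))%N.
    by rewrite Dy' (rmorphM E) -E_a E_b -mulrA size_Cmul // mulrC size_mulXn.
  by move: le_y hN; move: (size _) (size _) (size _) => i j l; lia.
exists (at_const 'X%:P p + 'X * P).
rewrite rmorphD rmorphM /= ev2Y -DP -Dy'.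
rewrite morph_at_const /=; last exact: subst_const_fixing.
by rewrite ev2X addrC subrK.
Qed.

(** * Removing a finite scalar extension by a linear functional *)

Section Coordinatewise.
Variables (k : fieldType) (L : fieldExtType k) (rho : {scalar L}).

(** Not a ring morphism, but linear over [bipoly k] by [hat_bmapM]; this is enough to bring
    solutions over [L] back to [k], whether or not [L] is separable. *)
Definition hat (p : bipoly L) : bipoly k := map_poly (map_poly rho) p.

Lemma coef_hat p i j : (hat p)`_j`_i = rho p`_j`_i.
Proof. by rewrite /hat coef_map_id0 ?raddf0 // coef_map_id0 ?raddf0. Qed.

Lemma hatD p q : hat (p + q) = hat p + hat q.
Proof. by apply/polyP => j; apply/polyP => i; rewrite !(coefD, coef_hat) raddfD. Qed.

Lemma hat0 : hat 0 = 0.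
Proof. by apply/polyP => j; apply/polyP => i; rewrite !(coef0, coef_hat) raddf0. Qed.

Lemma hatB p q : hat (p - q) = hat p - hat q.
Proof. by apply/polyP => j; apply/polyP => i; rewrite !(coefB, coef_hat) raddfB. Qed.

Lemma hat_sum (I : Type) (r : seq I) F :
  hat (\sum_(i <- r) F i) = \sum_(i <- r) hat (F i).
Proof. by elim/big_rec2: _ => [|i x y _ <-]; rewrite ?hat0 ?hatD. Qed.

Lemma hat_bmapM s t : hat (bmap (in_alg L) s * t) = s * hat t.
Proof.
apply/polyP => j; apply/polyP => i; rewrite coef_hat !coefM !coef_sum raddf_sum.
apply: eq_bigr => l _; rewrite !coefM raddf_sum; apply: eq_bigr => m _ /=.
by rewrite coef_bmap coef_hat /= mulr_algl linearZ.
Qed.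

Lemma hat_CC c : hat (CC L c) = CC k (rho c).
Proof.
apply/polyP => j; apply/polyP => i; rewrite coef_hat -!CCE !coefC.
by case: j => [|j] /=; rewrite !(coefC, coef0); case: i => [|i] //=; rewrite raddf0.
Qed.

Lemma hat_ev2 (s : {rmorphism bipoly k -> bipoly k}) p : const_fixing s ->
  hat (subst (bmap (in_alg L) (s 'X%:P)) (bmap (in_alg L) (s 'X)) p) = s (hat p).
Proof.
have expand (s' : {rmorphism bipoly k -> bipoly k}) :
    hat (subst (bmap (in_alg L) (s' 'X%:P)) (bmap (in_alg L) (s' 'X)) p) =
    \sum_(j < size p) \sum_(i < size p`_j)
      s' 'X%:P ^+ i * s' 'X ^+ j * CC k (rho p`_j`_i).
  rewrite ev2E hat_sum; apply: eq_bigr => j _; rewrite hat_sum; apply: eq_bigr => i _.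
  rewrite -!(rmorphXn (bmap (in_alg L))) -mulrA mulrC -(rmorphM (bmap (in_alg L))).
  by rewrite hat_bmapM hat_CC.
move=> hs; rewrite expand.
have := expand idfun; rewrite /= bmapX bmapY ev2_id => ->.
rewrite (rmorph_sum s); apply: eq_bigr => j _; rewrite (rmorph_sum s).
by apply: eq_bigr => i _; rewrite !(rmorphM s) !(rmorphXn s) hs.
Qed.

Lemma hat_polyC (p : {poly L}) : hat p%:P = (map_poly rho p)%:P.
Proof. by rewrite /hat map_polyC. Qed.

Lemma hat_at_const s (p : {poly L}) :
  hat (at_const (bmap (in_alg L) s) p) = at_const s (map_poly rho p).
Proof.
elim/poly_ind: p => [|p c IH].
  by rewrite !rmorph0 hat0 -[map_poly _ _]/(map_poly rho 0) raddf0 rmorph0.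
have -> : map_poly rho (p * 'X + c%:P) = map_poly rho p * 'X + (rho c)%:P.
  by rewrite raddfD /= map_polyC; congr (_ + _); apply/polyP => i;
    rewrite coef_map !coefMX coef_map; case: i => //=; rewrite raddf0.
by rewrite !at_constD hatD mulrC hat_bmapM IH hat_CC mulrC.
Qed.

End Coordinatewise.

Lemma unit_functional (k : fieldType) (L : fieldExtType k) :
  exists rho : {scalar L}, forall c, rho (in_alg L c) = c.
Proof.
pose X := [tuple (1 : L)]; have X_free : free X by rewrite seq1_free oner_eq0.
exists (coord X ord0) => c; rewrite /= linearZ /=.
by have /= -> := coord_free ord0 ord0 X_free; rewrite mulr1.
Qed.

(** If the extension of [s] kills [p], then [s] kills each coordinate of [p] in a basis of [L] over
    [k]. *)
Lemma extend_injective (k : fieldType) (L : fieldExtType k)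
    (s : {rmorphism bipoly k -> bipoly k}) : const_fixing s -> injective s ->
  injective (subst (bmap (in_alg L) (s 'X%:P)) (bmap (in_alg L) (s 'X))).
Proof.
move=> hs s_inj; apply: raddf_inj => p p0.
apply/polyP => j; apply/polyP => i; rewrite !coef0.
rewrite (coord_vbasis (memvf p`_j`_i)) big1 // => l _.
have := hat_ev2 (coord (vbasis fullv) l) p hs; rewrite [X in hat _ X]p0 hat0 -(rmorph0 s).
move/s_inj/(congr1 (fun r : bipoly k => r`_j`_i)); rewrite coef_hat !coef0 => <-.
by rewrite scale0r.
Qed.

Section DescentTheorem.
Variables (k : fieldType) (eps : {rmorphism bipoly k -> bipoly k}).
Hypotheses (eps_const : const_fixing eps) (eps_inj : injective eps).
Variables (a b : bipoly k) (n : nat) (H : {poly bipoly k}).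
Hypotheses (n_gt0 : (0 < n)%N) (b0 : b != 0).
Hypothesis eps_a : eps b * 'X%:P ^+ n = eps a.
Hypothesis eps_z0 : forall y s, eps y = 'X%:P * s -> exists y', y = a * y'.
Hypothesis eps_U : 'X = (map_poly eps H).['X%:P ^+ n].

(** Here [z^n = a / c] lies in [A], hence so does [U = H(z^n)]. *)
Lemma coordinate_in_A_unit_case c : b = CC k c -> exists u, eps u = 'X.
Proof.
move=> bc; have c0 : c != 0.
  by apply: contraNneq b0 => c0; rewrite bc c0 rmorph0.
have -> : 'X = (map_poly eps H).[eps (CC k c^-1 * a)].
  rewrite [LHS]eps_U (rmorphM eps) -eps_a bc !eps_const mulrA -CCM mulVf //.
  by rewrite (rmorph1 (CC k)) mul1r.
by exists H.[CC k c^-1 * a]; rewrite horner_map.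
Qed.

Section Extension.
Variable L : fieldExtType k.
Let iota : {rmorphism k -> L} := in_alg L.
Let E : {rmorphism bipoly L -> bipoly L} := subst (bmap iota (eps 'X%:P)) (bmap iota (eps 'X)).

Lemma E_bmap y : E (bmap iota y) = bmap iota (eps y).
Proof. by rewrite [in RHS](substE eps_const) bmap_subst. Qed.

(** Elements of [A] are polynomials in [x] up to multiples of [a = b z^n]; on the curve [x] is
    constant and [b] vanishes. *)
Lemma constant_on_curve (f : {poly L}) (r : L) y : (bmap iota (eps b)).[f] = 0 ->
  (bmap iota (eps H`_0)).[f] = r%:P -> exists c : L, (E y).[f] = c%:P.
Proof.
move=> bf xf; have const y0 : exists c : L, (bmap iota (eps y0)).[f] = c%:P.
  have [p [y' ->]] := mod_a eps_const n_gt0 eps_z0 eps_U y0.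
  exists (map_poly iota p).[r].
  rewrite (rmorphD eps) (rmorphM eps) -eps_a morph_at_const // (rmorphD (bmap iota)).
  rewrite !(rmorphM (bmap iota)) hornerD !hornerM bf !mul0r addr0.
  by rewrite bmap_at_const; apply: horner_at_const.
have [[cX DX] [cY DY]] := (const 'X%:P, const 'X).
exists (ev2 idfun cX cY y).
apply: (bipoly_morphism_ext (g := horner_eval f \o E) (h := polyC \o ev2 idfun cX cY)).
- by move=> c; rewrite /= /horner_eval !ev2C -CCE hornerC.
- by rewrite /= /horner_eval !ev2X DX.
- by rewrite /= /horner_eval !ev2Y DY.
Qed.

Lemma descend_coordinate (g : {poly L}) (r : L) (Q : {poly L}) : (1 < size Q)%N ->
  bmap iota (eps b) = at_const ('X - (g \Po 'X^n)%:P) Q ->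
  (bmap iota (eps b)).[g \Po 'X^n] = 0 -> (bmap iota (eps H`_0)).[g \Po 'X^n] = r%:P ->
  exists (u : bipoly k) (h q : {poly k}), eps u = 'X - h%:P /\ b = at_const u q.
Proof.
move=> sQ bQ bf xf; set f := g \Po _ in bQ bf xf.
have E_const : const_fixing E := subst_const_fixing _ _.
have E_inj : injective E := extend_injective eps_const eps_inj.
have bL0 : bmap iota b != 0 by rewrite -(rmorph0 (bmap iota)) (inj_eq (@bmap_inj k L iota)).
have E_a : E (bmap iota b) * 'X%:P ^+ n = E (bmap iota a).
  by rewrite !E_bmap -eps_a (rmorphM (bmap iota)) (rmorphXn (bmap iota)) bmapX.
pose G := map_poly (bmap iota) H - map_poly (CC L) g.
have DG : (map_poly E G).['X%:P ^+ n] = 'X - f%:P.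
  rewrite rmorphB /= hornerD hornerN -!map_poly_comp; congr (_ - _).
    rewrite -(bmapY iota) [in RHS]eps_U -(bmapX iota) -(rmorphXn (bmap iota)).
    rewrite -horner_map -map_poly_comp; congr (_.[_]).
    by apply: eq_map_poly => y /=; rewrite E_bmap.
  rewrite -at_const_Zn at_constE; congr (_.[_]).
  by apply: eq_map_poly => c /=; rewrite E_const.
have [N [y]] := clear_denominators E_a G; rewrite DG => Dy.
have [|uL DuL] := integral_in_image E_const E_inj bL0 sQ _ Dy; first by rewrite E_bmap.
have [rho rho1] := unit_functional L.
have hat1 : hat rho 1 = 1.
  by rewrite -(rmorph1 (CC L)) hat_CC -(rmorph1 iota) rho1 rmorph1.
have hat_bmap s : hat rho (bmap iota s) = s.
  by rewrite -[bmap _ _]mulr1 hat_bmapM hat1 mulr1.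
(* The preimage [uL] of [U - f] exists only over [L]; applying [rho] gives [u] over [k], with image
   [U - h]. *)
pose u := hat rho uL; pose h := map_poly rho f.
have Eu : eps u = 'X - h%:P.
  by rewrite -hat_ev2 // [X in hat rho X]DuL hatB hat_polyC -(bmapY iota) hat_bmap.
(* The difference of [uL] and [u] is constant on the curve, while its image [h - f] lies in [L[z]].
   So [f] and [h] differ by a constant, and [b] is a polynomial in [u] over [L]. *)
have [e De] := constant_on_curve (uL - bmap iota u) bf xf.
have DU : 'X - f%:P = bmap iota (eps u) + CC L e.
  move: De; rewrite (rmorphB E) DuL E_bmap Eu (rmorphB (bmap iota)) bmapY bmap_polyC.
  rewrite !(hornerD, hornerN, hornerX, hornerC) subrr sub0r opprB => De.
  by rewrite -CCE -De polyCB addrA subrK.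
exists u, h, (map_poly rho (Q \Po ('X + e%:P))); split=> //.
apply: eps_inj; rewrite morph_at_const // -hat_at_const -[LHS]hat_bmap bQ DU.
by congr (hat rho _); rewrite at_const_comp (rmorphD (at_const _)) at_constX at_constC.
Qed.

End Extension.

Lemma coordinate_in_A : exists (u : bipoly k) (h q : {poly k}),
  eps u = 'X - h%:P /\ b = at_const u q.
Proof.
have [P [W]] := expand_mod_b eps_const n_gt0 eps_a eps_z0 eps_U H.
rewrite -eps_U => DU.
have [b' [beta [beta0 Dbeta]]] := x_root_mod_b eps_const eps_inj n_gt0 b0 eps_a eps_z0 eps_U.
have [L [rs Drs]] := splitting_extension beta0.
have [[c c0 bc]|[g [r [Q [sQ [bQ [bf xf]]]]]]] := split_b DU Dbeta Drs; last first.
  exact: descend_coordinate sQ bQ bf xf.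
have [rho rho1] := unit_functional L.
have Db : b = CC k (rho c).
  apply: eps_inj; rewrite eps_const -hat_CC -bc -[bmap _ _]mulr1 hat_bmapM.
  by rewrite -(rmorph1 (CC L)) hat_CC -(rmorph1 (in_alg L)) rho1 rmorph1 mulr1.
have [u Du] := coordinate_in_A_unit_case Db.
by exists u, 0, (rho c)%:P; rewrite Du polyC0 subr0 at_constC.
Qed.

Theorem descent : exists u : bipoly k, [/\ exists q, b = at_const u q,
  forall y, exists P, y = subst u a P & forall W, exists P, W = subst (eps u) 'X%:P P].
Proof.
have [u [h [q [Du Db]]]] := coordinate_in_A; exists u.
(* [theta] sends [U - h(z)] to the inner indeterminate and [z] to the outer one, the layout required
   by [generated_by_u_a]. *)
pose theta : {rmorphism bipoly k -> bipoly k} := subst 'X ('X%:P + at_const 'X h).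
pose theta' : {rmorphism bipoly k -> bipoly k} := subst ('X - h%:P) 'X%:P.
have theta'X : theta' 'X = 'X%:P by rewrite /theta' /= ev2Y.
have thetaK : cancel theta theta'.
  have : theta' ('X%:P + at_const 'X h) = 'X.
    rewrite (rmorphD theta') morph_at_const ?theta'X; last exact: subst_const_fixing.
    by rewrite {1}/theta' /= ev2X at_const_Z subrK.
  move: theta'X; rewrite /theta /theta' /= => eX eY p.
  by rewrite ev2_subst eX eY ev2_id.
have theta_h : theta h%:P = at_const 'X h.
  rewrite -at_const_Z morph_at_const /=; last exact: subst_const_fixing.
  by rewrite ev2X.
split; [by exists q| |by move=> W; exists (theta W); rewrite Du; exact/esym/thetaK].
pose E : {rmorphism bipoly k -> bipoly k} := theta \o eps.
have E_const : const_fixing E by move=> c; rewrite /= eps_const /theta /= ev2C.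
have E_u : E u = 'X%:P by rewrite /= Du (rmorphB theta) theta_h /theta /= ev2Y addrK.
move=> y; apply: (@generated_by_u_a k E a b u y n q) => //.
- by move=> p1 p2 /(congr1 theta'); rewrite /= !thetaK => /eps_inj.
- rewrite /= -eps_a (rmorphM theta) (rmorphXn theta); congr (_ * _ ^+ _).
  by rewrite /theta /= ev2X.
- move=> y1 s /(congr1 theta'); rewrite /= thetaK (rmorphM theta').
  by rewrite {1}/theta' /= ev2Y; apply: eps_z0.
- by rewrite Db morph_at_const // E_u at_const_Z.
Qed.

End DescentTheorem.
(** * Weighted homogeneous components *)

Section Components.
Variables (k : fieldType) (w1 w2 w3 : int).
Implicit Types (P Q : {poly bipoly k}).

(** The weight of [X^i Y^j s^l], with [s] the parameter of the action; it is an integer because [s]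
    may get a negative weight. *)
Definition weight (l j i : nat) : int := w1 * i%:Z + w2 * j%:Z + w3 * l%:Z.

Definition filtered (N : int) P :=
  forall l j i, P`_l`_j`_i != 0 -> (weight l j i <= N)%R.

Definition component (N : int) P : {poly bipoly k} :=
  \poly_(l < size P) \poly_(j < size P`_l) \poly_(i < size P`_l`_j)
    (if weight l j i == N then P`_l`_j`_i else 0).

Lemma coef_component N P l j i :
  (component N P)`_l`_j`_i = if weight l j i == N then P`_l`_j`_i else 0.
Proof.
rewrite coef_poly; case: ltnP => [_|hl]; last first.
  by rewrite (nth_default 0 hl) !coef0 if_same.
rewrite coef_poly; case: ltnP => [_|hj]; last first.
  by rewrite (nth_default 0 hj) !coef0 if_same.
by rewrite coef_poly; case: ltnP => // hi; rewrite (nth_default 0 hi) if_same.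
Qed.

Lemma tripoly_ext P Q : (forall l j i, P`_l`_j`_i = Q`_l`_j`_i) -> P = Q.
Proof. by move=> h; do 3!apply/polyP => ?; exact: h. Qed.

Lemma component_sum (I : Type) (r : seq I) (F : I -> {poly bipoly k}) N :
  component N (\sum_(i <- r) F i) = \sum_(i <- r) component N (F i).
Proof.
elim/big_rec2: _ => [|i P Q _ <-]; apply: tripoly_ext => l j m.
  by rewrite coef_component !coef0 if_same.
by rewrite !(coef_component, coefD); case: ifP; rewrite ?addr0.
Qed.

Lemma coef_tripolyM P Q l j i : (P * Q)`_l`_j`_i =
  \sum_(l' < l.+1) \sum_(j' < j.+1) \sum_(i' < i.+1)
    P`_l'`_j'`_i' * Q`_(l - l')`_(j - j')`_(i - i').
Proof.
rewrite coefM !coef_sum; apply: eq_bigr => l' _.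
by rewrite coefM coef_sum; apply: eq_bigr => j' _; rewrite coefM.
Qed.

Lemma weight_split l j i (l' : 'I_l.+1) (j' : 'I_j.+1) (i' : 'I_i.+1) :
  weight l j i = weight l' j' i' + weight (l - l') (j - j') (i - i').
Proof.
rewrite -{1}(subnKC (ltn_ord l' : l' <= l)%N) -{1}(subnKC (ltn_ord j' : j' <= j)%N).
by rewrite -{1}(subnKC (ltn_ord i' : i' <= i)%N) /weight !PoszD; ring.
Qed.

Lemma componentM M N P Q : filtered M P -> filtered N Q ->
  component (M + N) (P * Q) = component M P * component N Q.
Proof.
move=> hP hQ; apply: tripoly_ext => l j i.
rewrite coef_component !coef_tripolyM.
have -> (c : bool) (x : k) : (if c then x else 0) = x *+ c by case: c.
rewrite -sumrMnl; apply: eq_bigr => l' _.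
rewrite -sumrMnl; apply: eq_bigr => j' _.
rewrite -sumrMnl; apply: eq_bigr => i' _.
rewrite !coef_component (weight_split l' j' i').
have [->|P0] := eqVneq P`_l'`_j'`_i' 0; first by rewrite if_same !mul0r mul0rn.
have [->|Q0] := eqVneq Q`_(l - l')`_(j - j')`_(i - i') 0.
  by rewrite if_same !mulr0 mul0rn.
have := hP _ _ _ P0; have := hQ _ _ _ Q0.
set y := weight _ _ _; set x := weight _ _ _ => hy hx.
have [ex|ne] := eqVneq x M; have [ey|ne'] := eqVneq y N; rewrite ?mulr0 ?mul0r.
- by rewrite ex ey eqxx mulr1n.
all: by rewrite (_ : _ == _ = false) //; apply/eqP; lia.
Qed.

Lemma filteredM M N P Q : filtered M P -> filtered N Q -> filtered (M + N) (P * Q).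
Proof.
move=> hP hQ l j i; apply: contraNT => hw; rewrite coef_tripolyM.
rewrite big1 // => l' _; rewrite big1 // => j' _; rewrite big1 // => i' _.
have [->|P0] := eqVneq P`_l'`_j'`_i' 0; first by rewrite mul0r.
have [->|Q0] := eqVneq Q`_(l - l')`_(j - j')`_(i - i') 0; first by rewrite mulr0.
have := hP _ _ _ P0; have := hQ _ _ _ Q0; move: hw; rewrite (weight_split l' j' i').
by move: (weight _ _ _) (weight _ _ _) => x y; lia.
Qed.

Lemma component_gt M N P : filtered M P -> (M < N)%R -> component N P = 0.
Proof.
move=> hP lt_MN; apply: tripoly_ext => l j i; rewrite coef_component !coef0.
case: eqP => // hw; apply/eqP; apply/negP => /negP/hP; rewrite hw; lia.
Qed.

Lemma coef_tripolyC (c : k) l j i : (CC k c)%:P`_l`_j`_i = c *+ [&& l == 0, j == 0 & i == 0]%N.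
Proof.
rewrite coefC; case: l => [|l] /=; last by rewrite !coef0.
rewrite -CCE coefC; case: j => [|j] /=; last by rewrite !coef0.
by rewrite coefC; case: i.
Qed.

Lemma filteredC c : filtered 0 (CC k c)%:P.
Proof.
move=> l j i; rewrite coef_tripolyC; case: and3P => [[/eqP-> /eqP-> /eqP->] _|]; last by rewrite eqxx.
by rewrite /weight !mulr0.
Qed.

Lemma componentC c : component 0 (CC k c)%:P = (CC k c)%:P.
Proof.
apply: tripoly_ext => l j i; rewrite coef_component coef_tripolyC.
case: and3P => [[/eqP-> /eqP-> /eqP->]|]; last by rewrite if_same.
by rewrite /weight !mulr0.
Qed.

Lemma filteredX M P n : filtered M P -> filtered (M *+ n) (P ^+ n).
Proof.
move=> hP; elim: n => [|n IH].
  by have := @filteredC 1; rewrite (rmorph1 (CC k)).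
by rewrite exprS mulrS; apply: filteredM.
Qed.

Lemma componentX M P n : filtered M P -> component (M *+ n) (P ^+ n) = component M P ^+ n.
Proof.
move=> hP; elim: n => [|n IH].
  by have := componentC 1; rewrite (rmorph1 (CC k)).
by rewrite !exprS mulrS componentM ?IH //; apply: filteredX.
Qed.

End Components.

Lemma ev2_poly (k S : comNzRingType) (f : {rmorphism k -> S}) x y m n
    (c : nat -> nat -> k) :
  ev2 f x y (\poly_(j < m) \poly_(i < n j) c j i) =
  \sum_(j < m) \sum_(i < n j) f (c j i) * x ^+ i * y ^+ j.
Proof.
rewrite poly_def (rmorph_sum (ev2 f x y)); apply: eq_bigr => j _.
rewrite -mul_polyC (rmorphM (ev2 f x y)) (rmorphXn (ev2 f x y)) /= ev2Y -mulr_suml.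
congr (_ * _); rewrite poly_def rmorph_sum (rmorph_sum (ev2 f x y)); apply: eq_bigr => i _.
rewrite -mul_polyC /= polyCM polyC_exp CCE (rmorphM (ev2 f x y)) (rmorphXn (ev2 f x y)) /=.
by rewrite ev2C ev2X.
Qed.

HB.lock Definition CCs (k : comNzRingType) : {rmorphism k -> {poly bipoly k}} :=
  polyC \o CC k.

Lemma CCsE (k : comNzRingType) (c : k) : (CC k c)%:P = CCs k c.
Proof. by rewrite [CCs]unlock. Qed.

(* [ev2s x y p] is [p(x, y)] for [x] and [y] in [k[X,Y][s]]. *)
Notation ev2s := (ev2 (CCs _)).

Section Grade.
Variables (k : fieldType) (D E : nat).
Implicit Types p q : bipoly k.

(** The weights [D] of [X] and [E] of [Y] are crossed with the bidegree [(E, D)], so that the corner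
    monomials [X^E] and [Y^D] both have weight [D * E]. *)
Definition grade (N : nat) p : bipoly k :=
  \poly_(j < size p) \poly_(i < size p`_j) (if (D * i + E * j == N)%N then p`_j`_i else 0).

Definition wdeg_le (N : nat) p := forall j i, p`_j`_i != 0 -> (D * i + E * j <= N)%N.

Lemma coef_grade N p j i :
  (grade N p)`_j`_i = if (D * i + E * j == N)%N then p`_j`_i else 0.
Proof.
rewrite coef_poly; case: ltnP => [_|hj]; last first.
  by rewrite (nth_default 0 hj) !coef0 if_same.
by rewrite coef_poly; case: ltnP => // hi; rewrite (nth_default 0 hi) if_same.
Qed.

(** The weights of [X] and [Y] are multiplied by [b] so that a slope with denominator [b] gives [s]
    an integral weight. *)
Lemma component_subst (b N : nat) (w3 : int) p x y : (0 < b)%N -> wdeg_le N p ->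
  filtered (b * D)%N (b * E)%N w3 (b * D)%N x -> filtered (b * D)%N (b * E)%N w3 (b * E)%N y ->
  component (b * D)%N (b * E)%N w3 (b * N)%N (ev2s x y p) =
  ev2s (component (b * D)%N (b * E)%N w3 (b * D)%N x)
       (component (b * D)%N (b * E)%N w3 (b * E)%N y) (grade N p).
Proof.
move=> b0 hp hx hy; set w1 := (b * D)%N; set w2 := (b * E)%N.
rewrite ev2_poly ev2E component_sum; apply: eq_bigr => j _.
rewrite component_sum; apply: eq_bigr => i _ /=.
have hc := @filteredC k w1 w2 w3 p`_j`_i; rewrite CCsE in hc.
have hxi := @filteredX k w1 w2 w3 _ _ i hx; have hyj := @filteredX k w1 w2 w3 _ _ j hy.
have hxy := filteredM (filteredM hc hxi) hyj.
have [->|c0] := eqVneq p`_j`_i 0.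
  rewrite if_same !rmorph0 !mul0r; apply: tripoly_ext => l' j' i'.
  by rewrite coef_component !coef0 if_same.
have := hp _ _ c0; rewrite leq_eqVlt => /predU1P [DN|lt_N].
  rewrite DN eqxx (_ : ((b * N)%N : int) = 0 + w1%:Z *+ i + w2%:Z *+ j); last first.
    by rewrite -DN /w1 /w2; lia.
  rewrite (componentM (filteredM hc hxi) hyj) (componentM hc hxi) !componentX //.
  by rewrite -CCsE componentC.
rewrite (component_gt hxy); last by rewrite /w1 /w2; nia.
by rewrite ltn_eqF // !rmorph0 !mul0r.
Qed.

Lemma componentC_grade (N : nat) p : component D E 0 N p%:P = (grade N p)%:P.
Proof.
apply: tripoly_ext => l j i; rewrite coef_component !coefC; case: l => [|l] /=; last first.
  by rewrite !coef0 if_same.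
rewrite coef_grade /weight mulr0 addr0 -!PoszM -PoszD; by [].
Qed.

Lemma filteredC_wdeg N p : wdeg_le N p -> filtered D E 0 N p%:P.
Proof.
move=> hp l j i; rewrite coefC; case: l => [|l] /=; last by rewrite !coef0 eqxx.
by move/hp; rewrite /weight; lia.
Qed.

Lemma gradeM M N p q : wdeg_le M p -> wdeg_le N q ->
  grade (M + N) (p * q) = grade M p * grade N q.
Proof.
move=> hp hq; apply: polyC_inj; rewrite polyCM -!componentC_grade polyCM PoszD.
by apply: componentM; exact: filteredC_wdeg.
Qed.

Lemma wdegM M N p q : wdeg_le M p -> wdeg_le N q -> wdeg_le (M + N) (p * q).
Proof.
move=> hp hq j i h; have hpq := filteredM (filteredC_wdeg hp) (filteredC_wdeg hq).
by have := hpq 0%N j i; rewrite -polyCM coefC eqxx => /(_ h); rewrite /weight; lia.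
Qed.

Lemma wdeg_exists p : p != 0 -> exists N, wdeg_le N p /\ grade N p != 0.
Proof.
move=> p0; pose M := (\max_(j < size p) size (p`_j)%R)%N.
have bound N : grade N p != 0 -> (N <= D * M + E * size p)%N.
  apply: contraNT => hN; apply/eqP/polyP => j; apply/polyP => i.
  rewrite coef_grade !coef0; case: eqP => // DN.
  have [hj|hj] := leqP (size p) j; first by rewrite (nth_default 0 hj) coef0.
  rewrite nth_default //; have := leq_bigmax (Ordinal hj) (F := fun j : 'I__ => size p`_j).
  rewrite -/M /=; move: hN hj; rewrite -DN; move: (size p) (size p`_j) => s t.
  by case: (leqP t i) => //; nia.
have ex : exists N, grade N p != 0.
  have [j pj0] : exists j, p`_j != 0.
    by exists (size p).-1; rewrite -lead_coefE lead_coef_eq0.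
  have [i pji0] : exists i, p`_j`_i != 0.
    by exists (size p`_j).-1; rewrite -lead_coefE lead_coef_eq0.
  exists (D * i + E * j)%N; apply: contraNneq pji0 => /(congr1 (fun q : bipoly k => q`_j`_i)).
  by rewrite coef_grade eqxx !coef0 => ->.
case: (ex_maxnP ex bound) => N gN maxN; exists N; split=> // j i pji0.
apply: maxN; apply: contraNneq pji0 => /(congr1 (fun q : bipoly k => q`_j`_i)).
by rewrite coef_grade eqxx !coef0 => ->.
Qed.

End Grade.

(** A pair stands for a fraction with positive denominator; fractions are compared by cross
    multiplication. *)
Lemma max_slope (s : seq (int * nat)) : s != [::] -> (forall x, x \in s -> (0 < x.2)%N) ->
  exists2 x, x \in s & forall y, y \in s -> (y.1 * x.2%:Z <= x.1 * y.2%:Z)%R.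
Proof.
elim: s => // x0 s IH _ hpos.
have x0_pos := hpos _ (mem_head _ _).
have [->|s0] := eqVneq s [::].
  by exists x0; rewrite ?mem_head // => y; rewrite inE => /eqP ->.
have [|x xs hx] := IH s0; first by move=> y ys; apply: hpos; rewrite in_cons ys orbT.
have x_pos : (0 < x.2)%N by apply: hpos; rewrite in_cons xs orbT.
have [le|lt] := lerP (x0.1 * x.2%:Z) (x.1 * x0.2%:Z).
  exists x; rewrite ?in_cons ?xs ?orbT // => y; rewrite in_cons => /predU1P[->//|]; exact: hx.
exists x0; rewrite ?mem_head // => y; rewrite in_cons => /predU1P[->//|ys].
have y_pos : (0 < y.2)%N by apply: hpos; rewrite in_cons ys orbT.
have := hx _ ys; move: x_pos y_pos x0_pos lt {hx hpos IH xs ys s0}.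
case: x x0 y => [x1 x2] [z1 z2] [y1 y2] /= x_pos y_pos z_pos lt le.
rewrite -(ler_pM2r (_ : 0 < x2%:Z)) ?ltz_nat //.
apply: le_trans (_ : x1 * y2%:Z * z2%:Z <= _); first by nia.
nia.
Qed.

Definition support (k : fieldType) (P : {poly bipoly k}) : seq (nat * nat * nat) :=
  flatten [seq flatten [seq [seq (l, j, i) | i <- iota 0 (size P`_l`_j)]
    | j <- iota 0 (size P`_l)] | l <- iota 0 (size P)].

Lemma mem_support (k : fieldType) (P : {poly bipoly k}) l j i :
  P`_l`_j`_i != 0 -> (l, j, i) \in support P.
Proof.
move=> h; have lt0 (R : nzRingType) (p : {poly R}) m : p`_m != 0 -> m \in iota 0 (size p).
  by rewrite mem_iota add0n /= ltnNge; apply: contraNN => hm; rewrite nth_default.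
have hj : P`_l`_j != 0 by apply: contraNneq h => ->; rewrite coef0.
have hl : P`_l != 0 by apply: contraNneq hj => ->; rewrite coef0.
apply/flattenP; eexists; first by apply/mapP; exists l; [exact: lt0 | reflexivity].
apply/flattenP; eexists; first by apply/mapP; exists j; [exact: lt0 | reflexivity].
by apply/mapP; exists i => //; exact: lt0.
Qed.

Section Degeneration.
Variables (k : fieldType) (D E : nat).

(** A term [X^i Y^j s^l] in the deformation of a variable of weight [w] exceeds [w] by
    [D i + E j - w]; giving [s] the weight minus this excess over [l] brings the term back to
    exactly [w]. *)
Let slopes (w : nat) (P : {poly bipoly k}) : seq (int * nat) :=
  [seq ((D * t.2 + E * t.1.2)%N%:Z - w%:Z, t.1.1) | t <- support P
     & (0 < t.1.1)%N && (P`_t.1.1`_t.1.2`_t.2 != 0)].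

Let slopesP (w : nat) (P : {poly bipoly k}) x : reflect (exists l j i : nat, [/\ (0 < l)%N, P`_l`_j`_i != 0 &
  x = ((D * i + E * j)%N%:Z - w%:Z, l)]) (x \in slopes w P).
Proof.
apply: (iffP mapP) => [[[[l j] i]]|[l [j [i [l0 h ->]]]]].
  by rewrite mem_filter => /andP[/= /andP[l0 h] _] ->; exists l, j, i.
by exists (l, j, i); rewrite // mem_filter /= l0 h mem_support.
Qed.

Let slopes_neq0 w (P : {poly bipoly k}) : (1 < size P)%N -> slopes w P != [::].
Proof.
move=> hP; pose l := (size P).-1; pose j := (size P`_l).-1; pose i := (size P`_l`_j).-1.
have l0 : P`_l != 0 by rewrite -lead_coefE lead_coef_eq0 -size_poly_gt0 (ltn_trans _ hP).
have j0 : P`_l`_j != 0 by rewrite -lead_coefE lead_coef_eq0.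
have i0 : P`_l`_j`_i != 0 by rewrite -lead_coefE lead_coef_eq0.
have : ((D * i + E * j)%N%:Z - w%:Z, l) \in slopes w P.
  apply/slopesP; exists l, j, i; split=> //; rewrite /l.
  by move: hP; case: (size P) => [|[]].
by case: (slopes w P).
Qed.

(* The weight of [s] is minus the largest slope, so that [x] and [y] have
   weights [D] and [E] and some coefficient of positive degree in [s] survives. *)
Lemma degeneration (N : nat) (F : bipoly k) (x y : {poly bipoly k}) :
  wdeg_le D E N F -> x`_0 = 'X%:P -> y`_0 = 'X -> ev2s x y F = F%:P ->
  (1 < size x)%N || (1 < size y)%N ->
  exists x' y' : {poly bipoly k}, [/\ x'`_0 = 'X%:P, y'`_0 = 'X,
    (1 < size x')%N || (1 < size y')%N & ev2s x' y' (grade D E N F) = (grade D E N F)%:P].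
Proof.
move=> hF x0 y0 hxy nontriv.
have [||[a b] ab_in ab_max] := max_slope (s := slopes D x ++ slopes E y).
- by case/orP: nontriv => /slopes_neq0 h; rewrite -size_eq0 size_cat addn_eq0 !size_eq0
    (negPf (h _)) ?andbF.
- by move=> z; rewrite mem_cat => /orP[] /slopesP [l [j [i [l0 _ ->]]]].
have b0 : (0 < b)%N.
  by move: ab_in; rewrite mem_cat => /orP[] /slopesP [l [j [i [l0 _ [_ ->]]]]].
pose w1 := (b * D)%N; pose w2 := (b * E)%N.
have fx : filtered w1 w2 (- a) w1 x.
  move=> [|l] j i h; rewrite /weight.
    by move: h; rewrite x0 coefC; case: j => [|j]; rewrite ?coef0 ?eqxx // coefX;
      case: i => [|[]] //=; rewrite ?eqxx // /w1; lia.
  have /ab_max /= : ((D * i + E * j)%N%:Z - D%:Z, l.+1) \in slopes D x ++ slopes E y.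
    by rewrite mem_cat; apply/orP; left; apply/slopesP; exists l.+1, j, i.
  by rewrite /w1 /w2; nia.
have fy : filtered w1 w2 (- a) w2 y.
  move=> [|l] j i h; rewrite /weight.
    by move: h; rewrite y0 coefX; case: j => [|[]] //=; rewrite ?coef0 ?eqxx // coefC;
      case: i => [|i] //=; rewrite ?eqxx // /w2; lia.
  have /ab_max /= : ((D * i + E * j)%N%:Z - E%:Z, l.+1) \in slopes D x ++ slopes E y.
    by rewrite mem_cat; apply/orP; right; apply/slopesP; exists l.+1, j, i.
  by rewrite /w1 /w2; nia.
exists (component w1 w2 (- a) w1 x), (component w1 w2 (- a) w2 y); split.
- apply/polyP => j; apply/polyP => i; rewrite coef_component x0 coefC.
  case: j => [|j]; rewrite ?coef0 ?if_same // coefX /weight.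
  by case: i => [|[|i]] /=; rewrite ?if_same // mulr0 mulr1 addr0 mulr0 addr0 eqxx.
- apply/polyP => j; apply/polyP => i; rewrite coef_component y0 coefX.
  case: j => [|[|j]] /=; rewrite ?coef0 ?if_same // coefC /weight.
  by case: i => [|i] /=; rewrite ?if_same // mulr0 mulr1 add0r mulr0 addr0 eqxx.
- have gt1 (P : {poly bipoly k}) (l j i : nat) (w : int) : (0 < l)%N -> (component w1 w2 (- a) w P)`_l`_j`_i != 0 ->
      (1 < size (component w1 w2 (- a) w P))%N.
    move=> l0; apply: contraNT; rewrite -leqNgt => h.
    by rewrite (nth_default _ (leq_trans h l0)) !coef0.
  move: ab_in; rewrite mem_cat => /orP[] /slopesP [l [j [i [l0 h [Da Db]]]]]; apply/orP.
    left; apply: (gt1 x l j i w1%:Z l0); rewrite coef_component.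
    rewrite (_ : weight _ _ _ _ _ _ = w1%:Z) ?eqxx //.
    by rewrite /weight /w1 /w2 Da Db !PoszD !PoszM; ring.
  right; apply: (gt1 y l j i w2%:Z l0); rewrite coef_component.
  rewrite (_ : weight _ _ _ _ _ _ = w2%:Z) ?eqxx //.
    by rewrite /weight /w1 /w2 Da Db !PoszD !PoszM; ring.
- rewrite -component_subst // hxy; apply: tripoly_ext => l j i.
  rewrite coef_component !coefC; case: l => [|l] /=; last by rewrite !coef0 if_same.
  rewrite coef_grade /weight mulr0 addr0; congr (if _ then _ else _).
  by apply/eqP/eqP; rewrite /w1 /w2; nia.
Qed.

End Degeneration.
(** * Binary forms *)

Section BinaryForms.
Variables (k : fieldType) (S : comNzRingType) (phi : {rmorphism k -> S}).

(** The homogenization of [f] in degree [g], evaluated at [(a, b)]: a factor ['X - mu] of [f]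
    becomes a factor [a - mu b]. *)
Definition bform (g : nat) (f : {poly k}) (a b : S) : S :=
  \sum_(t < g.+1) phi f`_t * a ^+ t * b ^+ (g - t).

Lemma bformB g (f f' : {poly k}) a b : bform g (f - f') a b = bform g f a b - bform g f' a b.
Proof.
rewrite /bform -sumrB; apply: eq_bigr => t _.
by rewrite coefB rmorphB; ring.
Qed.

Lemma bform_mulXsubC g (h : {poly k}) mu a b : (size h <= g.+1)%N ->
  bform g.+1 (h * ('X - mu%:P)) a b = bform g h a b * (a - phi mu * b).
Proof.
move=> hh; rewrite mulrBr bformB mulrBr /bform; congr (_ - _).
  rewrite big_ord_recl coefMX rmorph0 !mul0r add0r mulr_suml.
  by apply: eq_bigr => t _; rewrite coefMX /= /bump /= add1n subSS exprS; ring.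
rewrite big_ord_recr /= coefMC (nth_default 0 hh) mul0r rmorph0 !mul0r addr0 mulr_suml.
apply: eq_bigr => t _; have le_tg : (t <= g)%N by rewrite -ltnS.
by rewrite coefMC rmorphM subSn // [b ^+ _.+1]exprS; ring.
Qed.

Lemma bform_mulXsubCX g (h : {poly k}) mu e a b : (size h <= g.+1)%N ->
  bform (g + e) (h * ('X - mu%:P) ^+ e) a b = bform g h a b * (a - phi mu * b) ^+ e.
Proof.
move=> hh; elim: e => [|e IH]; first by rewrite addn0 !expr0 !mulr1.
rewrite addnS exprSr [X in bform _ X]mulrA bform_mulXsubC ?IH ?exprSr ?mulrA //.
apply: leq_trans (size_polyMleq _ _) _; rewrite size_exp_XsubC.
by move: hh; case: (size h) => [|n]; rewrite ?add0n ?addSn /= ?addnS /= => hh; rewrite ?ltnS; lia.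
Qed.

Lemma bform_proportional g (f : {poly k}) mu b : (size f <= g.+1)%N ->
  bform g f (phi mu * b) b = phi f.[mu] * b ^+ g.
Proof.
move=> hf; rewrite (horner_coef_wide mu hf) rmorph_sum mulr_suml.
apply: eq_bigr => t _; rewrite exprMn rmorphM rmorphXn /=.
have -> : b ^+ g = b ^+ t * b ^+ (g - t) by rewrite -exprD subnKC // -ltnS.
by ring.
Qed.

End BinaryForms.

Lemma coefM_top (R : nzRingType) (p q : {poly R}) m n :
  (size p <= m.+1)%N -> (size q <= n.+1)%N -> (p * q)`_(m + n) = p`_m * q`_n.
Proof.
move=> hp hq; rewrite coefM (bigD1 (inord m)) //= inordK ?ltnS ?leq_addr //.
rewrite addKn big1 ?addr0 // => i ne_im.
have [lt_im|lt_mi|e] := ltngtP i m.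
- rewrite [q`__]nth_default ?mulr0 //; apply: leq_trans hq _.
  by move: lt_im (ltn_ord i); lia.
- by rewrite nth_default ?mul0r //; apply: leq_trans hp _.
- by case/eqP: ne_im; apply: val_inj; rewrite /= inordK ?ltnS ?leq_addr.
Qed.

Lemma coefX_top (R : nzRingType) (p : {poly R}) m n :
  (size p <= m.+1)%N -> (size (p ^+ n) <= (n * m).+1)%N /\ (p ^+ n)`_(n * m) = p`_m ^+ n.
Proof.
move=> hp; elim: n => [|n [IH1 IH2]]; first by rewrite expr0 size_poly1 coef1.
rewrite !exprS mulSn coefM_top // IH2; split=> //.
apply: leq_trans (size_polyMleq _ _) _.
by move: hp IH1; move: (size p) (size _) => i j; lia.
Qed.

Lemma coef_bform (k : fieldType) (R : comNzRingType) (phi : {rmorphism k -> R})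
    (phi' : {rmorphism k -> {poly R}}) (g d : nat) f (a b : {poly R}) :
  (forall c, phi' c = (phi c)%:P) -> (size a <= d.+1)%N -> (size b <= d.+1)%N ->
  (bform phi' g f a b)`_(g * d) = bform phi g f a`_d b`_d.
Proof.
move=> hphi ha hb; rewrite coef_sum; apply: eq_bigr => t _.
have [sa ca] := coefX_top t ha; have [sb cb] := coefX_top (g - t) hb.
rewrite hphi -mulrA coefCM -mulrA; congr (_ * _).
have -> : (g * d = t * d + (g - t) * d)%N by rewrite -mulnDl subnKC // -ltnS.
by rewrite coefM_top // ca cb.
Qed.

Lemma size_sum_distinct (R : nzRingType) (I : finType) (F : I -> {poly R}) :
  (forall i j, F i != 0 -> F j != 0 -> size (F i) = size (F j) -> i = j) ->
  forall i, (size (F i) <= size (\sum_j F j)%R)%N.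
Proof.
move=> inj i; have [->|Fi0] := eqVneq (F i) 0; first by rewrite size_poly0.
have [m Fm0 hm] := @arg_maxnP I i (fun j => F j != 0) (fun j => size (F j)) Fi0.
rewrite (bigD1 m) //= size_polyDl; first exact: hm.
have F_m : (0 < size (F m))%N by rewrite size_poly_gt0.
elim/big_ind: _ => [|p q hp hq|j ne_jm]; first by rewrite size_poly0.
  by apply: leq_ltn_trans (size_polyD _ _) _; rewrite gtn_max hp hq.
have [->|Fj0] := eqVneq (F j) 0; first by rewrite size_poly0.
by rewrite ltn_neqAle [(size _ <= _)%N]hm // andbT; apply: contraNneq ne_jm => /inj ->.
Qed.

(* [k] is algebraically closed in the fraction field of [R]: the ratio of a
   nontrivial zero of a binary form is a constant. *)
Definition ratio_closed (k : fieldType) (R : idomainType) (phi : {rmorphism k -> R}) :=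
  forall g (f : {poly k}) (a b : R), f != 0 -> (size f <= g.+1)%N -> b != 0 ->
    bform phi g f a b = 0 -> exists mu, a = phi mu * b.

Lemma field_ratio_closed (k : fieldType) : @ratio_closed k k idfun.
Proof. by move=> g f a b _ _ b0 _; exists (a / b); rewrite /= divfK. Qed.

(** If [a] and [b] had different degrees, the terms of the form would have distinct degrees and
    could not cancel. So the leading coefficients satisfy the same equation over [R], with some
    ratio [mu]. Once all factors ['X - mu] are removed from [f], the cofactor is nonzero at the
    leading coefficients, so what vanishes is [a - mu b]. *)
Lemma poly_ratio_closed (k : fieldType) (R : idomainType) (phi : {rmorphism k -> R})
    (phi' : {rmorphism k -> {poly R}}) :
  (forall c, phi' c = (phi c)%:P) -> ratio_closed phi -> ratio_closed phi'.
Proof.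
move=> hphi IH g f a b f0 hf b0 hab.
have [->|a0] := eqVneq a 0; first by exists 0; rewrite rmorph0 mul0r.
have phi0 c : (phi' c == 0) = (c == 0) by rewrite fmorph_eq0.
have pos : (0 < size a)%N /\ (0 < size b)%N by rewrite !size_poly_gt0.
have [eq_ab|ne_ab] := eqVneq (size a) (size b); last first.
  have size_term (t : 'I_g.+1) : f`_t != 0 ->
      (size (phi' f`_t * a ^+ t * b ^+ (g - t))%R).-1 =
      ((size a).-1 * t + (size b).-1 * (g - t))%N.
    move=> ft0; rewrite hphi -mulrA size_Cmul; last by rewrite -polyC_eq0 -hphi phi0.
    by rewrite pred_size_mul ?expf_neq0 // !size_exp.
  have := @size_sum_distinct R 'I_g.+1 (fun t => phi' f`_t * a ^+ t * b ^+ (g - t)).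
  rewrite -/(bform phi' g f a b) hab => h.
  case/eqP: f0; apply/polyP => t; rewrite coef0.
  have [lt_tg|le_gt] := ltnP t g.+1; last by rewrite nth_default //; apply: leq_trans le_gt.
  have := h _ (Ordinal lt_tg); rewrite size_poly0 leqn0 size_poly_eq0 /= => hh.
  apply/eqP; have : phi' f`_t * a ^+ t * b ^+ (g - t) == 0; last first.
    by rewrite !mulf_eq0 phi0 !expf_eq0 (negPf a0) (negPf b0) !andbF !orbF.
  apply: hh => i j; rewrite !mulf_eq0 !phi0 => /norP[/norP[fi _] _] /norP[/norP[fj _] _].
  move/(congr1 predn); rewrite !size_term // => e; apply: val_inj => /=.
  case: pos ne_ab e (ltn_ord i) (ltn_ord j).
  move: (size a) (size b) (i : nat) (j : nat) => [|m] [|n] // i' j' _ _ /=.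
  by rewrite eqSS; nia.
pose d := (size a).-1.
have ha : (size a <= d.+1)%N by rewrite /d; case: (size a).
have hb : (size b <= d.+1)%N by rewrite -eq_ab.
have lb : b`_d != 0 by rewrite /d eq_ab -lead_coefE lead_coef_eq0.
have := coef_bform g f hphi ha hb; rewrite hab coef0 => /esym /IH [] // mu Dmu.
exists mu; have [e [h]] := multiplicity_XsubC f mu; rewrite f0 /= => hmu Df.
have h0 : h != 0 by apply: contraNneq f0 => h0; rewrite Df h0 mul0r.
have sf : size f = (size h + e)%N.
  by rewrite Df size_Mmonic ?monic_exp ?monicXsubC // size_exp_XsubC addnS.
have le_eg : (e <= g)%N.
  by move: hf; rewrite sf; move: h0; rewrite -size_poly_gt0; move: (size h) => n; lia.
have sh : (size h <= (g - e).+1)%N by move: hf; rewrite sf; move: (size h) => n; lia.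
have := hab; rewrite Df -{1}(subnK le_eg) bform_mulXsubCX // => /eqP.
rewrite mulf_eq0 expf_eq0 subr_eq0 => /orP[/eqP hh|/andP[_ /eqP //]].
have := coef_bform (g - e) h hphi ha hb; rewrite hh coef0 Dmu bform_proportional //.
move=> /esym /eqP; rewrite mulf_eq0 fmorph_eq0 expf_eq0 (negPf lb) andbF orbF.
by move=> hr; rewrite /root hr in hmu.
Qed.

Lemma bipoly_ratio_closed (k : fieldType) : ratio_closed (CC k).
Proof.
apply: (@poly_ratio_closed _ _ polyC) => [c|]; first by rewrite CCE.
by apply: (@poly_ratio_closed _ _ idfun) => //; exact: field_ratio_closed.
Qed.
(** * Derivations *)

Record derivation (R : comNzRingType) (d : R -> R) : Prop := Derivation {
  derD : forall a b, d (a + b) = d a + d b;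
  derM : forall a b, d (a * b) = d a * b + a * d b }.

Section DerivationTheory.
Variables (R : comNzRingType) (d : R -> R).
Hypothesis hd : derivation d.

Lemma der0 : d 0 = 0.
Proof. by apply: (addrI (d 0)); rewrite -(derD hd) !addr0. Qed.

Lemma derN a : d (- a) = - d a.
Proof. by apply: (addrI (d a)); rewrite -(derD hd) !subrr der0. Qed.

Lemma derB a b : d (a - b) = d a - d b.
Proof. by rewrite (derD hd) derN. Qed.

Lemma der1 : d 1 = 0.
Proof.
by apply: (addrI (d 1)); have := derM hd 1 1; rewrite !mulr1 mul1r addr0 => {1}<-.
Qed.

Lemma derX a n : d (a ^+ n) = n%:R * a ^+ n.-1 * d a.
Proof.
elim: n => [|n IH]; first by rewrite expr0 der1 !mul0r.
rewrite exprS (derM hd) IH -natr1; case: n {IH} => [|n] /=.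
  by rewrite expr0; ring.
by rewrite exprS; ring.
Qed.

Lemma map_derivation : derivation (map_poly d : {poly R} -> {poly R}).
Proof.
have coefd (p : {poly R}) i : (map_poly d p)`_i = d p`_i by rewrite coef_map_id0 ?der0.
split=> p q; apply/polyP => i; first by rewrite !(coefd, coefD) (derD hd).
rewrite coefd coefD !coefM -big_split /= (big_morph d (derD hd) der0).
by apply: eq_bigr => j _; rewrite (derM hd) !coefd.
Qed.

Lemma map_der_polyC a : map_poly d a%:P = (d a)%:P.
Proof.
by apply/polyP => i; rewrite coef_map_id0 ?der0 // !coefC; case: eqP; rewrite ?der0.
Qed.

Lemma map_der_polyX : map_poly d 'X = 0.
Proof.
apply/polyP => i; rewrite coef_map_id0 ?der0 // coefX coef0.
by case: eqP; rewrite ?der1 ?der0.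
Qed.

Lemma size_map_derivation (p : {poly R}) : (size (map_poly d p) <= size p)%N.
Proof. exact: size_poly. Qed.

End DerivationTheory.

Lemma deriv_derivation (R : comNzRingType) : derivation (@deriv R).
Proof. by split=> p q; [exact: derivD | exact: derivM]. Qed.

(** * Absence of cusps *)

Section NoCusp.
Variables (R : idomainType) (dX dY : {poly R} -> {poly R}) (cX cY m x y : {poly R}).
Variables (p q : nat).
Hypotheses (dXder : derivation dX) (dYder : derivation dY).
Hypotheses (size_dX : forall z, (size (dX z) <= size z)%N).
Hypotheses (size_dY : forall z, (size (dY z) <= size z)%N).
Hypotheses (dX0 : forall z, (dX z)`_0 = (dX (z`_0)%:P)`_0).
Hypotheses (dY0 : forall z, (dY z)`_0 = (dY (z`_0)%:P)`_0).
Hypotheses (dX_X : dX cX = 1) (dX_Y : dX cY = 0) (dX_m : dX m = 0).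
Hypotheses (dY_X : dY cX = 0) (dY_Y : dY cY = 1) (dY_m : dY m = 0).
Hypotheses (size_X : (size cX <= 1)%N) (size_Y : (size cY <= 1)%N) (size_m : (size m <= 1)%N).
Hypotheses (m0 : m != 0) (x0 : (x`_0)%:P = cX) (y0 : (y`_0)%:P = cY).
Hypothesis xy : x ^+ q - m * y ^+ p = cX ^+ q - m * cY ^+ p.

(** The Jacobian of [(x, y)] with respect to [X] and [Y]; it is nonzero because it equals 1 at
    [s = 0]. *)
Let J := dX x * dY y - dY x * dX y.

Let J_neq0 : J != 0.
Proof.
apply/eqP => /(congr1 (fun z : {poly R} => z`_0)).
rewrite coefB !coef0M (dX0 x) (dX0 y) (dY0 x) (dY0 y) x0 y0 dX_X dX_Y dY_X dY_Y.
by rewrite coef1 !coef0 mulr1 mul0r subr0 => /eqP; rewrite oner_eq0.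
Qed.

Let xyX : q%:R * x ^+ q.-1 * dX x - m * (p%:R * y ^+ p.-1 * dX y) = q%:R * cX ^+ q.-1.
Proof.
have := congr1 dX xy; rewrite !(derB dXder) !(derM dXder) !(derX dXder).
by rewrite dX_m dX_X dX_Y !mul0r !add0r !mulr0 subr0 mulr1.
Qed.

Let xyY : q%:R * x ^+ q.-1 * dY x - m * (p%:R * y ^+ p.-1 * dY y) =
  - (m * (p%:R * cY ^+ p.-1)).
Proof.
have := congr1 dY xy; rewrite !(derB dYder) !(derM dYder) !(derX dYder).
by rewrite dY_m dY_X dY_Y !mul0r !add0r !mulr0 sub0r mulr1.
Qed.

(** Cramer's rule for the two derivatives of the cusp equation. The coefficients on the right are
    free of [s], so the degree in [s] is at most that of [y]. *)
Let xJ : q%:R * x ^+ q.-1 * J =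
  q%:R * cX ^+ q.-1 * dY y + m * (p%:R * cY ^+ p.-1) * dX y.
Proof. by move: xyX xyY => e1 e2; rewrite -e1 -[m * (p%:R * cY ^+ _)]opprK -e2 /J; ring. Qed.

Let yJ : m * (p%:R * y ^+ p.-1) * J =
  q%:R * cX ^+ q.-1 * dY x + m * (p%:R * cY ^+ p.-1) * dX x.
Proof. by move: xyX xyY => e1 e2; rewrite -e1 -[m * (p%:R * cY ^+ _)]opprK -e2 /J; ring. Qed.

Let size_comb (A B d1 d2 z : {poly R}) : (size A <= 1)%N -> (size B <= 1)%N ->
  (size d1 <= size z)%N -> (size d2 <= size z)%N -> (size (A * d1 + B * d2)%R <= size z)%N.
Proof.
move=> hA hB h1 h2.
have hC (C d : {poly R}) : (size C <= 1)%N -> (size d <= size z)%N -> (size (C * d)%R <= size z)%N.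
  by move=> /size1_polyC -> h; rewrite mul_polyC; apply: leq_trans h; exact: size_scale_leq.
by apply: leq_trans (size_polyD _ _) _; rewrite geq_max !hC.
Qed.

Let size_const (C D : {poly R}) n l : (size C <= 1)%N -> (size D <= 1)%N ->
  (size (C * (l%:R * D ^+ n))%R <= 1)%N.
Proof.
move=> /size1_polyC -> /size1_polyC ->.
by rewrite -polyC_exp -(rmorph_nat polyC) -!polyCM size_polyC_leq1.
Qed.

Let size_mulJ (z c : {poly R}) n : c != 0 -> (1 < size z)%N ->
  (n * (size z).-1 < size (z ^+ n * (c * J))%R)%N.
Proof.
move=> c0 z1; have z0 : z != 0 by rewrite -size_poly_gt0 ltnW.
have cJ : c * J != 0 by rewrite mulf_neq0.
have := @pred_size_mul _ (z ^+ n) (c * J); rewrite expf_neq0 // => /(_ isT cJ).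
have : (0 < size (z ^+ n * (c * J))%R)%N by rewrite size_poly_gt0 mulf_neq0 ?expf_neq0.
by rewrite size_exp; move: (size _) (size _) (size _) => i j l; lia.
Qed.

(** For degrees in [s], [xJ] gives [(q - 1) deg x <= deg y], impossible with [q deg x = p deg y] and
    [2 <= q < p]. If [q] vanishes in [R], then [p] does not, by coprimality, and [yJ] gives
    [(p - 1) deg y <= deg x], equally impossible. *)
Lemma no_cusp_char : coprime p q -> (0 < q <= p)%N -> (1 < size x)%N -> (1 < size y)%N ->
  (q * (size x).-1 = p * (size y).-1)%N -> q = 1%N.
Proof.
move=> cop /andP[q_gt0 le_qp] x1 y1 Dxy; apply/eqP; rewrite -[_ == _]negbK; apply/negP => q1.
have lt_qp : (q < p)%N.
  by rewrite ltn_neqAle le_qp andbT; apply: contraNneq q1 => e; move: cop; rewrite -e /coprime gcdnn.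
have size_n l : (size (l%:R : {poly R}) <= 1)%N.
  by rewrite -(rmorph_nat polyC) size_polyC_leq1.
have [q0|q0] := eqVneq (q%:R : {poly R}) 0.
  have p0 : p%:R != 0 :> {poly R}.
    apply/eqP => p0; have [u v Duv _] := egcdnP q (ltn_trans q_gt0 lt_qp).
    have := congr1 (fun n => n%:R : {poly R}) Duv; rewrite (eqP cop) natrD !natrM p0 q0.
    by rewrite !mulr0 add0r => /esym/eqP; rewrite oner_eq0.
  have hc : m * p%:R != 0 by rewrite mulf_neq0.
  have := size_mulJ p.-1 hc y1.
  have -> : y ^+ p.-1 * (m * p%:R * J) = m * (p%:R * y ^+ p.-1) * J by ring.
  rewrite yJ -[q%:R * _]mul1r => lt.
  have := leq_trans lt (size_comb (size_const _ _ _ _) (size_const _ _ _ _) (size_dY x) (size_dX x)).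
  rewrite size_poly1 size_X size_Y size_m => /(_ isT isT isT isT).
  by move: (size x) (size y) x1 y1 Dxy q1 lt_qp q_gt0 {lt} => [|[|i]] [|[|j]] //= _ _; nia.
have := size_mulJ q.-1 q0 x1.
have -> : x ^+ q.-1 * (q%:R * J) = q%:R * x ^+ q.-1 * J by ring.
rewrite xJ -[q%:R * _]mul1r => lt.
have := leq_trans lt (size_comb (size_const _ _ _ _) (size_const _ _ _ _) (size_dY y) (size_dX y)).
rewrite size_poly1 size_X size_Y size_m => /(_ isT isT isT isT).
by move: (size x) (size y) x1 y1 Dxy q1 lt_qp q_gt0 {lt} => [|[|i]] [|[|j]] //= _ _; nia.
Qed.

End NoCusp.

Lemma coef0_map_derivation (R : comNzRingType) (d : R -> R) z :
  derivation d -> (map_poly d z)`_0 = (map_poly d (z`_0)%:P)`_0.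
Proof. by move=> hd; rewrite map_der_polyC // coefC eqxx coef_map_id0 ?der0. Qed.

Lemma no_cusp (k : fieldType) (x y : {poly bipoly k}) (mu : k) (p q : nat) :
  mu != 0 -> x`_0 = 'X%:P -> y`_0 = 'X ->
  x ^+ q - CCs k mu * y ^+ p = ('X%:P ^+ q - CC k mu * 'X ^+ p)%:P ->
  coprime p q -> (0 < q <= p)%N -> (1 < size x)%N -> (1 < size y)%N ->
  (q * (size x).-1 = p * (size y).-1)%N -> q = 1%N.
Proof.
move=> mu0 x0 y0; rewrite polyCB polyCM !polyC_exp CCsE => xy.
have d1 := deriv_derivation k; have d2 := @deriv_derivation {poly k}.
have d3 := map_derivation d1.
apply: (@no_cusp_char _ (map_poly (map_poly (@deriv k))) (map_poly (@deriv {poly k}))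
  'X%:P%:P 'X%:P (CCs k mu) x y p q _ _ _ _ _ _ _ _ _ _ _ _ _ _ _ _ _ _ xy).
- exact: map_derivation.
- exact: map_derivation.
- exact: size_map_derivation.
- exact: size_map_derivation.
- by move=> z; exact: coef0_map_derivation.
- by move=> z; exact: coef0_map_derivation.
- rewrite (map_der_polyC d3) (map_der_polyC d1) derivX !polyC1; reflexivity.
- rewrite (map_der_polyC d3) (map_der_polyX d1) polyC0; reflexivity.
- rewrite -CCsE (map_der_polyC d3) -CCE (map_der_polyC d1) derivC !polyC0; reflexivity.
- rewrite (map_der_polyC d2) derivC polyC0; reflexivity.
- rewrite (map_der_polyC d2) derivX polyC1; reflexivity.
- rewrite -CCsE (map_der_polyC d2) -CCE derivC polyC0; reflexivity.
- exact: size_polyC_leq1.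
- exact: size_polyC_leq1.
- rewrite -CCsE; exact: size_polyC_leq1.
- by rewrite fmorph_eq0.
- by rewrite x0.
- by rewrite y0.
Qed.
(** * Invariant forms *)

Lemma coef0_ev2s (k : fieldType) (x y : {poly bipoly k}) P :
  x`_0 = 'X%:P -> y`_0 = 'X -> (ev2s x y P)`_0 = P.
Proof.
move=> x0 y0; rewrite -[LHS]/(coefp 0 (ev2s x y P)) (@morph_ev2 _ _ _ _ (CC k)).
  by rewrite /= x0 y0 ev2_id.
by move=> c; rewrite -CCsE /= coefC.
Qed.

(** Degrees in [s] add up, so a factor of a polynomial free of [s] is free of [s], hence equal to
    its constant term [P]. *)
Lemma divisor_invariant (k : fieldType) (x y : {poly bipoly k}) P Q :
  x`_0 = 'X%:P -> y`_0 = 'X -> P * Q != 0 ->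
  ev2s x y (P * Q) = (P * Q)%:P -> ev2s x y P = P%:P.
Proof.
move=> x0 y0 PQ0; rewrite rmorphM => ePQ.
have : size (ev2s x y P * ev2s x y Q) == 1%N by rewrite ePQ size_polyC PQ0.
rewrite size_mul_eq1 => /andP[/size_poly1P [c _ Dc] _].
by rewrite -{2}(coef0_ev2s P x0 y0) Dc coefC.
Qed.

Lemma ev2_bform (k : fieldType) (S : comNzRingType) (phi : {rmorphism k -> S}) a b g f A B :
  ev2 phi a b (bform (CC k) g f A B) = bform phi g f (ev2 phi a b A) (ev2 phi a b B).
Proof.
rewrite /bform (rmorph_sum (ev2 phi a b)); apply: eq_bigr => t _.
by rewrite !(rmorphM (ev2 phi a b)) !(rmorphXn (ev2 phi a b)) /= ev2C.
Qed.

Lemma ev2_cusp (k : fieldType) (S : comNzRingType) (phi : {rmorphism k -> S}) a b mu p q :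
  ev2 phi a b ('X%:P ^+ q - CC k mu * 'X ^+ p) = a ^+ q - phi mu * b ^+ p.
Proof.
by rewrite ev2B ev2M !ev2Xn ev2X ev2Y ev2C.
Qed.

Lemma coef_monomial (k : fieldType) (c : k) m n j i :
  (CC k c * 'X%:P ^+ m * 'X ^+ n)`_j`_i = c *+ ((j == n) && (i == m)).
Proof.
rewrite coefMXn -CCE -polyC_exp -polyCM coefC.
have [lt|gt|->] := ltngtP j n; first by rewrite coef0.
  by rewrite subn_eq0 leqNgt gt coef0.
by rewrite subnn eqxx coefCM coefXn; case: eqP; rewrite ?mulr1 ?mulr0.
Qed.

Section InvariantForm.
Variables (k : fieldType) (D E N : nat) (Q : bipoly k) (x y : {poly bipoly k}).
Hypotheses (E_gt0 : (0 < E)%N) (le_ED : (E <= D)%N) (Q0 : Q != 0).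
Hypothesis Q_hom : forall j i, Q`_j`_i != 0 -> (D * i + E * j)%N = N.
Hypothesis Q_deg : forall j i, Q`_j`_i != 0 -> (i <= E)%N && (j <= D)%N.
Hypothesis N_ge : (D * E <= N)%N.
Hypothesis Q_corner : N = (D * E)%N -> Q`_0`_E != 0 /\ Q`_D`_0 != 0.
Hypotheses (x0 : x`_0 = 'X%:P) (y0 : y`_0 = 'X).
Hypothesis nontrivial : (1 < size x)%N || (1 < size y)%N.
Hypothesis Q_inv : ev2s x y Q = Q%:P.

Let x_neq0 : x != 0.
Proof.
by apply: contraTneq isT => x_0; move/eqP: x0; rewrite x_0 coef0 eq_sym polyC_eq0 polyX_eq0.
Qed.

Let y_neq0 : y != 0.
Proof.
by apply: contraTneq isT => y_0; move/eqP: y0; rewrite y_0 coef0 eq_sym polyX_eq0.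
Qed.

Lemma ev2_wide (S : comNzRingType) (phi : {rmorphism k -> S}) a b :
  ev2 phi a b Q = \sum_(t : 'I_D.+1 * 'I_E.+1) phi Q`_(t.1)`_(t.2) * a ^+ t.2 * b ^+ t.1.
Proof.
have DQ : Q = \poly_(j < D.+1) \poly_(i < E.+1) Q`_j`_i.
  apply/polyP => j; apply/polyP => i; rewrite coef_poly; case: ltnP => hj; last first.
    rewrite coef0; apply/eqP; apply/negP => /negP /Q_deg /andP [_]; lia.
  rewrite coef_poly; case: ltnP => hi //.
  apply/eqP; apply/negP => /negP /Q_deg /andP [h _]; lia.
rewrite {1}DQ ev2_poly.
exact: (pair_bigA _ (fun (j : 'I_D.+1) (i : 'I_E.+1) => phi Q`_j`_i * a ^+ i * b ^+ j)).
Qed.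

(** The monomials of [Q] lie on one line of weight [N]. Were the degrees of [x] and [y] in [s] not
    proportional to [D] and [E], these monomials would get distinct degrees in [s], hence all degree
    0 as [Q(x, y) = Q]; the corners then contradict nontriviality. *)
Lemma degree_balance : [/\ (1 < size x)%N, (1 < size y)%N &
  ((size x).-1 * E = (size y).-1 * D)%N].
Proof.
have bal : ((size x).-1 * E = (size y).-1 * D)%N.
  apply/eqP; apply/negPn/negP => ne.
  have size_term (j i : nat) : Q`_j`_i != 0 ->
      (size (CCs k Q`_j`_i * x ^+ i * y ^+ j)%R).-1 = ((size x).-1 * i + (size y).-1 * j)%N.
    move=> h; rewrite !pred_size_mul ?mulf_neq0 ?expf_neq0 // ?fmorph_eq0 //.
    by rewrite -CCsE size_polyC !size_exp; case: (_ != 0).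
  have term0 (j i : nat) : Q`_j`_i != 0 -> ((size x).-1 * i + (size y).-1 * j = 0)%N.
    move=> h; have /andP [hi hj] := Q_deg h; rewrite -size_term //.
    have := @size_sum_distinct _ _
      (fun t : 'I_D.+1 * 'I_E.+1 => CCs k Q`_(t.1)`_(t.2) * x ^+ t.2 * y ^+ t.1).
    rewrite -ev2_wide Q_inv => hs; have := hs _ (Ordinal (hj : j < D.+1)%N, Ordinal (hi : i < E.+1)%N).
    have le1 := size_polyC_leq1 Q; rewrite /= => hh; have {}hh := leq_trans (hh _) le1.
    suff /hh : forall i0 j0 : 'I_D.+1 * 'I_E.+1,
       CCs k Q`_(i0.1)`_(i0.2) * x ^+ i0.2 * y ^+ i0.1 != 0 ->
       CCs k Q`_(j0.1)`_(j0.2) * x ^+ j0.2 * y ^+ j0.1 != 0 ->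
       size (CCs k Q`_(i0.1)`_(i0.2) * x ^+ i0.2 * y ^+ i0.1) =
       size (CCs k Q`_(j0.1)`_(j0.2) * x ^+ j0.2 * y ^+ j0.1) -> i0 = j0.
      by case: (size _) => [|[]].
    move=> [j1 i1] [j2 i2] /=; rewrite !mulf_eq0 !fmorph_eq0.
    move=> /norP[/norP[h1 _] _] /norP[/norP[h2 _] _] /(congr1 predn).
    rewrite !size_term // => e; have := Q_hom h1; rewrite -(Q_hom h2) => e'.
    have ei : i1 = i2 :> nat by move: ne e e' E_gt0; clear; nia.
    congr pair; apply: val_inj => //=; move: e'; rewrite ei; clear -E_gt0; nia.
  have [j [i h]] : exists j i, Q`_j`_i != 0.
    exists (size Q).-1, (size Q`_(size Q).-1).-1.
    by rewrite -lead_coefE lead_coef_eq0 -lead_coefE lead_coef_eq0.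
  have := term0 _ _ h; have := Q_hom h; have /andP [hi hj] := Q_deg h.
  case/orP: nontrivial => size_gt1 hN h0.
    have i0 : i = 0%N by move: size_gt1 h0; clear; case: (size x) => [|[|n]] //= _; nia.
    have [//|/term0 h1 _] := Q_corner; first by move: hN hj N_ge; rewrite i0; clear; nia.
    by move: size_gt1 h1 E_gt0; clear; case: (size x) => [|[|n]] //= _; nia.
  have j0 : j = 0%N by move: size_gt1 h0; clear; case: (size y) => [|[|n]] //= _; nia.
  have [//|_ /term0 h1] := Q_corner; first by move: hN hi N_ge; rewrite j0; clear; nia.
  by move: size_gt1 h1 E_gt0 le_ED; clear; case: (size y) => [|[|n]] //= _; nia.
have D_gt0 : (0 < D)%N := leq_trans E_gt0 le_ED.
case/orP: nontrivial => h; split=> //.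
  by move: h bal E_gt0 D_gt0; clear; case: (size x) => [|[|n]] //; case: (size y) => [|[|m]] //=; nia.
by move: h bal E_gt0 D_gt0; clear; case: (size y) => [|[|n]] //; case: (size x) => [|[|m]] //=; nia.
Qed.

(** If [X] or [Y] divided [Q], it would be invariant, and [x] or [y] would be free of [s]. A
    monomial of [Q] without [X] has weight at most [D * E]. *)
Lemma corners : [/\ N = (D * E)%N, Q`_0`_E != 0 & Q`_D`_0 != 0].
Proof.
have [x1 y1 _] := degree_balance.
have [j0 hj0] : exists j, Q`_j`_0 != 0.
  have [/mod_z_eq0 [s Ds]|] := eqVneq (mod_z k Q) 0.
    have := @divisor_invariant k x y 'X%:P s x0 y0; rewrite -Ds => /(_ Q0 Q_inv).
    by rewrite ev2X => Dx; rewrite Dx size_polyC in x1; move: x1; case: (_ != 0).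
  rewrite -lead_coef_eq0 lead_coefE => h; exists (size (mod_z k Q)).-1.
  by move: h; rewrite {1}unlock coef_map /= /horner_eval horner_coef0.
have [i0 hi0] : exists i, Q`_0`_i != 0.
  have [h0|] := eqVneq Q`_0 0.
    have /factor_theorem [s] : root Q 0 by rewrite rootE horner_coef0 h0.
    rewrite subr0 mulrC => Ds.
    have := @divisor_invariant k x y 'X s x0 y0; rewrite -Ds => /(_ Q0 Q_inv).
    by rewrite ev2Y => Dy; rewrite Dy size_polyC in y1; move: y1; case: (_ != 0).
  by rewrite -lead_coef_eq0 lead_coefE => h; exists (size Q`_0).-1.
have eN : N = (D * E)%N.
  by have := Q_hom hj0; have /andP[_ h] := Q_deg hj0; move: N_ge h; clear; nia.
by have [h1 h2] := Q_corner eN.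
Qed.

Lemma invariant_form : N = (D * E)%N /\ exists c mu d, [/\ c != 0, D = (d * E)%N &
  Q = CC k c * ('X%:P - CC k mu * 'X ^+ d) ^+ E].
Proof.
have [x1 y1 bal] := degree_balance; have [eN Q0E QD0] := corners; split=> //.
have D_gt0 : (0 < D)%N := leq_trans E_gt0 le_ED.
(* Monomials of weight [D * E] are products of powers of [A = X^q] and [B = Y^p] of total degree
   [g], so [Q] is a binary form of degree [g] in [A] and [B]. *)
pose g := gcdn D E; pose p := (D %/ g)%N; pose q := (E %/ g)%N.
have g_gt0 : (0 < g)%N by rewrite gcdn_gt0 D_gt0.
have eD : D = (p * g)%N by rewrite divnK ?dvdn_gcdl.
have eE : E = (q * g)%N by rewrite divnK ?dvdn_gcdr.
have q_gt0 : (0 < q)%N by move: E_gt0; rewrite {1}eE muln_gt0 => /andP[].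
have p_gt0 : (0 < p)%N by move: D_gt0; rewrite {1}eD muln_gt0 => /andP[].
have cop : coprime p q.
  have : (gcdn p q * g = 1 * g)%N by rewrite muln_gcdl -eD -eE mul1n.
  by move/eqP; rewrite eqn_pmul2r.
have le_qp : (q <= p)%N by rewrite leq_div2r.
pose A : bipoly k := 'X%:P ^+ q; pose B : bipoly k := 'X ^+ p.
pose f := \poly_(t < g.+1) Q`_(p * (g - t))`_(q * t).
have size_f : (size f <= g.+1)%N by exact: size_poly.
have f0 : f != 0.
  apply: contraNneq Q0E => /(congr1 (fun r : {poly k} => r`_g)).
  by rewrite coef_poly ltnSn subnn muln0 coef0 -eE => ->.
have DQ : Q = bform (CC k) g f A B.
  apply/polyP => j; apply/polyP => i; rewrite /bform !coef_sum.
  under eq_bigr => t _.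
    rewrite coef_poly ltn_ord -!exprM coef_monomial.
    over.
  have [Qji|Qji] := eqVneq Q`_j`_i 0.
    rewrite Qji big1 // => t _; case: andP => [[/eqP ej /eqP ei]|_]; last by rewrite mulr0n.
    by rewrite -ej -ei Qji mul0rn.
  have := Q_hom Qji; rewrite eN {1}eD {1 2}eE eD => e.
  have {}e : (p * i + q * j = p * (q * g))%N.
    by apply/eqP; rewrite -(eqn_pmul2r g_gt0); apply/eqP; rewrite mulnDl; move: e; clear; lia.
  have [t ei] : exists t, i = (q * t)%N.
    have : (q %| p * i)%N by rewrite -(dvdn_addl _ (dvdn_mulr j (dvdnn q))) e mulnCA dvdn_mulr.
    by rewrite Gauss_dvdr 1?coprime_sym // => /dvdnP [t ->]; exists t; rewrite mulnC.
  have ej : (p * t + j = p * g)%N.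
    by apply/eqP; rewrite -(eqn_pmul2l q_gt0); apply/eqP; move: e; rewrite ei; clear; lia.
  have le_tg : (t < g.+1)%N by rewrite ltnS -(leq_pmul2l p_gt0) -ej leq_addr.
  rewrite (bigD1 (Ordinal le_tg)) //= -ei eqxx andbT.
  have -> : (p * (g - t))%N = j by rewrite mulnBr -ej addKn.
  rewrite eqxx mulr1n big1 ?addr0 // => t' ne_t; rewrite ei eqn_pmul2l //.
  rewrite [(t == t' :> nat)]eq_sym (_ : (t' == t :> nat) = false) ?andbF ?mulr0n //.
  by apply: contraNF ne_t => /eqP e'; apply/eqP; apply: val_inj.
pose d := (q * (size x).-1)%N.
have dy : d = (p * (size y).-1)%N.
  by apply/eqP; rewrite -(eqn_pmul2r g_gt0); apply/eqP; move: bal; rewrite {1}eE {1}eD /d; clear; lia.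
have d_gt0 : (0 < d)%N by rewrite muln_gt0 q_gt0; move: x1; case: (size x) => [|[]].
have [size_xq lead_xq] := @coefX_top _ x (size x).-1 q (leqSpred _).
have [size_yp lead_yp] := @coefX_top _ y (size y).-1 p (leqSpred _).
rewrite -/d in size_xq lead_xq; rewrite -dy in size_yp lead_yp.
pose u := x`_(size x).-1; pose v := y`_(size y).-1.
have u0 : u != 0 by rewrite /u -lead_coefE lead_coef_eq0.
have v0 : v != 0 by rewrite /v -lead_coefE lead_coef_eq0.
have CCs_C c : CCs k c = (CC k c)%:P by rewrite CCsE.
have ev_bform g' f' : ev2s x y (bform (CC k) g' f' A B) = bform (CCs k) g' f' (x ^+ q) (y ^+ p).
  by rewrite ev2_bform /A /B !rmorphXn /= ev2X ev2Y.
have top g' f' : (ev2s x y (bform (CC k) g' f' A B))`_(g' * d) =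
    bform (CC k) g' f' (u ^+ q) (v ^+ p).
  by rewrite ev_bform (coef_bform _ _ CCs_C size_xq size_yp) lead_xq lead_yp.
(* [Q] has no term of positive degree [g * d] in [s], so the form vanishes at the leading
   coefficients of [x^q] and [y^p]. *)
have fuv : bform (CC k) g f (u ^+ q) (v ^+ p) = 0.
  by rewrite -top -DQ Q_inv coefC muln_eq0 !gtn_eqF.
have [mu Dmu] := bipoly_ratio_closed f0 size_f (expf_neq0 p v0) fuv.
have mu0 : mu != 0.
  by apply: contraNneq (expf_neq0 q u0) => mu0; rewrite Dmu mu0 rmorph0 mul0r.
have [e [h]] := multiplicity_XsubC f mu; rewrite f0 /= => hmu Df.
have h0 : h != 0 by apply: contraNneq f0 => h0; rewrite Df h0 mul0r.
have sf : size f = (size h + e)%N.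
  by rewrite Df size_Mmonic ?monic_exp ?monicXsubC // size_exp_XsubC addnS.
have le_eg : (e <= g)%N.
  by move: size_f; rewrite sf; move: h0; rewrite -size_poly_gt0; move: (size h) => n; clear; lia.
have sh : (size h <= (g - e).+1)%N by move: size_f; rewrite sf; move: (size h) => n; clear -le_eg; lia.
pose H := bform (CC k) (g - e) h A B.
have DQ' : Q = H * (A - CC k mu * B) ^+ e.
  by rewrite DQ Df -{1}(subnK le_eg) bform_mulXsubCX.
have H_inv : ev2s x y H = H%:P.
  have := @divisor_invariant k x y H ((A - CC k mu * B) ^+ e) x0 y0.
  by rewrite -DQ' => /(_ Q0 Q_inv).
(* The cofactor [H] is invariant too. Were its degree [g - e] positive, its form would vanish at the
   same leading coefficients and [mu] would be a root of [h]. *)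
have e_g : e = g.
  apply/eqP; rewrite eqn_leq le_eg /= -subn_eq0; apply: contraNT hmu => ge0.
  have := top (g - e)%N h; rewrite -/H H_inv coefC muln_eq0 (negPf ge0) gtn_eqF //= Dmu.
  rewrite bform_proportional // => /esym/eqP; rewrite mulf_eq0 fmorph_eq0 !expf_eq0 (negPf v0).
  by rewrite !andbF orbF.
have DQ2 : Q = (A - CC k mu * B) * (H * (A - CC k mu * B) ^+ e.-1).
  by rewrite mulrCA -exprS prednK ?e_g // -{1}e_g -DQ'.
have cusp_inv : ev2s x y (A - CC k mu * B) = (A - CC k mu * B)%:P.
  have := @divisor_invariant k x y (A - CC k mu * B) (H * (A - CC k mu * B) ^+ e.-1) x0 y0.
  by rewrite -DQ2 => /(_ Q0 Q_inv).
have ev_cusp : ev2s x y (A - CC k mu * B) = x ^+ q - CCs k mu * y ^+ p.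
  exact: ev2_cusp.
have q1 : q = 1%N.
  apply: (no_cusp mu0 x0 y0 _ cop _ x1 y1) => //; last by rewrite q_gt0.
  exact: etrans (esym ev_cusp) cusp_inv.
have eg : g = E by rewrite eE q1 mul1n.
exists h`_0, mu, p; split; last 1 first.
- rewrite {1}DQ' /H e_g subnn /bform big_ord1 !expr0 !mulr1 eg.
  by rewrite /A q1 expr1.
- apply: contraNneq Q0 => hh; rewrite DQ' /H e_g subnn /bform big_ord1 hh rmorph0.
  by rewrite !mul0r.
- by rewrite eD eg.
Qed.

End InvariantForm.

(** When the weight of [Z] exceeds [D], the term [V] is too light to enter the top form of [F],
    which is then the product of those of [Z] and [R]. After degeneration the first factor inherits
    invariance. The exact bidegree gives it weight at least [D * E]. *)
Lemma top_form (k : fieldType) (D E : nat) (Z R V F : bipoly k) (x y : {poly bipoly k}) :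
  (0 < E)%N -> (E <= D)%N -> (forall j i, Z`_j`_i != 0 -> (i <= E)%N && (j <= D)%N) ->
  (exists j, Z`_j`_E != 0) -> (exists i, Z`_D`_i != 0) ->
  R != 0 -> wdeg_le D E D V -> F = V + Z * R -> x`_0 = 'X%:P -> y`_0 = 'X ->
  (1 < size x)%N || (1 < size y)%N -> ev2s x y F = F%:P -> 
  wdeg_le D E D Z \/ wdeg_le D E (D * E) Z /\ exists c mu d, [/\ c != 0, D = (d * E)%N &
    grade D E (D * E) Z = CC k c * ('X%:P - CC k mu * 'X ^+ d) ^+ E].
Proof.
move=> E0 le_ED Z_deg [j1 ZE] [i1 ZD] R0 hV DF x0 y0 nontriv F_inv.
have Z0 : Z != 0 by apply: contraNneq ZE => ->; rewrite !coef0.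
have [N [ZN gN]] := wdeg_exists D E Z0; have [M [RM gM]] := wdeg_exists D E R0.
have [le_ND|lt_DN] := leqP N D; first by left=> j i /ZN /leq_trans; apply.
right; have ZR := wdegM ZN RM.
have F_le : wdeg_le D E (N + M) F.
  move=> j i; rewrite DF !coefD; apply: contraNT; rewrite -ltnNge => lt.
  have -> : V`_j`_i = 0.
    by apply/eqP; apply/negPn/negP => h; move: lt lt_DN (hV _ _ h); clear; lia.
  rewrite add0r; apply/negPn/negP => h.
  by move: lt (ZR _ _ h); clear; lia.
have gF : grade D E (N + M) F = grade D E N Z * grade D E M R.
  rewrite -gradeM // DF; apply/polyP => j; apply/polyP => i.
  rewrite !coef_grade !coefD; case: eqP => // e.
  have -> : V`_j`_i = 0.
    by apply/eqP; apply/negPn/negP => h; move: e lt_DN (hV _ _ h); clear; lia.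
  by rewrite add0r.
have [x' [y' [x'0 y'0 nontriv' F'_inv]]] := degeneration F_le x0 y0 F_inv nontriv.
rewrite gF in F'_inv.
have Q_inv := divisor_invariant x'0 y'0 (mulf_neq0 gN gM) F'_inv.
have [eN form] : N = (D * E)%N /\ exists c mu d, [/\ c != 0, D = (d * E)%N &
    grade D E N Z = CC k c * ('X%:P - CC k mu * 'X ^+ d) ^+ E].
  apply: (invariant_form E0 le_ED gN _ _ _ _ x'0 y'0 nontriv' Q_inv).
  - by move=> j i; rewrite coef_grade; case: ifP => [/eqP|]; rewrite ?eqxx.
  - by move=> j i; rewrite coef_grade; case: ifP => [_|]; [exact: Z_deg | rewrite eqxx].
  - by move: (ZN _ _ ZE); clear; lia.
  - move=> eN; split.
      have j10 : j1 = 0%N by move: (ZN _ _ ZE) E0; rewrite eN; clear; nia.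
      rewrite j10 in ZE; rewrite coef_grade; case: ifP => // /eqP [].
      by rewrite eN; clear; lia.
    have i10 : i1 = 0%N by move: (ZN _ _ ZD) E0 le_ED; rewrite eN; clear; nia.
    rewrite i10 in ZD; rewrite coef_grade; case: ifP => // /eqP [].
    by rewrite eN; clear; lia.
by rewrite -eN.
Qed.
(** * Semi-invariants are coordinates *)

Record polyauto (k : comNzRingType) (s t : {rmorphism bipoly k -> bipoly k}) : Prop :=
  PolyAuto {
    auto_const : const_fixing s;
    auto_inv_const : const_fixing t;
    autoK : cancel s t;
    auto_invK : cancel t s }.

Lemma polyauto_sym (k : comNzRingType) (s t : {rmorphism bipoly k -> bipoly k}) :
  polyauto s t -> polyauto t s.
Proof. by case. Qed.

Lemma polyauto_comp (k : comNzRingType) (s t s' t' : {rmorphism bipoly k -> bipoly k}) :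
  polyauto s t -> polyauto s' t' -> polyauto (s \o s') (t' \o t).
Proof.
case=> h1 h2 h3 h4 [h1' h2' h3' h4']; split=> [c|c|p|p] /=.
- by rewrite h1' h1.
- by rewrite h2 h2'.
- by rewrite h3 h3'.
- by rewrite h4' h4.
Qed.

Lemma subst_polyauto (k : comNzRingType) (f g f' g' : bipoly k) :
  subst f g f' = 'X%:P -> subst f g g' = 'X ->
  subst f' g' f = 'X%:P -> subst f' g' g = 'X -> polyauto (subst f g) (subst f' g').
Proof.
move=> h1 h2 h3 h4; split; [exact: subst_const_fixing|exact: subst_const_fixing| |].
- by move=> p; rewrite /= ev2_subst h3 h4 ev2_id.
- by move=> p; rewrite /= ev2_subst h1 h2 ev2_id.
Qed.

Lemma bmap_polyauto (k K : comNzRingType) (iota : {rmorphism k -> K}) (f g f' g' : bipoly k) :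
  polyauto (subst f g) (subst f' g') ->
  polyauto (subst (bmap iota f) (bmap iota g)) (subst (bmap iota f') (bmap iota g')).
Proof.
case=> _ _ h1 h2; apply: subst_polyauto; rewrite -bmap_subst.
- by have := h2 'X%:P; rewrite /= ev2X => ->; rewrite bmapX.
- by have := h2 'X; rewrite /= ev2Y => ->; rewrite bmapY.
- by have := h1 'X%:P; rewrite /= ev2X => ->; rewrite bmapX.
- by have := h1 'X; rewrite /= ev2Y => ->; rewrite bmapY.
Qed.

Definition coordinate (k : comNzRingType) (Z : bipoly k) :=
  exists s t : {rmorphism bipoly k -> bipoly k}, polyauto s t /\ s Z = 'X%:P.

Lemma coordinate_auto (k : comNzRingType) (s t : {rmorphism bipoly k -> bipoly k}) Z :
  polyauto s t -> coordinate (s Z) -> coordinate Z.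
Proof.
move=> st [s' [t' [st' Z']]]; exists (s' \o s), (t \o t'); split=> //.
exact: polyauto_comp.
Qed.

(** All that is retained of the cyclic action. It does not mention [A], so it can follow [Z] through
    the coordinate changes of the induction. *)
Definition semi_invariant (K : comNzRingType) (Z : bipoly K) :=
  exists (s t : {rmorphism bipoly K -> bipoly K}) (zeta : K),
  [/\ polyauto s t, zeta != 1, s Z = CC K zeta * Z & forall p, exists r, s p = p + Z * r].

Lemma semi_invariant_auto (K : comNzRingType) (s t : {rmorphism bipoly K -> bipoly K}) Z :
  polyauto s t -> semi_invariant Z -> semi_invariant (s Z).
Proof.
move=> st [s' [t' [zeta [st' zeta1 Z' hs']]]]; exists (s \o s' \o t), (s \o t' \o t), zeta.
split=> // [||p].
- have := polyauto_comp (polyauto_comp st st') (polyauto_sym st); case=> h1 h2 h3 h4.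
  by split.
- by rewrite /= (autoK st) Z' (rmorphM s) (auto_const st).
- have [r Dr] := hs' (t p); exists (s r).
  by rewrite /= Dr (rmorphD s) (rmorphM s) (auto_invK st).
Qed.

Lemma swap_polyauto (k : comNzRingType) : polyauto (subst ('X : bipoly k) 'X%:P) (subst 'X 'X%:P).
Proof. by apply: subst_polyauto; rewrite ?ev2X ?ev2Y. Qed.

Lemma triangular_polyauto (k : fieldType) (c : k) (d : {poly k}) : c != 0 ->
  polyauto (subst (CC k c * 'X%:P + at_const 'X d) 'X)
           (subst (CC k c^-1 * ('X%:P - at_const 'X d)) 'X).
Proof.
move=> c0; have cV : CC k c * CC k c^-1 = 1 by rewrite -CCM divff // (rmorph1 (CC k)).
have subst_d a : subst a 'X (at_const 'X d) = at_const 'X d.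
  by rewrite morph_at_const /=; [rewrite ev2Y | exact: subst_const_fixing].
apply: subst_polyauto; rewrite ?ev2Y //.
- by rewrite /= ev2M ev2B ev2C ev2X subst_d addrK mulrA (mulrC (CC k _)) cV mul1r.
- by rewrite ev2D ev2M ev2C ev2X subst_d mulrA cV mul1r subrK.
Qed.

Lemma coordinate_triangular (k : fieldType) (c : k) (d : {poly k}) : c != 0 ->
  coordinate (CC k c * 'X%:P + at_const 'X d).
Proof.
move=> c0; have h := triangular_polyauto d c0.
exists (subst (CC k c^-1 * ('X%:P - at_const 'X d)) 'X), (subst (CC k c * 'X%:P + at_const 'X d) 'X).
split; first exact: polyauto_sym.
by have := autoK h 'X%:P; rewrite /= ev2X.
Qed.

(** The pair [(x, y)] is the deformation [(a, b)] of [s] composed with the inverse [t]. Translating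
    only one of [s 'X%:P] and [s 'X] yields a flow that fixes the other. *)
Lemma exists_flow (K : fieldType) (s t : {rmorphism bipoly K -> bipoly K}) (a b : {poly bipoly K}) :
  polyauto s t -> a`_0 = s 'X%:P -> b`_0 = s 'X -> (1 < size a)%N || (1 < size b)%N ->
  exists x y : {poly bipoly K}, [/\ x`_0 = 'X%:P, y`_0 = 'X,
    (1 < size x)%N || (1 < size y)%N, ev2s x y (s 'X%:P) = a & ev2s x y (s 'X) = b].
Proof.
move=> st a0 b0 nontriv; pose x := ev2s a b (t 'X%:P); pose y := ev2s a b (t 'X).
have coef0 p : (ev2s a b p)`_0 = s p.
  rewrite (substE (auto_const st)) -a0 -b0 -[LHS]/(coefp 0 (ev2s a b p)).
  by rewrite (@morph_ev2 _ _ _ _ (CC K)) // => c; rewrite -CCsE /= coefC.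
have flow p : ev2s x y p = ev2s a b (t p).
  by rewrite -ev2_subst -(substE (auto_inv_const st)).
exists x, y; split.
- by rewrite coef0 (auto_invK st).
- by rewrite coef0 (auto_invK st).
- apply: contraTT nontriv; rewrite !negb_or -!leqNgt => /andP[/size1_polyC Dx /size1_polyC Dy].
  have const p : (size (ev2s x y p) <= 1)%N.
    rewrite Dx Dy -(@morph_ev2 _ _ _ (CC K) _ polyC) ?size_polyC_leq1 // => c.
    by rewrite /= CCsE.
  have := const (s 'X%:P); rewrite flow (autoK st) ev2X => ->.
  by have := const (s 'X); rewrite flow (autoK st) ev2Y => ->.
- by rewrite flow (autoK st) ev2X.
- by rewrite flow (autoK st) ev2Y.
Qed.

Lemma at_const_compE (k : comNzRingType) (x : bipoly k) p : at_const x p = map_poly polyC p \Po x.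
Proof.
elim/poly_ind: p => [|p c IH]; first by rewrite !rmorph0.
rewrite at_constD IH rmorphD rmorphM /= map_polyX map_polyC /= comp_poly_MXaddC.
by rewrite CCE.
Qed.

Lemma grade_subst (k : fieldType) (D E N : nat) (f g Z : bipoly k) :
  grade D E D f = f -> grade D E E g = g -> wdeg_le D E D f -> wdeg_le D E E g ->
  wdeg_le D E N Z -> grade D E N (subst f g Z) = subst f g (grade D E N Z).
Proof.
move=> ff gg hf hg hZ; apply: polyC_inj.
have ev_C p : ev2s f%:P g%:P p = (subst f g p)%:P.
  by rewrite -(@morph_ev2 _ _ _ (CC k) _ polyC) // => c; rewrite /= CCsE.
have := @component_subst k D E 1 N 0 Z f%:P g%:P isT hZ; rewrite !mul1n.
move=> /(_ (filteredC_wdeg hf) (filteredC_wdeg hg)).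
by rewrite !ev_C !componentC_grade ff gg ev_C.
Qed.

Definition bidegree_le (k : fieldType) (E D : nat) (Z : bipoly k) :=
  forall j i, Z`_j`_i != 0 -> (i <= E)%N && (j <= D)%N.

Lemma exact_bidegree (k : fieldType) (Z : bipoly k) : Z != 0 ->
  exists E D, [/\ bidegree_le E D Z, exists j, Z`_j`_E != 0 & exists i, Z`_D`_i != 0].
Proof.
move=> Z0; have [E [hE gE]] := wdeg_exists 1 0 Z0; have [D [hD gD]] := wdeg_exists 0 1 Z0.
have nz (p : bipoly k) : p != 0 -> exists j i, p`_j`_i != 0.
  move=> p0; exists (size p).-1, (size p`_(size p).-1).-1.
  by rewrite -lead_coefE lead_coef_eq0 -lead_coefE lead_coef_eq0.
exists E, D; split.
- by move=> j i h; move: (hE _ _ h) (hD _ _ h); rewrite !mul1n !mul0n addn0 add0n => -> ->.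
- have [j [i]] := nz _ gE; rewrite coef_grade mul1n mul0n addn0.
  by case: ifP => [/eqP ->|_]; [exists j | rewrite eqxx].
- have [j [i]] := nz _ gD; rewrite coef_grade mul1n mul0n add0n.
  by case: ifP => [/eqP ->|_]; [exists i | rewrite eqxx].
Qed.

Lemma swap_coef (k : comNzRingType) (W : bipoly k) j i :
  (subst 'X 'X%:P W)`_j`_i = W`_i`_j.
Proof.
have -> : subst 'X 'X%:P W = swapXY W; last exact: coef_swapXY.
rewrite [RHS](@substE _ (swapXY : {rmorphism bipoly k -> bipoly k})) => [|c].
  by rewrite /= swapXY_Y swapXY_X.
by rewrite -CCE /= swapXY_polyC map_polyC.
Qed.

(* Comparing degrees in [s Z = zeta * Z], the polynomial [s 'X] has degree one, and
   [Z] divides the nonzero polynomial [s 'X - 'X]. *)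
Lemma semi_invariant_univariate (K : fieldType) (P : {poly K}) :
  semi_invariant (at_const 'X P) -> P != 0 -> size P = 2.
Proof.
move=> [s [t [zeta [st zeta1 sZ hs]]]] P0; set Z := at_const _ _ in sZ hs.
have DZ : Z = map_poly polyC P by rewrite /Z at_const_id.
have size_Z : size Z = size P by rewrite DZ size_map_inj_poly //; exact: polyC_inj.
have P'0 : Z != 0 by rewrite -size_poly_gt0 size_Z size_poly_gt0.
have P1 : (1 < size P)%N.
  rewrite ltnNge; apply/negP => /size1_polyC DP; move: sZ P'0.
  rewrite /Z DP at_constC (auto_const st) => /eqP; rewrite -subr_eq0 -{1}[CC K P`_0]mul1r -mulrBl.
  rewrite mulf_eq0 subr_eq0 => /orP[|/eqP ->]; last by rewrite eqxx.
  by rewrite -(rmorph1 (CC K)) (inj_eq (fmorph_inj (CC K))) eq_sym (negPf zeta1).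
pose G := s 'X; have sG : s Z = Z \Po G.
  by rewrite /Z morph_at_const; [rewrite at_const_compE at_const_id | exact: auto_const st].
have size_sZ : (size (s Z)).-1 = (size P).-1.
  rewrite sZ -CCE size_Cmul ?size_Z // polyC_eq0; apply: contraNneq P'0 => z0.
  by have := autoK st Z; rewrite sZ z0 rmorph0 mul0r (rmorph0 t) => <-.
have size_G : size G = 2.
  have := size_comp_poly Z G; rewrite -sG size_sZ size_Z.
  by move: (size P) (size G) P1 => [|[|m]] // [|[|[|n]]] //= _; nia.
have [r Dr] := hs 'X; rewrite -/G in Dr.
have ZG : Z * r = G - 'X by rewrite Dr addrC addKr.
have GX : G - 'X != 0.
  rewrite subr_eq0; apply: contraNneq zeta1 => GX; move: sZ.
  rewrite sG GX comp_polyXr => /eqP; rewrite -subr_eq0 -{1}[Z]mul1r -mulrBl mulf_eq0.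
  rewrite (negPf P'0) orbF subr_eq0 -(rmorph1 (CC K)) (inj_eq (fmorph_inj (CC K))).
  by rewrite eq_sym.
have r0 : r != 0 by apply: contraNneq GX => r0; rewrite -ZG r0 mulr0.
have : (size (G - 'X)%R <= 2)%N.
  by apply: leq_trans (size_polyD _ _) _; rewrite size_polyN size_polyX size_G maxnn.
rewrite -ZG size_mul // size_Z; rewrite -size_poly_gt0 in r0.
by move: (size P) (size r) P1 r0; clear; lia.
Qed.

Lemma homogeneous_grade (k : fieldType) (D E N : nat) (p : bipoly k) :
  (forall j i, p`_j`_i != 0 -> (D * i + E * j)%N = N) -> wdeg_le D E N p /\ grade D E N p = p.
Proof.
move=> hp; split=> [j i /hp -> //|]; apply/polyP => j; apply/polyP => i; rewrite coef_grade.
by case: eqP => // ne; have [->//|/hp /ne] := eqVneq p`_j`_i 0.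
Qed.

Lemma shear_polyauto (k : fieldType) (m : k) (d : nat) :
  polyauto (subst ('X%:P + CC k m * 'X ^+ d) 'X) (subst ('X%:P - CC k m * 'X ^+ d) 'X).
Proof.
by apply: subst_polyauto; rewrite ?(ev2B, ev2D) ?ev2M ?ev2Xn ?ev2C ?ev2X ?ev2Y ?addrK ?subrK.
Qed.

Lemma coef_fst (k : fieldType) j i :
  ('X%:P : bipoly k)`_j`_i = ((j == 0%N) && (i == 1%N))%:R.
Proof. by rewrite coefC; case: j => [|j]; rewrite ?coefX ?coef0. Qed.

Lemma coef_snd (k : fieldType) j i :
  ('X : bipoly k)`_j`_i = ((j == 1%N) && (i == 0%N))%:R.
Proof. by rewrite coefX; case: eqP => _; rewrite ?coef0 // -polyC1 coefC; case: i. Qed.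

Lemma coef_shear (k : fieldType) (m : k) (d D E j i : nat) : D = (d * E)%N ->
  ('X%:P + CC k m * 'X ^+ d : bipoly k)`_j`_i != 0 -> (D * i + E * j)%N = D.
Proof.
move=> DE; rewrite !coefD coef_fst; have := coef_monomial m 0 d j i; rewrite expr0 mulr1 => ->.
case: andP => [[/eqP -> /eqP ->] _|_]; first by rewrite muln1 muln0 addn0.
case: andP => [[/eqP -> /eqP ->] _|_]; first by rewrite muln0 DE mulnC.
by rewrite addr0 eqxx.
Qed.

(** * Induction on the bidegree *)

Section CoordinateOfSemiInvariant.
Variables (k K : fieldType) (iota : {rmorphism k -> K}).
Hypothesis insep_closed : forall (mu : K) (e : nat) (P : {poly k}), (0 < e)%N ->
  ('X - mu%:P) ^+ e = map_poly iota P -> exists m, mu = iota m.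

Lemma univariate_case (Z : bipoly k) D : Z != 0 -> bidegree_le 0 D Z ->
  semi_invariant (bmap iota Z) -> coordinate Z.
Proof.
move=> Z0 hZ sZ; pose P := map_poly (coefp 0) Z.
have DZ : Z = at_const 'X P.
  rewrite at_const_id; apply/polyP => j; apply/polyP => i.
  rewrite coef_map /= coef_map /= coefC; case: eqP => [->//|/eqP i0].
  by apply/eqP; apply/negPn/negP => /hZ; rewrite leqn0 (negPf i0).
have P0 : P != 0 by apply: contraNneq Z0 => P0; rewrite DZ P0 rmorph0.
have size_P : size P = 2.
  move: sZ; rewrite DZ bmap_at_const bmapY => sZ.
  by rewrite -(size_map_poly iota); apply: semi_invariant_univariate; rewrite ?map_poly_eq0.
have lead0 : P`_1 != 0 by have := lead_coef_eq0 P; rewrite lead_coefE size_P => ->.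
apply: (coordinate_auto (swap_polyauto k)); rewrite /=.
have -> : subst 'X 'X%:P Z = CC k P`_1 * 'X%:P + at_const 'X (P`_0)%:P.
  rewrite DZ morph_at_const; last exact: subst_const_fixing.
  rewrite /= ev2Y at_constC at_constE (@horner_coef_wide _ 2) ?size_P; last first.
    by rewrite size_map_inj_poly ?size_P ?rmorph0 //; exact: fmorph_inj.
  by rewrite !big_ord_recl big_ord0 addr0 /= !coef_map /= expr0 mulr1 expr1 addrC.
exact: coordinate_triangular.
Qed.

(** The monomial [X^E Y^j] has weight at least [D * E], so a bound [D] forces [E = 1] and [j = 0],
    and [Z] is linear in [X]. *)
Lemma linear_case (Z : bipoly k) D E : (0 < E)%N -> (E <= D)%N ->
  (exists j, Z`_j`_E != 0) -> wdeg_le D E D Z -> coordinate Z.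
Proof.
move=> E0 le_ED [j ZE] hZ.
have D0 : (0 < D)%N := leq_trans E0 le_ED.
have [E1 j0] : E = 1%N /\ j = 0%N by move: (hZ _ _ ZE) E0 D0; clear; nia.
pose d : {poly k} := map_poly (coefp 0) Z.
have -> : Z = CC k Z`_0`_1 * 'X%:P + at_const 'X d; last first.
  by apply: coordinate_triangular; rewrite -{1}j0 -E1.
apply/polyP => j'; apply/polyP => i'; rewrite !coefD at_const_id.
rewrite [in X in _ + X]coef_map /= coef_map /= coefC.
rewrite -CCE -polyCM coefC; case: j' => [|j'] /=.
  rewrite coefCM coefX; case: i' => [|[|i']] /=; rewrite ?mulr0 ?mulr1 ?addr0 ?add0r //.
  by apply/eqP; apply/negPn/negP => h; move: (hZ _ _ h) E0 D0; clear; nia.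
rewrite coef0 add0r; case: i' => [//|i'] /=.
by apply/eqP; apply/negPn/negP => h; move: (hZ _ _ h) E0 D0; clear; nia.
Qed.

(** Setting [Y = 1] gives [c ('X - mu)^E] with coefficients in [k]. Dividing by its leading
    coefficient [c] leaves a power to which [insep_closed] applies. *)
Lemma descend_form (Z : bipoly k) (D E N d : nat) (c mu : K) : (0 < E)%N -> c != 0 ->
  grade D E N (bmap iota Z) = CC K c * ('X%:P - CC K mu * 'X ^+ d) ^+ E ->
  exists c0 m, [/\ c0 != 0, mu = iota m &
    grade D E N Z = CC k c0 * ('X%:P - CC k m * 'X ^+ d) ^+ E].
Proof.
move=> E0 c0 gZ; have gZ' : bmap iota (grade D E N Z) = grade D E N (bmap iota Z).
  apply/polyP => j; apply/polyP => i; rewrite coef_bmap !coef_grade coef_bmap.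
  by case: eqP; rewrite ?rmorph0.
pose P := (grade D E N Z).[1].
have DP : map_poly iota P = c%:P * ('X - mu%:P) ^+ E.
  have -> : map_poly iota P = (bmap iota (grade D E N Z)).[1].
    by rewrite [bmap]unlock /= -[1 in RHS](rmorph1 (map_poly iota)) horner_map.
  rewrite gZ' gZ hornerM horner_exp hornerD hornerN hornerM hornerXn expr1n mulr1.
  by rewrite -!CCE !hornerC.
have Dc : c = iota P`_E.
  have := congr1 (fun q : {poly K} => q`_E) DP; rewrite coef_map coefCM => /= ->.
  rewrite -[X in _ * X]/(_`_(E.+1.-1)) -(size_exp_XsubC E mu) -lead_coefE.
  by rewrite (monicP (monic_exp _ (monicXsubC mu))) mulr1.
have cP : P`_E != 0 by apply: contraNneq c0 => h; rewrite Dc h rmorph0.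
have [m Dm] : exists m, mu = iota m.
  apply: (@insep_closed mu E ((P`_E)^-1%:P * P) E0).
  rewrite rmorphM /= map_polyC /= DP fmorphV -Dc mulrA -polyCM mulVf // polyC1 mul1r.
  by [].
exists P`_E, m; split=> //; apply: (@bmap_inj k K iota); rewrite gZ' gZ.
rewrite (rmorphM (bmap iota)) (rmorphXn (bmap iota)) (rmorphB (bmap iota)) bmapX.
by rewrite (rmorphM (bmap iota)) (rmorphXn (bmap iota)) !bmapC bmapY -Dc Dm.
Qed.
Lemma top_form_of_semi_invariant (Z : bipoly K) (D E : nat) : Z != 0 ->
  semi_invariant Z -> (0 < E)%N -> (E <= D)%N -> bidegree_le E D Z ->
  (exists j, Z`_j`_E != 0) -> (exists i, Z`_D`_i != 0) ->
  wdeg_le D E D Z \/ wdeg_le D E (D * E) Z /\ exists c mu d, [/\ c != 0, D = (d * E)%N &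
    grade D E (D * E) Z = CC K c * ('X%:P - CC K mu * 'X ^+ d) ^+ E].
Proof.
move=> Z0 [s [t [zeta [st zeta1 sZ hs]]]] E0 le_ED Z_deg ZE ZD.
have [r1 Dr1] := hs 'X%:P; have [r2 Dr2] := hs 'X.
have size_up (p : bipoly K) : (p%:P + 'X)`_0 = p /\ (1 < size (p%:P + 'X)%R)%N.
  split; first by rewrite coefD coefX coefC addr0.
  by rewrite addrC size_polyDl size_polyX // ltnS size_polyC_leq1.
have [sX_0 sX_1] := size_up (s 'X%:P); have [sY_0 sY_1] := size_up (s 'X).
have C0 p : (p%:P : {poly bipoly K})`_0 = p by rewrite coefC.
have [r10|r10] := eqVneq r1 0; last first.
  (* The flow translates [s 'X] only, so it fixes [s 'X%:P], which plays the role of [F]. *)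
  have [|x [y [x0 y0 nontriv hx _]]] := exists_flow st (C0 _) sY_0; first by rewrite sY_1 orbT.
  apply: (top_form E0 le_ED Z_deg ZE ZD r10 _ Dr1 x0 y0 nontriv hx).
  move=> j i; rewrite coef_fst.
  by case: andP => [[/eqP -> /eqP ->]|_]; rewrite ?eqxx // muln1 muln0 addn0.
have [r20|r20] := eqVneq r2 0; last first.
  have [|x [y [x0 y0 nontriv _ hy]]] := exists_flow st sX_0 (C0 _); first by rewrite sX_1.
  apply: (top_form E0 le_ED Z_deg ZE ZD r20 _ Dr2 x0 y0 nontriv hy).
  move=> j i; rewrite coef_snd.
  by case: andP => [[/eqP -> /eqP ->]|_]; rewrite ?eqxx // muln0 muln1.
(* With [r1] and [r2] both zero, [s] would be the identity, against [zeta] being different from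
   1. *)
case/negP: zeta1; move: sZ; rewrite (substE (auto_const st)) Dr1 Dr2 r10 r20 !mulr0 !addr0 ev2_id.
move/eqP; rewrite -subr_eq0 -{1}[Z]mul1r -mulrBl mulf_eq0 (negPf Z0) orbF subr_eq0.
by rewrite -(rmorph1 (CC K)) (inj_eq (fmorph_inj (CC K))) eq_sym.
Qed.

(** The shear turns the top form into [c X^E]. Weights stay at most [D * E], which leaves [Y^D] as
    the only possible monomial of degree [D] or more in [Y], and it has disappeared. *)
Lemma reduce_bidegree (Z : bipoly k) (D E d : nat) (c m : k) : (0 < E)%N -> (E <= D)%N ->
  D = (d * E)%N -> wdeg_le D E (D * E) Z ->
  grade D E (D * E) Z = CC k c * ('X%:P - CC k m * 'X ^+ d) ^+ E ->
  bidegree_le E D.-1 (subst ('X%:P + CC k m * 'X ^+ d) 'X Z).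
Proof.
move=> E0 le_ED DE Z_le gZ; set f := 'X%:P + _.
have D0 : (0 < D)%N := leq_trans E0 le_ED.
have [f_le gf] : wdeg_le D E D f /\ grade D E D f = f.
  by apply: homogeneous_grade => j i; exact: coef_shear.
have [y_le gy] : wdeg_le D E E ('X : bipoly k) /\ grade D E E ('X : bipoly k) = 'X.
  apply: homogeneous_grade => j i; rewrite coef_snd.
  by case: andP => [[/eqP -> /eqP ->]|_]; rewrite ?eqxx // muln0 muln1.
have top : grade D E (D * E) (subst f 'X Z) = CC k c * 'X%:P ^+ E.
  rewrite grade_subst // gZ ev2M ev2Xn ev2B ev2M ev2Xn !ev2C ev2X ev2Y.
  by rewrite /f addrK.
move=> j i h; have [lt|le] := ltnP (D * E) (D * i + E * j).
  have Z_le' : wdeg_le D E (D * i + E * j) Z.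
    by move=> j' i' /Z_le h'; apply: leq_trans h' _; apply: ltnW.
  have g0 : grade D E (D * i + E * j) Z = 0.
    apply/polyP => j'; apply/polyP => i'; rewrite coef_grade !coef0.
    case: eqP => // e; apply/eqP; apply/negPn/negP => /Z_le.
    by move: lt e; clear; lia.
  have := grade_subst gf gy f_le y_le Z_le'; rewrite g0 (rmorph0 (subst f 'X)).
  move/(congr1 (fun p : bipoly k => p`_j`_i)); rewrite coef_grade eqxx !coef0 => h0.
  by rewrite h0 eqxx in h.
have ne_jD : j <> D.
  move=> jD; have i0 : i = 0%N by move: le D0 E0; rewrite jD; clear; nia.
  have := congr1 (fun p : bipoly k => p`_j`_i) top; rewrite coef_grade jD i0.
  have -> : (D * 0 + E * D)%N = (D * E)%N by rewrite muln0 mulnC.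
  rewrite eqxx; have := coef_monomial c E 0 D 0; rewrite expr0 mulr1 => ->.
  by rewrite gtn_eqF // mulr0n => h0; rewrite jD i0 h0 eqxx in h.
by move: le ne_jD D0 E0; clear; nia.
Qed.

Theorem coordinate_of_semi_invariant (Z : bipoly k) :
  Z != 0 -> semi_invariant (bmap iota Z) -> coordinate Z.
Proof.
have aux N E D (W : bipoly k) : (E + D <= N)%N -> bidegree_le E D W ->
    W != 0 -> semi_invariant (bmap iota W) -> coordinate W.
  elim: N E D W => [|N IH] E D W.
    rewrite leqn0 addn_eq0 => /andP[/eqP -> /eqP ->] hW W0 sW.
    exact: (univariate_case W0 hW).
  have main E' D' (W' : bipoly k) : (E' <= D')%N -> (E' + D' <= N.+1)%N -> bidegree_le E' D' W' ->
      (exists j, W'`_j`_E' != 0) -> (exists i, W'`_D'`_i != 0) ->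
      W' != 0 -> semi_invariant (bmap iota W') -> coordinate W'.
    move=> le_ED hN hW WE WD W0 sW.
    have [E0|E0] := posnP E'; first by apply: (univariate_case W0 _ sW); rewrite -E0; exact: hW.
    have WK0 : bmap iota W' != 0 by rewrite -(rmorph0 (bmap iota)) (inj_eq (@bmap_inj k K iota)).
    have iota0 j i : ((bmap iota W')`_j`_i != 0) = (W'`_j`_i != 0).
      by rewrite coef_bmap fmorph_eq0.
    case: (top_form_of_semi_invariant WK0 sW E0 le_ED).
    - by move=> j i; rewrite iota0; exact: hW.
    - by have [j hj] := WE; exists j; rewrite iota0.
    - by have [i hi] := WD; exists i; rewrite iota0.
    - by move=> h; apply: (linear_case E0 le_ED WE) => j i; rewrite -iota0; exact: h.
    move=> [W_le [c [mu [d [c0 DE gW]]]]].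
    have [c' [m [c'0 _ gW']]] := descend_form E0 c0 gW.
    have W_le' : wdeg_le D' E' (D' * E') W' by move=> j i; rewrite -iota0; exact: W_le.
    apply: (coordinate_auto (shear_polyauto m d)).
    apply: (IH E' D'.-1); rewrite /=.
    + by move: hN E0 le_ED; clear; case: D' => [|D'] /=; lia.
    + exact: (reduce_bidegree E0 le_ED DE W_le' gW').
    + apply: contraNneq W0 => h; have := autoK (shear_polyauto m d) W'.
      by rewrite /= h rmorph0 => <-.
    + rewrite bmap_subst.
      by apply: semi_invariant_auto sW; apply: bmap_polyauto; exact: shear_polyauto.
  move=> hN hW W0 sW; have [E' [D' [hW' WE WD]]] := exact_bidegree W0.
  have {}hN : (E' + D' <= N.+1)%N.
    have [j hj] := WE; have [i hi] := WD; have /andP[h1 _] := hW _ _ hj.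
    by have /andP[_ h2] := hW _ _ hi; move: h1 h2 hN; clear; lia.
  have [le_ED|lt_DE] := leqP E' D'; first exact: (main E' D').
  apply: (coordinate_auto (swap_polyauto k)); rewrite /=.
  apply: (main D' E'); first exact: ltnW.
  - by rewrite addnC.
  - by move=> j i; rewrite swap_coef andbC; exact: hW'.
  - by have [i hi] := WD; exists i; rewrite swap_coef.
  - by have [j hj] := WE; exists j; rewrite swap_coef.
  - apply: contraNneq W0 => h; have := autoK (swap_polyauto k) W.
    by rewrite /= h rmorph0 => <-.
  - rewrite bmap_subst bmapX bmapY.
    exact: semi_invariant_auto (swap_polyauto K) sW.
move=> Z0; have [E [D [hZ _ _]]] := exact_bidegree Z0.
exact: (aux (E + D)%N E D Z).
Qed.

End CoordinateOfSemiInvariant.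
(** * The action of the roots of unity *)

(** For [phi = eps] and [w = z] this is the presentation [A[Z] -> B], with kernel generated by
    [b Z^n - a]. *)
HB.lock Definition hev (R S : comNzRingType) (phi : {rmorphism R -> S}) (w : S) :
  {rmorphism {poly R} -> S} := horner_morph (fun a => mulrC w (phi a)).

Section HornerEvaluation.
Variables (R S : comNzRingType) (phi : {rmorphism R -> S}) (w : S).

Lemma hevE P : hev phi w P = (map_poly phi P).[w].
Proof. by rewrite [hev]unlock. Qed.

Lemma hevC c : hev phi w c%:P = phi c.
Proof. by rewrite hevE map_polyC hornerC. Qed.

Lemma hevX : hev phi w 'X = w.
Proof. by rewrite hevE map_polyX hornerX. Qed.

Lemma hev_MXaddC P c : hev phi w (P * 'X + c%:P) = hev phi w P * w + phi c.
Proof. by rewrite rmorphD rmorphM /= hevX hevC. Qed.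

End HornerEvaluation.

Lemma morph_hev (R S S' : comNzRingType) (phi : {rmorphism R -> S}) (phi' : {rmorphism R -> S'})
    (g : {rmorphism S -> S'}) w P :
  (forall c, g (phi c) = phi' c) -> g (hev phi w P) = hev phi' (g w) P.
Proof.
move=> hg; elim/poly_ind: P => [|P c IH]; first by rewrite !rmorph0.
by rewrite !hev_MXaddC (rmorphD g) (rmorphM g) IH hg.
Qed.

Lemma size_binomial (R : idomainType) (a b : R) n : (0 < n)%N -> b != 0 ->
  size (b%:P * 'X^n - a%:P) = n.+1.
Proof.
move=> n0 b0; have s : size (b%:P * 'X^n) = n.+1 by rewrite size_Cmul // size_polyXn.
by rewrite size_polyDl s // size_polyN ltnS (leq_trans (size_polyC_leq1 _)).
Qed.

Section Cyclic.
Variables (k : fieldType) (eps : {rmorphism bipoly k -> bipoly k}).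
Variables (a b z : bipoly k) (n : nat).
Hypotheses (eps_const : const_fixing eps) (n_gt1 : (1 < n)%N) (b0 : b != 0).
Hypothesis surj : forall s, exists P, s = hev eps z P.
Hypothesis ker : forall P, hev eps z P = 0 -> exists Q, P = Q * (b%:P * 'X^n - a%:P).
Hypothesis relation : eps b * z ^+ n = eps a.

Let n_gt0 : (0 < n)%N := ltnW n_gt1.

Lemma kernel_size P : P != 0 -> hev eps z P = 0 -> (n < size P)%N.
Proof.
move=> P0 /ker [Q DP]; have Q0 : Q != 0 by apply: contraNneq P0 => Q0; rewrite DP Q0 mul0r.
have s := size_binomial a n_gt0 b0.
rewrite DP size_mul -?size_poly_gt0 ?s //; last by rewrite size_poly_gt0.
by rewrite addnS /= -[X in (X < _)%N]add0n ltn_add2r size_poly_gt0.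
Qed.

Lemma base_injective : injective eps.
Proof.
apply: raddf_inj => p p0; apply/eqP; rewrite -polyC_eq0; apply/negPn/negP => h.
have := kernel_size h; rewrite hevC => /(_ p0).
by rewrite ltnNge (leq_trans (size_polyC_leq1 _)).
Qed.

Lemma z_neq0 : z != 0.
Proof.
apply: contraTneq n_gt1 => z0; rewrite -leqNgt.
have := @kernel_size 'X; rewrite polyX_eq0 hevX size_polyX => /(_ isT z0).
by rewrite ltnS.
Qed.

(** Lifting [s] to [P] in [A[Z]] makes [y - Z P] a multiple of [b Z^n - a]; constant terms in [Z]
    show that [a] divides [y]. *)
Lemma ideal_z y s : eps y = z * s -> exists y', y = a * y'.
Proof.
have [P ->] := surj s => h; have [Q DQ] : exists Q, y%:P - 'X * P = Q * (b%:P * 'X^n - a%:P).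
  by apply: ker; rewrite rmorphB rmorphM /= hevC hevX h subrr.
exists (- Q`_0); have := congr1 (fun R : {poly bipoly k} => R`_0) DQ.
rewrite coefB coefC coefXM coef0M coefB coefCM coefXn coefC /= subr0 eq_sym gtn_eqF //.
by rewrite mulr0 sub0r => ->; rewrite !mulrN mulrC.
Qed.

Variables (K : fieldType) (iota : {rmorphism k -> K}).

Let epsK : {rmorphism bipoly k -> bipoly K} := bmap iota \o eps.
Let zK : bipoly K := bmap iota z.
Let EK (omega : K) : {rmorphism {poly bipoly k} -> bipoly K} := hev epsK (CC K omega * zK).

Lemma EK1 P : EK 1 P = bmap iota (hev eps z P).
Proof. by rewrite /EK (rmorph1 (CC K)) mul1r -(morph_hev (g := bmap iota) (phi := eps)). Qed.

Lemma EK_congr omega P P' : omega ^+ n = 1 -> hev eps z P = hev eps z P' -> EK omega P = EK omega P'.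
Proof.
move=> omega_n /eqP; rewrite -subr_eq0 -rmorphB => /eqP /ker [Q DQ].
apply/eqP; rewrite -subr_eq0 -rmorphB DQ rmorphM rmorphB rmorphM rmorphXn /= !hevC hevX.
rewrite exprMn -(rmorphXn (CC K)) omega_n (rmorph1 (CC K)) mul1r /epsK /zK /=.
by rewrite -(rmorphXn (bmap iota)) -(rmorphM (bmap iota)) relation subrr mulr0.
Qed.

(** For [omega ^+ n = 1], sending [Z] to [omega z] kills [b Z^n - a] and so factors through [B]. As
    [B] is a polynomial ring, the induced map is a substitution, written with lifts of the two
    variables. *)
Lemma exists_cyclic : exists sigma : K -> {rmorphism bipoly K -> bipoly K},
  forall omega, const_fixing (sigma omega) /\
    (omega ^+ n = 1 -> forall P, sigma omega (bmap iota (hev eps z P)) = EK omega P).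
Proof.
have [PX DX] := surj 'X%:P; have [PY DY] := surj 'X.
exists (fun omega => subst (EK omega PX) (EK omega PY)) => omega.
split=> [|omega_n P]; first exact: subst_const_fixing.
have lift s : hev eps z (ev2s PX PY s) = s.
  rewrite (@morph_ev2 _ _ _ _ (CC k)) -?DX -?DY ?ev2_id // => c.
  by rewrite -CCsE hevC eps_const.
have liftK s : EK omega (ev2s PX PY s) = subst (EK omega PX) (EK omega PY) (bmap iota s).
  move: s; apply: (bipoly_morphism_ext (g := EK omega \o ev2s PX PY)
    (h := subst (EK omega PX) (EK omega PY) \o bmap iota)) => [c||] /=.
  - by rewrite bmapC !ev2C -CCsE /EK hevC /epsK /= eps_const bmapC.
  - by rewrite bmapX !ev2X.
  - by rewrite bmapY !ev2Y.
by rewrite /= -liftK; apply: EK_congr => //; rewrite lift.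
Qed.

Section Sigma.
Variable sigma : K -> {rmorphism bipoly K -> bipoly K}.
Hypothesis sigma_const : forall omega, const_fixing (sigma omega).
Hypothesis sigmaE : forall omega, omega ^+ n = 1 ->
  forall P, sigma omega (bmap iota (hev eps z P)) = EK omega P.

Lemma sigma_z omega : omega ^+ n = 1 -> sigma omega zK = CC K omega * zK.
Proof. by move=> h; have := sigmaE h 'X; rewrite /EK !hevX. Qed.

Lemma sigma_EK omega omega' P : omega ^+ n = 1 ->
  sigma omega (EK omega' P) = EK (omega * omega') P.
Proof.
move=> h; have sz := sigma_z h.
rewrite [LHS](@morph_hev _ _ _ epsK epsK) => [|c].
  by rewrite (rmorphM (sigma omega)) sigma_const sz mulrA -CCM mulrC -/zK [omega' * _]mulrC -mulrC.
by have := sigmaE h c%:P; rewrite /EK !hevC.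
Qed.

Lemma sigma_polyauto (omega : K) : omega ^+ n = 1 -> polyauto (sigma omega) (sigma omega^-1).
Proof.
have cancel_sigma w w' : w ^+ n = 1 -> w' ^+ n = 1 -> w' * w = 1 -> cancel (sigma w) (sigma w').
  move=> h h' ww; have fixed s : sigma w' (sigma w (bmap iota s)) = bmap iota s.
    by have [P ->] := surj s; rewrite sigmaE // sigma_EK // ww EK1.
  apply: (bipoly_morphism_ext (g := sigma w' \o sigma w) (h := idfun)) => [c||] /=.
  - by rewrite !sigma_const.
  - by rewrite -(bmapX iota) fixed.
  - by rewrite -(bmapY iota) fixed.
move=> h; have h' : omega^-1 ^+ n = 1 by rewrite exprVn h invr1.
have w0 : omega != 0 by apply: contraTneq isT => w0; move/eqP: h; rewrite w0 expr0n gtn_eqF // eq_sym oner_eq0.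
by split=> //; apply: cancel_sigma; rewrite ?mulVf ?mulfV.
Qed.

Lemma sigma_mod_z (omega : K) p : omega ^+ n = 1 -> exists r, sigma omega p = p + zK * r.
Proof.
move=> h; have base s : exists r, sigma omega (bmap iota s) = bmap iota s + zK * r.
  have [P ->] := surj s; rewrite sigmaE // -EK1; elim/poly_ind: P => [|P c _].
    by exists 0; rewrite !rmorph0 mulr0 addr0.
  exists (EK omega P * CC K omega - EK 1 P).
  by rewrite /EK !hev_MXaddC (rmorph1 (CC K)) mul1r; ring.
have hX := base 'X%:P; rewrite bmapX in hX; have hY := base 'X; rewrite bmapY in hY.
have hD p1 p2 : (exists r, sigma omega p1 = p1 + zK * r) ->
    (exists r, sigma omega p2 = p2 + zK * r) -> exists r, sigma omega (p1 + p2) = p1 + p2 + zK * r.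
  by move=> [r1 D1] [r2 D2]; exists (r1 + r2); rewrite rmorphD D1 D2; ring.
have hM p1 p2 : (exists r, sigma omega p1 = p1 + zK * r) ->
    (exists r, sigma omega p2 = p2 + zK * r) -> exists r, sigma omega (p1 * p2) = p1 * p2 + zK * r.
  move=> [r1 D1] [r2 D2]; exists (r1 * p2 + p1 * r2 + r1 * zK * r2).
  by rewrite rmorphM D1 D2; ring.
have hC c : exists r, sigma omega (CC K c) = CC K c + zK * r.
  by exists 0; rewrite sigma_const mulr0 addr0.
elim/poly_ind: p => [|p q IH]; first by exists 0; rewrite rmorph0 mulr0 addr0.
apply: (hD _ _ _ _); first exact: hM.
elim/poly_ind: q => [|q c IHq]; first by exists 0; rewrite rmorph0 mulr0 addr0.
by rewrite polyCD polyCM CCE; apply: hD => //; exact: hM.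
Qed.

Lemma z_semi_invariant (zeta : K) : zeta ^+ n = 1 -> zeta != 1 -> semi_invariant zK.
Proof.
move=> h zeta1; exists (sigma zeta), (sigma zeta^-1), zeta; split=> // [||p].
- exact: sigma_polyauto.
- exact: sigma_z.
- exact: sigma_mod_z.
Qed.

(** The sum over [i] of the [zeta^(i j)] is [n] if [n] divides [j] and 0 otherwise. *)
Lemma sum_sigma (zeta : K) (P : {poly bipoly k}) : n.-primitive_root zeta -> 
  \sum_(i < n) sigma (zeta ^+ i) (bmap iota (hev eps z P)) =
  n%:R * bmap iota (\sum_(j < size P | (n %| j)%N) eps P`_j * z ^+ j).
Proof.
move=> zeta_prim; have zeta_n i : (zeta ^+ i) ^+ n = 1.
  by rewrite exprAC (prim_expr_order zeta_prim) expr1n.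
under eq_bigr => i _.
  rewrite sigmaE // /EK hevE (@horner_coef_wide _ (size P)); last exact: size_poly.
  over.
rewrite exchange_big (rmorph_sum (bmap iota)) mulr_sumr [RHS]big_mkcond; apply: eq_bigr => j _ /=.
have -> : \sum_(i < n) (map_poly epsK P)`_j * (CC K (zeta ^+ i) * zK) ^+ j =
    (\sum_(i < n) CC K ((zeta ^+ j) ^+ i)) * bmap iota (eps P`_j * z ^+ j).
  rewrite mulr_suml; apply: eq_bigr => i _.
  rewrite coef_map /= exprMn -(rmorphXn (CC K)) exprAC (rmorphM (bmap iota)).
  by rewrite (rmorphXn (bmap iota)) /zK; ring.
rewrite -(rmorph_sum (CC K)); case: ifP => [nj|/negbT nj].
  have -> : zeta ^+ j = 1 by apply/eqP; rewrite -(prim_order_dvd zeta_prim).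
  under eq_bigr do rewrite expr1n.
  by rewrite sumr_const card_ord (rmorph_nat (CC K)).
have sum0 : \sum_(i < n) (zeta ^+ j) ^+ i = 0.
  have : (zeta ^+ j - 1) * (\sum_(i < n) (zeta ^+ j) ^+ i) == 0.
    by rewrite -subrX1 zeta_n subrr.
  by rewrite mulf_eq0 subr_eq0 -(prim_order_dvd zeta_prim) (negPf nj) => /eqP.
by rewrite sum0 (rmorph0 (CC K)) mul0r.
Qed.

End Sigma.
End Cyclic.

(** Degrees multiply under composition with the inverse, so [s 'X] has degree 1 in the outer
    variable. Its leading coefficient is a unit, hence a constant, and the congruence modulo [z]
    makes it 1. *)
Lemma translation (K : fieldType) (s t : {rmorphism bipoly K -> bipoly K}) (w : K) :
  polyauto s t -> s 'X%:P = CC K w * 'X%:P -> (exists r, s 'X = 'X + 'X%:P * r) ->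
  s 'X = 'X + ((s 'X)`_0)%:P.
Proof.
move=> st sz [r Dr]; pose G := s 'X; pose dil : {rmorphism {poly K} -> {poly K}} := comp_poly (w%:P * 'X).
have sE p : s p = map_poly dil p \Po G.
  move: p; apply: (bipoly_morphism_ext (g := s) (h := comp_poly G \o map_poly dil)) => [c||] /=.
  - by rewrite (auto_const st) -CCE map_polyC /= !comp_polyC.
  - by rewrite sz map_polyC /= comp_polyX comp_polyC polyCM CCE.
  - by rewrite map_polyX comp_polyX.
have := sE (t 'X); rewrite (auto_invK st); set p := map_poly _ _ => Dp.
have sizes : ((size p).-1 * (size G).-1 = 1)%N.
  by rewrite -size_comp_poly -Dp size_polyX.
have size_G : size G = 2.
  by move: sizes; case: (size G) => [|[|[|m]]] //=; case: (size p) => [|[|[|l]]] //=; nia.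
have size_p : size p = 2.
  by move: sizes; rewrite size_G; case: (size p) => [|[|[|l]]] //=; nia.
have G1 : p`_1 * G`_1 = 1.
  have := congr1 (fun q : bipoly K => q`_1) Dp; rewrite coefX eqxx /= => E.
  apply: etrans (esym E).
  rewrite comp_polyE size_p !big_ord_recl big_ord0 addr0 /= expr0 expr1 coefD !coefZ.
  by rewrite coef1 /= mulr0 add0r.
have /andP [/size_poly1P [l l0 Dl] _] : (size G`_1 == 1%N) && (G`_1`_0 \is a GRing.unit).
  have GU : G`_1 \is a GRing.unit by apply/unitrPr; exists p`_1; rewrite mulrC.
  exact: GU.
have l1 : l = 1.
  have := congr1 (fun q : bipoly K => q`_1`_0) Dr; rewrite -/G Dl coefC eqxx => ->.
  by rewrite !coefD coefX coefCM coefXM /= coef1 addr0.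
apply/polyP => -[|[|j]]; rewrite -/G coefD coefX coefC /=.
- by rewrite add0r.
- by rewrite Dl l1 addr0.
- by rewrite addr0 nth_default // size_G.
Qed.

Lemma generators_transport (k : fieldType) (s t : {rmorphism bipoly k -> bipoly k}) (v z : bipoly k) :
  polyauto s t -> (forall W, exists P, W = subst (s v) (s z) P) ->
  forall W, exists P, W = subst v z P.
Proof.
move=> st h W; have [P DP] := h (s W); exists P.
apply: (can_inj (autoK st)); rewrite DP (@morph_ev2 _ _ _ _ (CC k)) // => c.
exact: auto_const st _.
Qed.

Section Homogenization.
Variables (k : fieldType) (eps : {rmorphism bipoly k -> bipoly k}).
Variables (a b : bipoly k) (n : nat).
Hypotheses (eps_const : const_fixing eps) (n_gt1 : (1 < n)%N) (b0 : b != 0).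
Hypothesis n0 : n%:R != 0 :> k.
Hypothesis surj : forall s, exists P, s = hev eps 'X%:P P.
Hypothesis ker : forall P, hev eps 'X%:P P = 0 -> exists Q, P = Q * (b%:P * 'X^n - a%:P).
Hypothesis relation : eps b * 'X%:P ^+ n = eps a.

(* Averaging a coordinate complementary to [z = 'X%:P] over the action makes it invariant. *)
Lemma invariant_complement : exists (h : {poly k}) H, 'X + h%:P = hev eps ('X%:P ^+ n) H.
Proof.
have [K [zeta [zeta_prim _]]] := primitive_extension (ltnW n_gt1) n0.
pose iota : {rmorphism k -> K} := in_alg K.
have [sigma hs] := exists_cyclic eps_const surj ker relation iota.
have s_const omega : const_fixing (sigma omega) by case: (hs omega).
have sE omega (h : omega ^+ n = 1) := (hs omega).2 h.
have zeta_n i : (zeta ^+ i) ^+ n = 1 by rewrite exprAC (prim_expr_order zeta_prim) expr1n.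
have [P DP] := surj 'X.
have := sum_sigma sE P zeta_prim; rewrite -DP bmapY.
have transl (i : 'I_n) : sigma (zeta ^+ i) 'X = 'X + ((sigma (zeta ^+ i) 'X)`_0)%:P.
  have h := zeta_n i; apply: (translation (sigma_polyauto n_gt1 surj s_const sE h) (w := zeta ^+ i)).
    have := sigma_z sE h; rewrite bmapX; exact.
  have := sigma_mod_z surj s_const sE 'X h; rewrite bmapX; exact.
rewrite (eq_bigr _ (fun i _ => transl i)) big_split /= sumr_const card_ord -(rmorph_sum polyC).
set hh := \sum_(i < n) _; set U := \sum_(j < _ | _) _ => E.
(* Multiplied by [n], [U] and ['X] agree in positive outer degree; [n] is nonzero in [k] and [iota]
   is injective, so they differ by a polynomial in [z] over [k]. *)
have size_U : (size (U - 'X)%R <= 1)%N.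
  apply/leq_sizeP => j j1; apply/polyP => i; rewrite coef0.
  have := congr1 (fun q : bipoly K => q`_j`_i) E.
  rewrite !mulr_natl coefD !coefMn coefC gtn_eqF // addr0 -(bmapY iota) !coefMn !coef_bmap.
  move/eqP; rewrite -subr_eq0 -mulrnBl -rmorphB -rmorphMn fmorph_eq0 -mulr_natl.
  by rewrite mulf_eq0 (negPf n0) /= subr_eq0 !coefB => /eqP ->; rewrite subrr.
exists (U - 'X)`_0, (\sum_(j < size P | (n %| j)%N) (P`_j)%:P * 'X ^+ (j %/ n)).
rewrite -(size1_polyC size_U) addrC subrK rmorph_sum; apply: eq_bigr => j /dvdnP [q Dq].
by rewrite rmorphM rmorphXn /= hevC hevX -exprM mulnC divnK ?Dq ?dvdn_mull.
Qed.

Lemma straightened : exists u : bipoly k, [/\ exists q, b = at_const u q,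
  forall y, exists P, y = subst u a P & forall W, exists P, W = subst (eps u) 'X%:P P].
Proof.
have [h [H DH]] := invariant_complement.
have sub_h (v : bipoly k) : subst 'X%:P v h%:P = h%:P.
  rewrite -(at_const_Z h) morph_at_const /=; last exact: subst_const_fixing.
  by rewrite ev2X.
(* The shear that makes the invariant complement the outer indeterminate, as [descent] requires. *)
pose s : {rmorphism bipoly k -> bipoly k} := subst 'X%:P ('X - h%:P).
pose t : {rmorphism bipoly k -> bipoly k} := subst 'X%:P ('X + h%:P).
have st : polyauto s t.
  apply: subst_polyauto; rewrite ?ev2X //.
    by rewrite ev2D ev2Y sub_h subrK.
  by rewrite ev2B ev2Y sub_h addrK.
have sX : s 'X%:P = 'X%:P by rewrite /s /= ev2X.
have sY : s ('X + h%:P) = 'X by rewrite /s /= ev2D ev2Y sub_h subrK.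
have s_const : const_fixing (s \o eps) by move=> c /=; rewrite eps_const (auto_const st).
have s_inj : injective (s \o eps).
  by move=> p q /= /(can_inj (autoK st)); exact: (base_injective n_gt1 b0 ker).
have s_rel : (s \o eps) b * 'X%:P ^+ n = (s \o eps) a.
  by rewrite /= -relation (rmorphM s) (rmorphXn s) sX.
have s_z0 y r : (s \o eps) y = 'X%:P * r -> exists y', y = a * y'.
  move=> h1; have h2 : eps y = 'X%:P * t r.
    apply: (can_inj (autoK st)); rewrite (rmorphM s) (auto_invK st) sX; exact: h1.
  exact: (ideal_z n_gt1 surj ker h2).
have s_U : 'X = (map_poly (s \o eps) H).['X%:P ^+ n].
  rewrite -[LHS]sY DH -hevE (@morph_hev _ _ _ eps (s \o eps)) //.
  by rewrite (rmorphXn s) sX.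
have [u [uq ua uW]] := descent s_const s_inj (ltnW n_gt1) b0 s_rel s_z0 s_U.
exists u; split=> //; apply: (generators_transport st) => W.
by have [P DP] := uW W; exists P; rewrite sX; exact: DP.
Qed.

End Homogenization.

Theorem cyclic_surface (k : fieldType) (eps : {rmorphism bipoly k -> bipoly k})
    (a b z : bipoly k) (n : nat) :
  const_fixing eps -> (1 < n)%N -> b != 0 -> n%:R != 0 :> k ->
  (forall s, exists P, s = hev eps z P) ->
  (forall P, hev eps z P = 0 -> exists Q, P = Q * (b%:P * 'X^n - a%:P)) ->
  eps b * z ^+ n = eps a ->
  exists u : bipoly k, [/\ exists q, b = at_const u q,
    forall y, exists P, y = subst u a P & forall W, exists P, W = subst (eps u) z P].
Proof.
move=> eps_const n_gt1 b0 n0 surj ker relation.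
have [K [zeta [zeta_prim insep]]] := primitive_extension (ltnW n_gt1) n0.
have [sigma hs] := exists_cyclic eps_const surj ker relation (in_alg K).
have s_const omega : const_fixing (sigma omega) by case: (hs omega).
have sE omega (h : omega ^+ n = 1) := (hs omega).2 h.
have zeta1 : zeta != 1.
  by rewrite -[zeta]expr1 -(prim_order_dvd zeta_prim) dvdn1 gtn_eqF.
have semi := z_semi_invariant n_gt1 surj s_const sE (prim_expr_order zeta_prim) zeta1.
have [s [t [st sz]]] := coordinate_of_semi_invariant insep (z_neq0 n_gt1 b0 ker) semi.
have hev_s P : hev (s \o eps) 'X%:P P = s (hev eps z P).
  by rewrite (@morph_hev _ _ _ eps (s \o eps)) // sz.
have [|W|P||] := @straightened k (s \o eps) a b n _ n_gt1 b0 n0.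
- by move=> c /=; rewrite eps_const (auto_const st).
- have [P DP] := surj (t W); exists P.
  by rewrite hev_s -DP (auto_invK st).
- rewrite hev_s => h; apply: ker; apply: (can_inj (autoK st)); rewrite rmorph0; exact: h.
- by rewrite /= -relation (rmorphM s) (rmorphXn s) sz.
move=> u [uq ua uW]; exists u; split=> //; apply: (generators_transport st) => W.
by have [P DP] := uW W; exists P; rewrite sz; exact: DP.
Qed.
(** * Transfer to [{mpoly k[n]}] *)

Lemma ord2_cases (i : 'I_2) : i = 0 \/ i = 1.
Proof. by case: i => [[|[|m]] hi] //; [left | right]; apply: val_inj. Qed.

Lemma ord3_cases (i : 'I_3) : [\/ i = 0, i = 1 | i = 2].
Proof.
by case: i => [[|[|[|m]]] hi] //; [apply: Or31 | apply: Or32 | apply: Or33]; apply: val_inj.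
Qed.

Lemma mpoly_morphism_ext (k S : comNzRingType) n (g h : {rmorphism {mpoly k[n]} -> S}) :
  (forall c, g c%:MP = h c%:MP) -> (forall i, g 'X_i = h 'X_i) -> g =1 h.
Proof.
move=> hC hX p; rewrite (mpolyE p) (rmorph_sum g) (rmorph_sum h); apply: eq_bigr => m _.
rewrite -mul_mpolyC (rmorphM g) (rmorphM h) hC mpolyXE_id (rmorph_prod g) (rmorph_prod h).
by congr (_ * _); apply: eq_bigr => i _; rewrite (rmorphXn g) (rmorphXn h) hX.
Qed.

HB.lock Definition mev (k S : comNzRingType) n (f : {rmorphism k -> S}) (h : 'I_n -> S) :
  {rmorphism {mpoly k[n]} -> S} := mmap f h.

Lemma mevC (k S : comNzRingType) n (f : {rmorphism k -> S}) (h : 'I_n -> S) c :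
  mev f h c%:MP = f c.
Proof. by rewrite [mev]unlock /= mmapC. Qed.

Lemma mevX (k S : comNzRingType) n (f : {rmorphism k -> S}) (h : 'I_n -> S) i :
  mev f h 'X_i = h i.
Proof. by rewrite [mev]unlock /= mmapX mmap1U. Qed.

Section Transfer.
Variable k : fieldType.

Definition mcomp m n (t : n.-tuple {mpoly k[m]}) : {rmorphism {mpoly k[n]} -> {mpoly k[m]}} :=
  comp_mpoly t.

Lemma mcompX m n (t : n.-tuple {mpoly k[m]}) i : 'X_i \mPo t = tnth t i.
Proof. by rewrite comp_mpolyXU -tnth_nth. Qed.

Lemma morph_mcomp m n (S : comNzRingType) (g : {rmorphism {mpoly k[m]} -> S})
    (h : {rmorphism {mpoly k[n]} -> S}) (t : n.-tuple {mpoly k[m]}) p :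
  (forall c, g c%:MP = h c%:MP) -> (forall i, g (tnth t i) = h 'X_i) -> g (p \mPo t) = h p.
Proof.
move=> hC hX; apply: (mpoly_morphism_ext (g := g \o mcomp t) (h := h)) => [c|i] /=.
  by rewrite comp_mpolyC hC.
by rewrite mcompX hX.
Qed.

Lemma in_subalg_comp m n l (T : n.-tuple {mpoly k[m]}) (t : l.-tuple {mpoly k[m]}) P :
  (forall i, in_subalg T (tnth t i)) -> in_subalg T (P \mPo t).
Proof.
move=> ht; have [Q hQ] : exists Q : 'I_l -> {mpoly k[n]}, forall i, tnth t i = Q i \mPo T.
  exact: fin_all_exists ht.
exists (P \mPo [tuple Q i | i < l]); apply/esym.
apply: (morph_mcomp (g := mcomp T) (h := mcomp t)) => [c|i] /=.
  by rewrite !comp_mpolyC.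
by rewrite tnth_mktuple -hQ mcompX.
Qed.

Definition toB : {rmorphism {mpoly k[2]} -> bipoly k} :=
  mev (CC k) (fun i : 'I_2 => if i == 0 then 'X%:P else 'X).
Definition ofB : {rmorphism bipoly k -> {mpoly k[2]}} := ev2 (@mpolyC 2 k) 'X_0 'X_1.

Lemma toB_C c : toB c%:MP = CC k c. Proof. exact: mevC. Qed.
Lemma toB_X : toB 'X_0 = 'X%:P. Proof. exact: mevX. Qed.
Lemma toB_Y : toB 'X_1 = 'X. Proof. exact: mevX. Qed.

Lemma toBK : cancel toB ofB.
Proof.
apply: (mpoly_morphism_ext (g := ofB \o toB) (h := idfun)) => [c|i] /=.
  by rewrite toB_C /ofB /= ev2C.
by case: (ord2_cases i) => ->; rewrite ?toB_X ?toB_Y /ofB /= ?ev2X ?ev2Y.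
Qed.

Lemma ofBK : cancel ofB toB.
Proof.
apply: (bipoly_morphism_ext (g := toB \o ofB) (h := idfun)) => [c||] /=.
- by rewrite /ofB /= ev2C toB_C.
- by rewrite /ofB /= ev2X toB_X.
- by rewrite /ofB /= ev2Y toB_Y.
Qed.

Definition embm : {rmorphism {mpoly k[2]} -> {mpoly k[3]}} := mcomp [tuple 'X_0; 'X_1].

Lemma embm_X : embm 'X_0 = 'X_0. Proof. by rewrite /embm /= mcompX. Qed.
Lemma embm_Y : embm 'X_1 = 'X_1. Proof. by rewrite /embm /= mcompX. Qed.
Lemma embm_C c : embm c%:MP = c%:MP. Proof. exact: comp_mpolyC. Qed.

Definition toT : {rmorphism {mpoly k[3]} -> {poly bipoly k}} :=
  mev (CCs k) (fun i : 'I_3 => if i == 0 then 'X%:P%:P else if i == 1 then 'X%:P else 'X).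
Definition ofT : {rmorphism {poly bipoly k} -> {mpoly k[3]}} := hev (embm \o ofB) 'X_2.

Lemma toT_emb p : toT (embm p) = (toB p)%:P.
Proof.
apply: (mpoly_morphism_ext (g := toT \o embm) (h := polyC \o toB)) => [c|i] /=.
  by rewrite embm_C toB_C [LHS]mevC CCsE.
by case: (ord2_cases i) => ->; rewrite ?embm_X ?embm_Y ?toB_X ?toB_Y [LHS]mevX.
Qed.

Lemma toT_Z : toT 'X_2 = 'X. Proof. exact: mevX. Qed.

Lemma ofTK : cancel ofT toT.
Proof.
move=> P; rewrite [LHS](@morph_hev _ _ _ _ polyC) => [|c].
  by elim/poly_ind: P => [|P c IH]; rewrite ?rmorph0 // hev_MXaddC IH toT_Z.
by rewrite /= toT_emb ofBK.
Qed.

Lemma toTK : cancel toT ofT.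
Proof.
apply: (mpoly_morphism_ext (g := ofT \o toT) (h := idfun)) => [c|i] /=.
  by rewrite [toT _]mevC -CCsE [LHS]hevC /= -toB_C toBK embm_C.
case: (ord3_cases i) => ->.
- by rewrite -embm_X toT_emb [LHS]hevC /= toBK.
- by rewrite -embm_Y toT_emb [LHS]hevC /= toBK.
- by rewrite toT_Z [LHS]hevX.
Qed.

Lemma ofB_subst A B P : ofB (subst A B P) = ofB P \mPo [tuple ofB A; ofB B].
Proof.
apply: (bipoly_morphism_ext (g := ofB \o subst A B)
  (h := mcomp [tuple ofB A; ofB B] \o ofB)) => [c||] /=.
- by rewrite !ev2C comp_mpolyC.
- by rewrite !ev2X mcompX.
- by rewrite !ev2Y mcompX.
Qed.

Lemma ofB_at_const u q : ofB (at_const u q) = hev (@mpolyC 1 k) 'X_0 q \mPo [tuple ofB u].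
Proof.
rewrite at_constE -hevE [LHS](@morph_hev _ _ _ _ (@mpolyC 2 k)) => [|c].
  rewrite [RHS](@morph_hev _ _ _ _ (@mpolyC 2 k) (mcomp [tuple ofB u])) => [|c] /=.
    by rewrite mcompX.
  by rewrite comp_mpolyC.
by rewrite /ofB /= ev2C.
Qed.

End Transfer.
Theorem theorem4p5 (k : fieldType) (a b : {mpoly k[2]}) (n : nat)
  (t : 3.-tuple {mpoly k[2]}) :
  b != 0 -> (2 <= n)%N ->
  (forall p : nat, p \in [pchar k] -> ~~ (p %| n)%N) ->
  quot_iso_poly2 (embXY b * 'X_2 ^+ n - embXY a) t ->
  let g := embXY b * 'X_2 ^+ n - embXY a in
  exists u : {mpoly k[2]},
    (* B = k[U, V] with U = image of u, V = image of Z *)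
    (forall s : {mpoly k[2]},
        in_subalg [tuple embXY u \mPo t; 'X_2 \mPo t] s) /\
    (* b \in k[U] *)
    in_subalg [tuple u] b /\
    (* k[X,Y] = k[U, a] *)
    (forall x : {mpoly k[2]}, in_subalg [tuple u; a] x) /\
    (* k[X,Y,Z] = k[U, g, Z] *)
    (forall p : {mpoly k[3]}, in_subalg [tuple embXY u; g; 'X_2] p).
Proof.
move=> b0 n2 pn [surj ker] g.
pose red : {rmorphism {mpoly k[3]} -> {mpoly k[2]}} := mcomp t.
pose eps : {rmorphism bipoly k -> bipoly k} := toB k \o red \o embm k \o ofB k.
pose z := toB k ('X_2 \mPo t).
have eps_const : const_fixing eps.
  by move=> c; rewrite /eps /= -toB_C toBK embm_C /red /= comp_mpolyC.
have hevE' P : hev eps z P = toB k (ofT k P \mPo t).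
  by rewrite [RHS](@morph_hev _ _ _ _ eps (toB k \o red)).
have to_g : toT k g = (toB k b)%:P * 'X^n - (toB k a)%:P.
  by rewrite rmorphB rmorphM rmorphXn /= toT_Z -!toT_emb.
have b'0 : toB k b != 0 by rewrite -(rmorph0 (toB k)) (can_eq (@toBK k)).
have n0 : n%:R != 0 :> k.
  apply/negP => hn; have [p pc] := natf0_pchar (ltnW n2) hn.
  by have := pn p pc; rewrite (dvdn_pcharf pc) hn.
have relation : eps (toB k b) * z ^+ n = eps (toB k a).
  have gt0 : red g = 0 by apply/ker; exists 1; rewrite mul1r.
  apply/eqP; rewrite -subr_eq0 -(rmorph0 (toB k)) -gt0 /eps /z /= !toBK /g.
  rewrite -[comp_mpoly t (_ - _)]/(red (embm k b * 'X_2 ^+ n - embm k a)).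
  rewrite (rmorphB red) (rmorphM red) (rmorphXn red) (rmorphB (toB k)) (rmorphM (toB k)).
  by rewrite (rmorphXn (toB k)).
have [|P|u [[q Dq] ua uW]] := @cyclic_surface k eps (toB k a) (toB k b) z n eps_const n2 b'0 n0
    _ _ relation.
- move=> s; have [p Dp] := surj (ofB k s); exists (toT k p).
  by rewrite hevE' toTK -Dp ofBK.
- rewrite hevE' -(rmorph0 (toB k)) => /(can_inj (@toBK k)) /ker [Q DQ]; exists (toT k Q).
  by rewrite -to_g -rmorphM -DQ ofTK.
have Db : b = hev (@mpolyC 1 k) 'X_0 q \mPo [tuple ofB k u] by rewrite -ofB_at_const -Dq toBK.
have Dx x : exists P, x = P \mPo [tuple ofB k u; a].
  have [P DP] := ua (toB k x); exists (ofB k P).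
  by rewrite -[LHS](@toBK k) DP ofB_subst toBK.
exists (ofB k u); split; [|split; [|split]] => //.
- move=> s; have [P DP] := uW (toB k s); exists (ofB k P).
  by rewrite -[LHS](@toBK k) DP ofB_subst toBK /eps /= toBK.
- by exists (hev (@mpolyC 1 k) 'X_0 q).
move=> p; set T := [tuple embXY (ofB k u); g; 'X_2].
have gen i : in_subalg T (tnth T i) by exists 'X_i; rewrite mcompX.
have emb m (tt : m.-tuple {mpoly k[2]}) P :
    (forall i, in_subalg T (embXY (tnth tt i))) -> in_subalg T (embXY (P \mPo tt)).
  move=> htt; have -> : embXY (P \mPo tt) = P \mPo [tuple embXY (tnth tt i) | i < m].
    apply: (morph_mcomp (g := embm k) (h := mcomp [tuple embXY (tnth tt i) | i < m])).
      by move=> c; rewrite embm_C /= comp_mpolyC.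
    by move=> i; rewrite /= mcompX tnth_mktuple.
  by apply: in_subalg_comp => i; rewrite tnth_mktuple.
have emb_b : in_subalg T (embXY b).
  by rewrite Db; apply: emb => i; rewrite (ord1 i); exact: (gen 0).
(* From [g = b Z^n - a], with [b] already in [k[U]], one recovers [a = b Z^n - g], and then all of
   [k[X,Y] = k[U, a]]. *)
have emb_a : in_subalg T (embXY a).
  have -> : embXY a = ('X_0 * 'X_2 ^+ n - 'X_1) \mPo [tuple embXY b; g; 'X_2].
    by rewrite comp_mpolyB rmorphM rmorphXn /= !mcompX /g subKr.
  apply: in_subalg_comp => i; case: (ord3_cases i) => -> //; [exact: (gen 1) | exact: (gen 2)].
have emb_x x : in_subalg T (embXY x).
  have [P ->] := Dx x; apply: emb => i; case: (ord2_cases i) => -> //; exact: (gen 0).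
rewrite -(comp_mpoly_id p); apply: in_subalg_comp => i; rewrite tnth_mktuple.
case: (ord3_cases i) => ->; last exact: (gen 2).
  by rewrite -embm_X; exact: emb_x.
by rewrite -embm_Y; exact: emb_x.
Qed.
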